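(* (Variational principle for a holomorphic correspondence.) Let $\Gamma$ be a holomorphic correspondence on $\widehat{\mathbb{C}}$ and let $f\in\mathcal{C}(\widehat{\mathbb{C}},\mathbb{R})$ be a continuous real-valued function. Then the topological pressure of $f$ with respect to $\Gamma$ satisfies $$\mathrm{Pr}(\Gamma,f)=\sup_{\nu\in\mathscr{S}^{\Gamma}}\left\{h_\nu(\Gamma)+\int f\,\mathrm{d}\nu\right\},$$ where $h_\nu(\Gamma)$ denotes the measure-theoretic entropy of $\Gamma$ with respect to $\nu$.
   Context: Holomorphic correspondence: $\Gamma\subseteq\widehat{\mathbb{C}}\times\widehat{\mathbb{C}}$ is a formal linear combination $\Gamma=\sum_{t=1}^{M}\Gamma_t$ of irreducible complex-analytic subvarieties $\Gamma_t$ of $\widehat{\mathbb{C}}\times\widehat{\mathbb{C}}$, repeated according to their multiplicities, such that, with $\pi_i$ the projection onto the $i$-th coordinate ($i=1,2$): (1) $\pi_i|_{\Gamma_t}$ is surjective for $i=1,2$ and every $1\le t\le M$; (2) for every $t$ and every generic $x_0\in\widehat{\mathbb{C}}$ the sets $\pi_1(\pi_2^{-1}(\{x_0\})\cap\Gamma_t)$ and $\pi_2(\pi_1^{-1}(\{x_0\})\cap\Gamma_t)$ are finite. Finite paths and pressure: for $n\ge1$, $\mathscr{P}_n^{\Gamma}(\widehat{\mathbb{C}})$ is the set of all $(x_0,\dots,x_n;\alpha_1,\dots,\alpha_n)$ with $x_r\in\widehat{\mathbb{C}}$, $\alpha_r\in\{1,\dots,M\}$, $(x_{r-1},x_r)\in\Gamma_{\alpha_r}$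 for $1\le r\le n$. Let $d_{\widehat{\mathbb{C}}}$ be the spherical metric. Given $\epsilon>0$, two points $(x_r;\alpha_r)$, $(y_r;\beta_r)$ of $\mathscr{P}_n^{\Gamma}(\widehat{\mathbb{C}})$ are $(n,\epsilon)$-separated if $d_{\widehat{\mathbb{C}}}(x_r,y_r)>\epsilon$ for some $0\le r\le n$ or $\alpha_r\ne\beta_r$ for some $1\le r\le n$; a subset $\mathcal{F}$ is $(n,\epsilon)$-separated if any two distinct points of it are. A subset $\mathcal{G}\subseteq\mathscr{P}_n^{\Gamma}(\widehat{\mathbb{C}})$ is $(n,\epsilon)$-spanning if for every $(x_r;\alpha_r)\in\mathscr{P}_n^{\Gamma}(\widehat{\mathbb{C}})$ there is $(y_r;\alpha_r)\in\mathcal{G}$ (same $\alpha$'s) with $d_{\widehat{\mathbb{C}}}(x_r,y_r)<\epsilon$ for all $0\le r\le n$. For $f\in\mathcal{C}(\widehat{\mathbb{C}},\mathbb{R})$, $$\mathrm{Pr}(\Gamma,f)=\lim_{\epsilon\to0}\limsup_{n\to\infty}\frac1n\log\sup_{\mathcal{F}}\sum_{(x_0,\dots,x_n;\alpha_1,\dots,\alpha_n)\in\mathcal{F}}\ \prod_{p=0}^{n-1}e^{f(x_p)},$$ the supremum over $(n,\epsilon)$-separated sets $\mathcal{F}\subseteq\mathscr{P}_n^{\Gamma}(\widehat{\mathbb{C}})$; equivalently, the same expression with $\sup_{\mathcal{F}}$ replaced by the infimum over $(n,\epsilon)$-spanning sets $\mathcal{G}$ and the sum taken over $\mathcal{G}$.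 Infinite path space: $\mathscr{P}^{\Gamma}(\widehat{\mathbb{C}})$ is the set of all $(x_0,x_1,x_2,\dots;\alpha_1,\alpha_2,\dots)$ with $x_r\in\widehat{\mathbb{C}}$, $\alpha_r\in\{1,\dots,M\}$ and $(x_{r-1},x_r)\in\Gamma_{\alpha_r}$ for all $r\ge 1$. It is a compact metric space with the metric $$\Delta\big((x_r;\alpha_r),(y_r;\beta_r)\big)=\max\Big\{\sup_{r\ge 0}2^{-r}d_{\widehat{\mathbb{C}}}(x_r,y_r),\ \sup_{r\ge1}2^{-r}(1-\delta_{(\alpha_r,\beta_r)})\Big\},$$ $\delta_{(p,q)}$ the Kronecker delta. The shift is $\sigma^{\Gamma}(x_0,x_1,\dots;\alpha_1,\alpha_2,\dots)=(x_1,x_2,\dots;\alpha_2,\alpha_3,\dots)$, which is continuous. Projections: $\Pi_r(x_0,x_1,\dots;\alpha_1,\dots)=x_r$ for $r\ge0$ and $\mathrm{Proj}_r(x_0,x_1,\dots;\alpha_1,\dots)=\alpha_r$ for $r\ge1$. Measures: $\mathscr{M}(\widehat{\mathbb{C}})$ is the set of Borel probability measures on $\widehat{\mathbb{C}}$; $\mathscr{M}_{\sigma^{\Gamma}}(\mathscr{P}^{\Gamma}(\widehat{\mathbb{C}}))$ is the set of $\sigma^{\Gamma}$-invariant Borel probability measures on $\mathscr{P}^{\Gamma}(\widehat{\mathbb{C}})$; $((\Pi_0)_*\mu)(B)=\mu(\Pi_0^{-1}B)$ for Borel $B\subset\widehat{\mathbb{C}}$; and $\mathscr{S}^{\Gamma}=\{\nu\in\mathscr{M}(\widehat{\mathbb{C}}):\nu=(\Pi_0)_*\mu\text{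 for some }\mu\in\mathscr{M}_{\sigma^{\Gamma}}(\mathscr{P}^{\Gamma}(\widehat{\mathbb{C}}))\}$. Entropies: for a finite measurable collection $\mathcal{A}=\{A_1,\dots,A_s\}$ of subsets of $\mathscr{P}^{\Gamma}(\widehat{\mathbb{C}})$ put $H_\mu(\mathcal{A})=-\sum_i\mu(A_i)\log\mu(A_i)$ (with $0\log0=0$), and $\mathcal{A}\vee\mathcal{B}=\{A\cap B:A\in\mathcal{A},B\in\mathcal{B}\}$. For a finite $\nu$-measurable partition $\mathcal{Q}=\{Q_1,\dots,Q_s\}$ of $\widehat{\mathbb{C}}$ and $\mu\in\mathscr{M}_{\sigma^{\Gamma}}(\mathscr{P}^{\Gamma}(\widehat{\mathbb{C}}))$ with $\nu=(\Pi_0)_*\mu$, define $$H_{(\nu,\mu)}(\mathcal{Q};\Gamma)=\lim_{n\to\infty}\frac1n H_\mu\left(\bigvee_{p=0}^{n-1}\left\{\Pi_p^{-1}(Q_i)\cap\mathrm{Proj}_{p+1}^{-1}(\{t\}):1\le i\le s,\ 1\le t\le M\right\}\right),$$ $h_{(\nu,\mu)}(\Gamma)=\sup_{\mathcal{Q}}H_{(\nu,\mu)}(\mathcal{Q};\Gamma)$ (supremum over finite $\nu$-measurable partitions of $\widehat{\mathbb{C}}$), and, for $\nu\in\mathscr{S}^{\Gamma}$, the measure-theoretic entropy $$h_\nu(\Gamma)=\sup\left\{h_{(\nu,\mu)}(\Gamma):\mu\in\mathscr{M}_{\sigma^{\Gamma}}(\mathscr{P}^{\Gamma}(\widehat{\mathbb{C}})),\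 \nu=(\Pi_0)_*\mu\right\}.$$ *)

(* Defs.v *)
From HB Require Import structures.
From mathcomp Require Import all_boot all_order all_algebra.
From mathcomp Require Import complex.
From mathcomp Require Import all_classical all_reals all_analysis.
From mathcomp Require Import ring lra.

Set Implicit Arguments.
Unset Strict Implicit.
Unset Printing Implicit Defensive.

Import Order.TTheory GRing.Theory Num.Theory.
Import numFieldNormedType.Exports.

Local Open Scope classical_set_scope.
Local Open Scope ring_scope.

(* [Some z] is the finite point z and [None] is the point at infinity; the
   topology is the one of the great-circle metric below. *)
Definition sphere (R : realType) : Type := option R[i].

HB.instance Definition _ (R : realType) := Choice.on (sphere R).
HB.instance Definition _ (R : realType) := Pointed.on (sphere R).

Section spherical_metric.
Context {R : realType}.
Implicit Types (x y : sphere R) (u v w : R * R * R).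

Definition dot3 u v : R := u.1.1 * v.1.1 + u.1.2 * v.1.2 + u.2 * v.2.

(* Inverse of the stereographic projection from the north pole (0, 0, 1) of
   the unit sphere. *)
Definition stereo x : R * R * R :=
  if x is Some z then
    let a := complex.Re z in let b := complex.Im z in
    let N := 1 + a ^+ 2 + b ^+ 2 in
    (2 * a / N, 2 * b / N, (a ^+ 2 + b ^+ 2 - 1) / N)
  else (0, 0, 1).

Definition spherical_dist x y : R := acos (dot3 (stereo x) (stereo y)).

Lemma stereo_unit x : dot3 (stereo x) (stereo x) = 1.
Proof.
case: x => [z|]; rewrite /dot3 /=; last by ring.
set a := complex.Re z; set b := complex.Im z.
have N0 : 1 + a ^+ 2 + b ^+ 2 != 0.
  by apply: lt0r_neq0; have := sqr_ge0 a; have := sqr_ge0 b; lra.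
by field.
Qed.

Lemma dot3C u v : dot3 u v = dot3 v u.
Proof. by rewrite /dot3; ring. Qed.

Lemma dot3_itv u v : dot3 u u = 1 -> dot3 v v = 1 -> -1 <= dot3 u v <= 1.
Proof.
case: u => -[u1 u2] u3; case: v => -[v1 v2] v3; rewrite /dot3 /= => hu hv.
have := sqr_ge0 (u1 - v1); have := sqr_ge0 (u2 - v2).
have := sqr_ge0 (u3 - v3); have := sqr_ge0 (u1 + v1).
have := sqr_ge0 (u2 + v2); have := sqr_ge0 (u3 + v3).
by move=> *; apply/andP; split; nra.
Qed.

Lemma stereo_itv x y : -1 <= dot3 (stereo x) (stereo y) <= 1.
Proof. by apply: dot3_itv; exact: stereo_unit. Qed.

Lemma dot3_eq1 u v : dot3 u u = 1 -> dot3 v v = 1 -> dot3 u v = 1 -> u = v.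
Proof.
case: u => -[u1 u2] u3; case: v => -[v1 v2] v3; rewrite /dot3 /= => hu hv h.
have h1 := sqr_ge0 (u1 - v1); have h2 := sqr_ge0 (u2 - v2).
have h3 := sqr_ge0 (u3 - v3).
have hs : (u1 - v1) ^+ 2 + (u2 - v2) ^+ 2 + (u3 - v3) ^+ 2 = 0.
  transitivity ((u1 * u1 + u2 * u2 + u3 * u3) + (v1 * v1 + v2 * v2 + v3 * v3)
     - 2 * (u1 * v1 + u2 * v2 + u3 * v3)); first by ring.
  by rewrite hu hv h; ring.
have e1 : (u1 - v1) ^+ 2 = 0 by lra.
have e2 : (u2 - v2) ^+ 2 = 0 by lra.
have e3 : (u3 - v3) ^+ 2 = 0 by lra.
move/eqP : e1; rewrite sqrf_eq0 subr_eq0 => /eqP ->.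
move/eqP : e2; rewrite sqrf_eq0 subr_eq0 => /eqP ->.
by move/eqP : e3; rewrite sqrf_eq0 subr_eq0 => /eqP ->.
Qed.

Lemma gram_ge0 u v w : dot3 u u = 1 -> dot3 v v = 1 -> dot3 w w = 1 ->
  (dot3 u v * dot3 v w - dot3 u w) ^+ 2 <=
  (1 - dot3 u v ^+ 2) * (1 - dot3 v w ^+ 2).
Proof.
case: u => -[u1 u2] u3; case: v => -[v1 v2] v3; case: w => -[w1 w2] w3 hu hv hw.
pose D := u1 * (v2 * w3 - v3 * w2) - u2 * (v1 * w3 - v3 * w1)
        + u3 * (v1 * w2 - v2 * w1).
rewrite -subr_ge0.
set U := (u1, u2, u3); set V := (v1, v2, v3); set W := (w1, w2, w3).
have -> : (1 - dot3 U V ^+ 2) * (1 - dot3 V W ^+ 2) -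
   (dot3 U V * dot3 V W - dot3 U W) ^+ 2 = D ^+ 2.
  transitivity (dot3 U U * dot3 V V * dot3 W W
    - dot3 U V ^+ 2 * dot3 W W - dot3 V W ^+ 2 * dot3 U U
    - dot3 U W ^+ 2 * dot3 V V + 2 * dot3 U V * dot3 V W * dot3 U W).
    by rewrite hu hv hw; ring.
  by rewrite /dot3 /D /=; ring.
exact: sqr_ge0.
Qed.

Lemma stereo_inj : injective stereo.
Proof.
have N0 (a b : R) : 1 + a ^+ 2 + b ^+ 2 != 0.
  by apply: lt0r_neq0; have := sqr_ge0 a; have := sqr_ge0 b; lra.
have key (a b : R) : 1 - (a ^+ 2 + b ^+ 2 - 1) / (1 + a ^+ 2 + b ^+ 2)
    = 2 / (1 + a ^+ 2 + b ^+ 2) by field; exact: N0.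
have key0 (a b : R) : 2 / (1 + a ^+ 2 + b ^+ 2) != 0.
  by rewrite mulf_neq0 ?invr_neq0 // pnatr_eq0.
case=> [[a b]|] [[c d]|] //= [].
- move=> h1 h2 h3.
  have := key a b; rewrite h3 key => h.
  have h' : 2 * a / (1 + a ^+ 2 + b ^+ 2) = a * (2 / (1 + a ^+ 2 + b ^+ 2)).
    by ring.
  have k' : 2 * c / (1 + c ^+ 2 + d ^+ 2) = c * (2 / (1 + c ^+ 2 + d ^+ 2)).
    by ring.
  have h'' : 2 * b / (1 + a ^+ 2 + b ^+ 2) = b * (2 / (1 + a ^+ 2 + b ^+ 2)).
    by ring.
  have k'' : 2 * d / (1 + c ^+ 2 + d ^+ 2) = d * (2 / (1 + c ^+ 2 + d ^+ 2)).
    by ring.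
  move: h1; rewrite h' k' -h => /(mulIf (key0 _ _)) ->.
  by move: h2; rewrite h'' k'' -h => /(mulIf (key0 _ _)) ->.
- by move=> _ _ h; have := key a b; rewrite h subrr => /esym/eqP; rewrite (negbTE (key0 _ _)).
- by move=> _ _ h; have := key c d; rewrite -h subrr => /esym/eqP; rewrite (negbTE (key0 _ _)).
Qed.

Lemma spherical_distxx x : spherical_dist x x = 0.
Proof. by rewrite /spherical_dist stereo_unit acos1. Qed.

Lemma spherical_dist_positivity x y : spherical_dist x y = 0 -> x = y.
Proof.
move=> h; apply: stereo_inj; apply: dot3_eq1; rewrite ?stereo_unit //.
by rewrite -(@acosK R (dot3 _ _)) ?in_itv/= ?stereo_itv // -/(spherical_dist x y) h cos0.
Qed.

Lemma spherical_distC x y : spherical_dist x y = spherical_dist y x.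
Proof. by rewrite /spherical_dist dot3C. Qed.

Lemma spherical_dist_ge0 x y : 0 <= spherical_dist x y.
Proof. by rewrite acos_ge0 // stereo_itv. Qed.

Lemma spherical_dist_lepi x y : spherical_dist x y <= pi.
Proof. by rewrite acos_lepi // stereo_itv. Qed.

Lemma spherical_dist_triangle y x z :
  spherical_dist x z <= spherical_dist x y + spherical_dist y z.
Proof.
have [h|h] := leP pi (spherical_dist x y + spherical_dist y z).
  exact: le_trans (spherical_dist_lepi _ _) h.
rewrite leNgt -ltr_cos ?in_itv/= ?spherical_dist_ge0 ?spherical_dist_lepi //;
  last by rewrite addr_ge0 ?spherical_dist_ge0 //= ltW.
rewrite -leNgt cosD /spherical_dist !acosK ?in_itv/= ?stereo_itv //.
rewrite !sin_acos ?stereo_itv //.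
set p := dot3 _ _; set q := dot3 _ _; set r := dot3 _ _.
have := @gram_ge0 (stereo x) (stereo y) (stereo z)
  (stereo_unit _) (stereo_unit _) (stereo_unit _).
rewrite -/p -/q -/r => hg.
have hp : 0 <= 1 - p ^+ 2 by have /andP[] := stereo_itv x y; rewrite -/p => *; nra.
rewrite -sqrtrM // lerBlDl -lerBlDr.
by apply: le_trans (ler_norm _) _; rewrite -sqrtr_sqr ler_wsqrtr.
Qed.

End spherical_metric.

HB.instance Definition _ (R : realType) := @isMetric.Build R (sphere R)
  (@spherical_dist R) (@spherical_distxx R) (@spherical_dist_positivity R)
  (@spherical_distC R) (@spherical_dist_triangle R).

(* The two standard holomorphic charts z |-> z and w |-> 1/w; each is a
   biholomorphism from the complex plane onto the complement of a point. *)
Definition chart (R : realType) (at_infinity : bool) (z : R[i]^o) : sphere R :=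
  if at_infinity then (if z == 0 then None else Some z^-1) else Some z.

(* [differentiable] is over the field R[i], so that g k is holomorphic on U. *)
Definition analytic_set (R : realType) (A : set (sphere R * sphere R)) : Prop :=
  forall (i j : bool) (p : R[i]^o * R[i]^o),
    exists (U : set (R[i]^o * R[i]^o)) (m : nat)
           (g : 'I_m -> R[i]^o * R[i]^o -> R[i]^o),
      [/\ open U, U p, (forall k q, U q -> differentiable (g k) q)
        & forall q, U q ->
            (A (chart i q.1, chart j q.2) <-> forall k, g k q = 0)].

Definition irreducible_analytic_set (R : realType)
    (A : set (sphere R * sphere R)) : Prop :=
  [/\ analytic_set A, A !=set0
    & forall B C, analytic_set B -> analytic_set C -> A = B `|` C ->
        A = B \/ A = C].

(* The formal sum of the irreducible components, each repeated according to
   its multiplicity, is the family [component], which need not be injective. *)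
Record correspondence (R : realType) := Correspondence {
  ncomp : nat ;
  component : 'I_ncomp -> set (sphere R * sphere R) ;
  ncomp_gt0 : (0 < ncomp)%N ;
  component_irreducible : forall t, irreducible_analytic_set (component t) ;
  component_surj1 : forall t, fst @` component t = setT ;
  component_surj2 : forall t, snd @` component t = setT ;
  (* "generic" means outside of a proper analytic subset of the sphere, that
     is, outside of a finite set *)
  component_finite1 : forall t, exists2 E : set (sphere R), finite_set E &
    forall x0, ~ E x0 -> finite_set (fst @` (snd @^-1` [set x0] `&` component t)) ;
  component_finite2 : forall t, exists2 E : set (sphere R), finite_set E &
    forall x0, ~ E x0 -> finite_set (snd @` (fst @^-1` [set x0] `&` component t))
}.

Section pressure.
Context {R : realType} (Gamma : correspondence R).

(* In (x, a) the letter [a r] joins x_r to x_{r+1}: it is alpha_{r+1}. *)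
Definition finite_path_type (n : nat) : Type :=
  ({ffun 'I_n.+1 -> sphere R} * {ffun 'I_n -> 'I_(ncomp Gamma)})%type.

HB.instance Definition _ n := Choice.on (finite_path_type n).

Definition finite_paths (n : nat) : set (finite_path_type n) :=
  [set p : finite_path_type n | forall r : 'I_n,
    component (p.2 r) (p.1 (widen_ord (leqnSn n) r), p.1 (lift ord0 r))].

Definition separated_points (n : nat) (e : R) (p q : finite_path_type n) : Prop :=
  (exists r, e < mdist (p.1 r) (q.1 r)) \/ (exists r, p.2 r <> q.2 r).

Definition separated_set (n : nat) (e : R) (F : set (finite_path_type n)) : Prop :=
  F `<=` @finite_paths n /\
  forall p q, F p -> F q -> p <> q -> separated_points e p q.

Definition separated_sum (f : sphere R -> R) (n : nat)
    (F : set (finite_path_type n)) : \bar R :=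
  (\esum_(p in F) (\prod_(k < n) expR (f (p.1 (widen_ord (leqnSn n) k))))%:E)%E.

Definition pressure_at (f : sphere R -> R) (e : R) : \bar R :=
  limn_esup (fun n : nat => ((n%:R^-1)%:E *
    lne (ereal_sup [set separated_sum f F | F in @separated_set n e]))%E).

Definition pressure (f : sphere R -> R) : \bar R :=
  lim (pressure_at f e @[e --> 0^'+]).

End pressure.

(* As for finite paths, [letter p r] is alpha_{r+1}. *)
Record path_space (R : realType) (Gamma : correspondence R) := PathSpace {
  vertex : nat -> sphere R ;
  letter : nat -> 'I_(ncomp Gamma) ;
  path_spaceP : forall r, component (letter r) (vertex r, vertex r.+1)
}.

HB.instance Definition _ (R : realType) (Gamma : correspondence R) :=
  gen_eqMixin (path_space Gamma).
HB.instance Definition _ (R : realType) (Gamma : correspondence R) :=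
  gen_choiceMixin (path_space Gamma).

Section path_space_theory.
Context {R : realType} {Gamma : correspondence R}.
Implicit Types p q : path_space Gamma.

Lemma path_space_eq p q : vertex p = vertex q -> letter p = letter q -> p = q.
Proof.
case: p q => [x a ha] [y b hb] /= xy ab.
by subst; congr PathSpace; exact: Prop_irrelevance.
Qed.

Lemma component_next (t : 'I_(ncomp Gamma)) x : {y | component t (x, y)}.
Proof.
apply: cid; have : (fst @` component t) x by rewrite component_surj1.
by move=> [[x' y]] /= h <-; exists y.
Qed.

Definition some_path : path_space Gamma :=
  let t0 := Ordinal (ncomp_gt0 Gamma) in
  @PathSpace R Gamma (fun r => iter r (fun x => sval (component_next t0 x)) point)
    (fun=> t0) (fun r => svalP (component_next t0 _)).

Definition path_term1 p q (r : nat) : R :=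
  2 ^- r * mdist (vertex p r) (vertex q r).

Definition path_term2 p q (r : nat) : R :=
  2 ^- r.+1 * (letter p r != letter q r)%:R.

Definition path_dist p q : R :=
  Num.max (sup (range (path_term1 p q))) (sup (range (path_term2 p q))).

Let exp2_le1 r : (2 ^- r : R) <= 1.
Proof. by rewrite invf_le1 ?exprn_gt0 // exprn_ege1 // ler1n. Qed.

Let exp2_gt0 r : 0 < (2 ^- r : R).
Proof. by rewrite invr_gt0 exprn_gt0. Qed.

Lemma path_term1_ub p q : has_ubound (range (path_term1 p q)).
Proof.
exists pi => _ [r _ <-]; rewrite /path_term1.
apply: le_trans (spherical_dist_lepi (vertex p r) (vertex q r)).
by rewrite ler_piMl // spherical_dist_ge0.
Qed.

Lemma path_term2_ub p q : has_ubound (range (path_term2 p q)).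
Proof.
exists 1 => _ [r _ <-]; rewrite /path_term2.
by case: (_ != _); rewrite ?mulr1 ?mulr0.
Qed.

Lemma path_term1_le p q r : path_term1 p q r <= path_dist p q.
Proof.
rewrite /path_dist le_max; apply/orP; left.
by apply: ub_le_sup; [exact: path_term1_ub | exists r].
Qed.

Lemma path_term2_le p q r : path_term2 p q r <= path_dist p q.
Proof.
rewrite /path_dist le_max; apply/orP; right.
by apply: ub_le_sup; [exact: path_term2_ub | exists r].
Qed.

Lemma path_dist_le p q c : (forall r, path_term1 p q r <= c) ->
  (forall r, path_term2 p q r <= c) -> path_dist p q <= c.
Proof.
move=> h1 h2; rewrite /path_dist ge_max.
apply/andP; split; apply: ge_sup.
- by exists (path_term1 p q 0%N), 0%N.
- by move=> _ [r _ <-].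
- by exists (path_term2 p q 0%N), 0%N.
- by move=> _ [r _ <-].
Qed.

Lemma path_term1_ge0 p q r : 0 <= path_term1 p q r.
Proof. by rewrite mulr_ge0 // ?mdist_ge0 // ltW. Qed.

Lemma path_term2_ge0 p q r : 0 <= path_term2 p q r.
Proof. by rewrite mulr_ge0 // ltW. Qed.

Lemma path_distxx p : path_dist p p = 0.
Proof.
apply/eqP; rewrite eq_le; apply/andP; split; last first.
  exact: le_trans (path_term1_ge0 p p 0%N) (path_term1_le _ _ _).
by apply: path_dist_le => r;
  rewrite /path_term1 /path_term2 ?mdistxx ?eqxx mulr0.
Qed.

Lemma path_dist_positivity p q : path_dist p q = 0 -> p = q.
Proof.
move=> h; apply: path_space_eq; apply/funext => r.
- apply: (@mdist_positivity R); apply/eqP; rewrite eq_le mdist_ge0 andbT.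
  by have := path_term1_le p q r; rewrite h /path_term1 pmulr_rle0.
- have := path_term2_le p q r.
  rewrite h /path_term2 pmulr_rle0 //.
  by case: eqVneq => //=; rewrite ler10.
Qed.

Lemma path_distC p q : path_dist p q = path_dist q p.
Proof.
have e1 : path_term1 p q = path_term1 q p.
  by apply/funext => r; rewrite /path_term1 metric_sym.
have e2 : path_term2 p q = path_term2 q p.
  by apply/funext => r; rewrite /path_term2 eq_sym.
by rewrite /path_dist e1 e2.
Qed.

Lemma path_dist_triangle q p s :
  path_dist p s <= path_dist p q + path_dist q s.
Proof.
apply: path_dist_le => r.
- apply: (@le_trans _ _ (path_term1 p q r + path_term1 q s r)).
    by rewrite /path_term1 -mulrDr ler_wpM2l ?metric_triangle // ltW.
  by rewrite lerD // path_term1_le.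
- apply: (@le_trans _ _ (path_term2 p q r + path_term2 q s r)).
    rewrite /path_term2 -mulrDr; apply: ler_wpM2l; first exact: ltW (exp2_gt0 _).
    rewrite -natrD ler_nat.
    case: (eqVneq (letter p r) (letter q r)) => [->|_] //.
    by case: (_ != _); case: (_ != _).
  by rewrite lerD // path_term2_le.
Qed.

Lemma shift_subproof p r :
  component (letter p r.+1) (vertex p r.+1, vertex p r.+2).
Proof. exact: path_spaceP. Qed.

Definition path_shift p : path_space Gamma :=
  @PathSpace R Gamma (fun r => vertex p r.+1) (fun r => letter p r.+1)
    (shift_subproof p).

End path_space_theory.

HB.instance Definition _ (R : realType) (Gamma : correspondence R) :=
  isPointed.Build (path_space Gamma) some_path.

HB.instance Definition _ (R : realType) (Gamma : correspondence R) :=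
  @isMetric.Build R (path_space Gamma) (@path_dist R Gamma)
    (@path_distxx R Gamma) (@path_dist_positivity R Gamma)
    (@path_distC R Gamma) (@path_dist_triangle R Gamma).

Notation borel T := (g_sigma_algebraType (@open T)).

(* Collections of sets are sets of sets, so a set that arises several times in
   a join (only the empty set, for joins of partitions) is counted once. *)
Definition collection_join (T : Type) (A B : set (set T)) : set (set T) :=
  [set a `&` b | a in A & b in B].

Definition collection_entropy (R : realType) (d : measure_display)
    (T : measurableType d)
    (mu : probability T R) (A : set (set T)) : R :=
  - \sum_(a \in A) fine (mu a) * ln (fine (mu a)).

Section measure_entropy.
Context {R : realType} (Gamma : correspondence R).
Implicit Types (mu : probability (borel (path_space Gamma)) R)
  (nu : probability (borel (sphere R)) R).

Definition shift_invariant mu : Prop :=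
  forall B : set (borel (path_space Gamma)), measurable B ->
    mu (path_shift @^-1` B) = mu B.

Definition is_marginal nu mu : Prop :=
  forall B : set (borel (sphere R)), measurable B ->
    nu B = mu ((fun p => vertex p 0) @^-1` B).

Definition marginals : set (probability (borel (sphere R)) R) :=
  [set nu | exists2 mu, shift_invariant mu & is_marginal nu mu].

Definition measurable_partition (s : nat) (Q : 'I_s -> set (borel (sphere R))) :
    Prop :=
  partition [set: 'I_s] Q [set: borel (sphere R)] /\
  forall i, measurable (Q i).

Definition cylinders (s : nat) (Q : 'I_s -> set (borel (sphere R))) (p : nat) :
    set (set (borel (path_space Gamma))) :=
  [set [set x | Q i (vertex x p) /\ letter x p = t]
    | i in [set: 'I_s] & t in [set: 'I_(ncomp Gamma)]].

Definition partition_entropy mu (s : nat) (Q : 'I_s -> set (borel (sphere R))) :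
    R :=
  limn (fun n : nat => n%:R^-1 * collection_entropy mu
    (\big[@collection_join _/[set setT]]_(p < n) cylinders Q p)).

(* h_(nu, mu); it depends on nu only through the sigma-algebra on which nu is
   defined, since the partitions are measured by mu. *)
Definition pair_entropy nu mu : \bar R :=
  ereal_sup [set h | exists (s : nat) (Q : 'I_s -> set (borel (sphere R))),
    measurable_partition Q /\ h = (partition_entropy mu Q)%:E].

Definition measure_entropy nu : \bar R :=
  ereal_sup [set pair_entropy nu mu
    | mu in [set mu | shift_invariant mu /\ is_marginal nu mu]].

End measure_entropy.

(* Main.v *)
From HB Require Import structures.
Require Import Defs.
From mathcomp Require Import all_boot all_order all_algebra.
From mathcomp Require Import complex.
From mathcomp Require Import all_classical all_reals all_analysis.
From mathcomp Require Import measurable_realfun.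
From mathcomp Require Import ring lra.
Import Order.TTheory GRing.Theory Num.Theory.
Import numFieldNormedType.Exports.
Set Implicit Arguments.
Unset Strict Implicit.
Unset Printing Implicit Defensive.
Local Open Scope classical_set_scope.
Local Open Scope ring_scope.

(** The path space is a compact metric space on which the shift acts
    continuously, and the pressure, the partitions and the entropies of the
    statement are those of this dynamical system, except that a symbol of an
    itinerary consists of a cell of the sphere and of a letter. The two
    inequalities are proved separately, after Misiurewicz.

    Analyticity enters through compactness. The components are closed, because
    the charts are open and analytic sets are locally the common zeros of
    continuous functions ([analytic_set_closed]); limits of paths along
    ultrafilters are then paths ([path_space_compact]).

    Upper bound ([partition_entropy_le_pressure]). Let [mu] be invariant and let
    [c] code the sphere by cells on which [f] varies little. The cells are
    shrunk to closed sets, which are at a positive distance from each other; the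
    points left over are called bad and have small measure. For weights [w] on
    the words of length [n], Gibbs' inequality bounds the entropy plus the mean
    of [ln w] by [ln (\sum w)]. Take for [w] the product of [expR (f x)] over the
    visited cells, times a small factor [rho] for every bad letter. All words
    read near a given path have the same good cells, so that the sum of the
    weights is at most [(1 + #|A| rho)^n] times a sum over a separated set
    ([sum_word_weight]), whereas the factors [rho] cost only [ln rho] times the
    measure of the bad points. Counting bad letters by weights makes every error
    term as small as desired, so that no iterate of the shift is needed to get
    rid of constants.

    Lower bound ([pressure_at_le_sup]). Let [a] be less than the exponential
    growth of the sums over [e]-separated sets. Averaging along orbits the
    distribution proportional to the weights on a separated set gives a finitely
    additive probability, defined on all sets, that is almost invariant and for
    which the entropy of the words of any length [q], plus [q] times the mean of
    [f], is about [q a] ([separated_mean]). An ultralimit of these is exactly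
    invariant ([limit_mean]). From it an outer measure is built by covering sets
    with open sets; it is a Borel probability on the path space, by compactness,
    still invariant, and it agrees with the ultralimit on the sets whose boundary
    is negligible ([exists_regular_probability], [regular_null_boundary]). As the
    sphere has partitions into small cells with negligible boundary
    ([null_boundary_code]), the inequality passes to this measure. *)

(** * Entropy of finite distributions *)

Section finite_entropy.
Context {R : realType}.

Definition ent (A : finType) (p : A -> R) : R := \sum_a - (p a * ln (p a)).

Definition push (O A : finType) (X : O -> A) (p : O -> R) (a : A) : R :=
  \sum_(o | X o == a) p o.

(** Termwise, [ln x <= x - 1] for [x = g a / p a], weighted by [p a]. *)
Lemma gibbs (A : finType) (p g : A -> R) :
  (forall a, 0 <= p a) -> (forall a, 0 <= g a) -> (forall a, g a = 0 -> p a = 0) ->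
  \sum_a g a <= \sum_a p a -> ent p <= \sum_a - (p a * ln (g a)).
Proof.
move=> p0 g0 gp gle; rewrite -subr_le0 /ent -sumrB.
apply: (@le_trans _ _ (\sum_a (g a - p a))); last by rewrite sumrB subr_le0.
apply: ler_sum => a _; rewrite opprK.
have [pa0|pa0] := eqVneq (p a) 0; first by rewrite pa0 !mul0r oppr0 !addr0.
have pp : 0 < p a by rewrite lt_neqAle eq_sym pa0 p0.
have gg : 0 < g a.
  by rewrite lt_neqAle eq_sym g0 andbT; apply: contra_neq pa0 => /gp.
rewrite addrC -mulrBr -ln_div ?posrE//.
have h : ln (g a / p a) <= g a / p a - 1.
  have := @le_ln1Dx R (g a / p a - 1); rewrite [1 + _]addrC subrK; apply.
  by rewrite ltrBDl subrr divr_gt0.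
apply: le_trans (ler_wpM2l (p0 a) h) _.
by rewrite mulrBr mulr1 mulrC divfK.
Qed.

Lemma push_ge0 (O A : finType) (X : O -> A) (p : O -> R) a :
  (forall o, 0 <= p o) -> 0 <= push X p a.
Proof. by move=> p0; apply: sumr_ge0. Qed.

Lemma le_push (O A : finType) (X : O -> A) (p : O -> R) o :
  (forall o, 0 <= p o) -> p o <= push X p (X o).
Proof.
by move=> p0; rewrite /push (bigD1 o)//= lerDl sumr_ge0.
Qed.

Lemma sum_push (O A : finType) (X : O -> A) (p : O -> R) (F : A -> R) :
  \sum_a push X p a * F a = \sum_o p o * F (X o).
Proof.
rewrite [RHS](partition_big X xpredT)//=; apply: eq_bigr => a _.
by rewrite mulr_suml; apply: eq_bigr => o /eqP ->.
Qed.

Lemma push_mass (O A : finType) (X : O -> A) (p : O -> R) :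
  \sum_a push X p a = \sum_o p o.
Proof. by rewrite [RHS](partition_big X xpredT). Qed.

Lemma push_comp (O A B : finType) (X : O -> A) (g : A -> B) (p : O -> R) :
  push g (push X p) = push (g \o X) p.
Proof.
apply/funext => b; rewrite /push [RHS](partition_big X (fun a => g a == b))//=.
by apply: eq_bigr => a /eqP gab; apply: eq_bigl => o; rewrite andb_idl// => /eqP ->; apply/eqP.
Qed.

Lemma push_id (A : finType) (p : A -> R) : push id p = p.
Proof. by apply/funext => a; rewrite /push big_pred1_eq. Qed.

Lemma ent_push (O A : finType) (X : O -> A) (p : O -> R) :
  ent (push X p) = \sum_o - (p o * ln (push X p (X o))).
Proof.
by rewrite /ent sumrN sum_push -sumrN.
Qed.

(** Merging atoms only increases the masses inside the logarithm. *)
Lemma ent_push_le (O A : finType) (X : O -> A) (p : O -> R) :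
  (forall o, 0 <= p o) -> ent (push X p) <= ent p.
Proof.
move=> p0; rewrite ent_push; apply: ler_sum => o _; rewrite lerN2.
have [->|po] := eqVneq (p o) 0; first by rewrite !mul0r.
have pp : 0 < p o by rewrite lt_neqAle eq_sym po p0.
rewrite ler_pM2l// ler_ln ?posrE ?le_push//.
exact: lt_le_trans pp (le_push _ _ _).
Qed.

(** Gibbs' inequality for the joint distribution against the product of its
    marginals. *)
Lemma ent_join (O A B : finType) (X : O -> A) (Y : O -> B) (p : O -> R) :
  (forall o, 0 <= p o) -> \sum_o p o = 1 ->
  ent (push (fun o => (X o, Y o)) p) <= ent (push X p) + ent (push Y p).
Proof.
move=> p0 p1; set XY := fun o => (X o, Y o).
pose g (ab : A * B) := push X p ab.1 * push Y p ab.2.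
have Jp a : 0 <= push XY p a by exact: push_ge0.
have leX ab : push XY p ab <= push X p ab.1.
  have -> : push X p = push fst (push XY p) by rewrite push_comp.
  exact: le_push.
have leY ab : push XY p ab <= push Y p ab.2.
  have -> : push Y p = push snd (push XY p) by rewrite push_comp.
  exact: le_push.
apply: le_trans (@gibbs _ (push XY p) g Jp _ _ _) _.
- by move=> ab; rewrite mulr_ge0// push_ge0.
- move=> ab /eqP; rewrite mulf_eq0 => /orP[] /eqP h; apply/eqP; rewrite eq_le Jp andbT -h.
    exact: leX.
  exact: leY.
- rewrite push_mass p1 -(pair_bigA _ (fun a b => push X p a * push Y p b))//=.
  under eq_bigr do rewrite -mulr_sumr push_mass p1 mulr1.
  by rewrite push_mass p1.
- rewrite !ent_push -big_split/= sumrN sum_push -sumrN; apply: ler_sum => o _.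
  have [->|po] := eqVneq (p o) 0; first by rewrite !mul0r !oppr0 addr0.
  have pp : 0 < p o by rewrite lt_neqAle eq_sym po p0.
  rewrite /g/= lnM ?posrE; first by rewrite mulrDr opprD.
  + exact: lt_le_trans pp (le_push _ _ _).
  + exact: lt_le_trans pp (le_push _ _ _).
Qed.

(** Gibbs' inequality for [w] divided by its sum; equality holds when [p] is
    proportional to [w], so that this is the variational principle on a finite set. *)
Lemma ent_weight (A : finType) (p w : A -> R) :
  (forall a, 0 <= p a) -> \sum_a p a = 1 -> (forall a, 0 <= w a) ->
  (forall a, w a = 0 -> p a = 0) ->
  ent p + \sum_a p a * ln (w a) <= ln (\sum_a w a).
Proof.
move=> p0 p1 w0 wp; set W := \sum_a w a.
have W0 : 0 < W.
  rewrite lt_neqAle sumr_ge0// andbT; apply/negP => /eqP/esym/eqP.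
  rewrite psumr_eq0// => /allP h; have : \sum_a p a = 0.
    by apply: big1 => a _; apply: wp; apply/eqP/(h a); rewrite mem_index_enum.
  by rewrite p1 => /eqP; rewrite oner_eq0.
have h : ent p <= \sum_a - (p a * ln (w a / W)).
  apply: gibbs => //.
  - by move=> a; rewrite divr_ge0// ltW.
  - by move=> a /eqP; rewrite mulf_eq0 invr_eq0 (gt_eqF W0) orbF => /eqP/wp.
  - by rewrite -mulr_suml p1 divff// gt_eqF.
rewrite -lerBrDr; apply: le_trans h _.
rewrite -[ln W]mul1r -p1 mulr_suml -sumrB; apply: ler_sum => a _.
have [->|pa] := eqVneq (p a) 0; first by rewrite !mul0r oppr0 addr0.
have wa : 0 < w a by rewrite lt_neqAle w0 andbT eq_sym; apply: contra_neq pa => /wp.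
by rewrite ln_div ?posrE// mulrBr opprB.
Qed.

Lemma ent_le_ln_card (A : finType) (p : A -> R) :
  (forall a, 0 <= p a) -> \sum_a p a = 1 -> ent p <= ln #|A|%:R.
Proof.
move=> p0 p1; have := @ent_weight A p (fun=> 1) p0 p1 (fun=> ler01).
rewrite big1 ?addr0 => [|a _]; last by rewrite ln1 mulr0.
rewrite sumr_const; apply => a /eqP; by rewrite oner_eq0.
Qed.

Lemma ent_ge0 (A : finType) (p : A -> R) :
  (forall a, 0 <= p a) -> \sum_a p a = 1 -> 0 <= ent p.
Proof.
move=> p0 p1; apply: sumr_ge0 => a _; rewrite -mulrN mulr_ge0// oppr_ge0.
by apply: ln_le0; rewrite -p1 (bigD1 a)//= lerDl sumr_ge0.
Qed.

(** The limit is the infimum [l] of [u n / n]: if [u q / q] is close to [l], then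
    dividing [n] by [q] and using subadditivity bounds [u n / n] by [u q / q] up to
    a term in [1 / n]. *)
Lemma fekete (u : nat -> R) : (forall n, 0 <= u n) ->
  (forall m n, u (m + n)%N <= u m + u n) -> cvgn (fun n => n%:R^-1 * u n).
Proof.
move=> u0 uD.
pose S := [set n.+1%:R^-1 * u n.+1 | n in [set: nat]].
have Sinf : has_inf S.
  split; first by exists (1%:R^-1 * u 1%N), 0%N.
  by exists 0 => _ [n _ <-]; rewrite mulr_ge0.
have uM q k : u (k * q)%N <= k%:R * u q + u 0%N.
  elim: k => [|k IH]; first by rewrite mul0n mul0r add0r.
  rewrite mulSn; apply: le_trans (uD _ _) _; rewrite mulrSr mulrDl mul1r.
  by rewrite [X in _ <= X + _]addrC -addrA lerD2l.
apply/cvg_ex; exists (inf S); apply/cvgrPdist_le => e e0.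
have [_ [q _ <-] hq] := inf_adherent (divr_gt0 e0 (ltr0n _ 2)) Sinf.
(* [n] is [k q.+1 + r] with [r <= q]; [C] bounds what the remainder [r] costs,
   the two terms [u 0] coming from the multiples [k q.+1] and [r * 1]. *)
pose C := q.+1%:R * u 1%N + u 0%N + u 0%N.
have C0 : 0 <= C by rewrite !addr_ge0// mulr_ge0.
have [N hN] : exists N : nat, C / (e / 2) < N%:R.
  by exists (Num.truncn (C / (e / 2))).+1; rewrite truncnS_gt.
exists N.+1 => // n /= Nn; have n0 : (0 < n)%N by exact: leq_trans Nn.
have nR : 0 < n%:R :> R by rewrite ltr0n.
have lo : inf S <= n%:R^-1 * u n.
  by apply: ge_inf; [exact: Sinf.2 | exists n.-1 => //; rewrite prednK].
rewrite distrC ger0_norm ?subr_ge0//.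
have up : u n <= n%:R * (q.+1%:R^-1 * u q.+1) + C.
  rewrite {1}(divn_eq n q.+1); apply: le_trans (uD _ _) _.
  have h1 := uM q.+1 (n %/ q.+1)%N.
  have h2 := uM 1%N (n %% q.+1)%N; rewrite muln1 in h2.
  have h3 : (n %% q.+1)%:R * u 1%N <= q.+1%:R * u 1%N.
    by rewrite ler_wpM2r// ler_nat ltnW// ltn_mod.
  have h4 : (n %/ q.+1)%:R * u q.+1 <= n%:R * (q.+1%:R^-1 * u q.+1).
    by rewrite mulrA ler_wpM2r// ler_pdivlMr// -natrM ler_nat leq_trunc_div.
  apply: (le_trans (lerD (le_trans h1 (lerD h4 (lexx _))) (le_trans h2 (lerD h3 (lexx _))))).
  by rewrite /C -!addrA [u 0%N + (_ + _)]addrCA.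
have : n%:R^-1 * u n <= q.+1%:R^-1 * u q.+1 + n%:R^-1 * C.
  by rewrite -(ler_pM2l nR) mulrDr !mulVKf ?gt_eqF// !mulrA divff ?gt_eqF// mul1r -mulrA.
have : n%:R^-1 * C <= e / 2.
  rewrite mulrC ler_pdivrMr// -ler_pdivrMl ?divr_gt0// mulrC.
  apply: le_trans (ltW hN) _; by rewrite ler_nat ltnW.
move=> h1 h2; rewrite lerBlDl; apply: le_trans h2 _; rewrite [e]splitr addrA.
exact: lerD (ltW hq) h1.
Qed.

(** Averaging the decomposition of a long window into blocks of length [q] over
    the [q] possible positions of the first block. *)
Lemma block_average (h : nat -> nat -> R) (L E : R) (q N : nat) :
  (forall i l l', h i (l + l')%N <= h i l + h (i + l)%N l') ->
  (forall i l, 0 <= h i l) -> (forall i l, h i l <= l%:R * L) -> 0 <= L ->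
  (0 < q)%N -> (forall j, E <= h 0%N (j + N)%N) ->
  q%:R * E <= \sum_(i < N) h i q + 2 * q%:R ^+ 2 * L.
Proof.
move=> hD h0 hL L0 q0 hE.
have blocks k : \sum_(j < q) h j (k * q)%N <= \sum_(0 <= i < k * q) h i q.
  elim: k => [|k IH].
    rewrite mul0n big_geq//; apply: sumr_le0 => j _.
    by apply: le_trans (hL _ _) _; rewrite mul0r.
  rewrite mulSn addnC (@big_cat_nat _ _ _ (k * q)%N) ?leq_addr//=.
  apply: (@le_trans _ _ (\sum_(j < q) h j (k * q)%N + \sum_(j < q) h (j + k * q)%N q)).
    by rewrite -big_split/=; apply: ler_sum => j _; exact: hD.
  apply: lerD => //; rewrite -{2}[(k * q)%N]add0n big_addn addKn big_mkord.
  by [].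
have hj (j : 'I_q) : E <= q%:R * L + (h j (N %/ q * q)%N + q%:R * L).
  apply: le_trans (hE j) _; apply: le_trans (hD _ _ _) _; rewrite add0n.
  apply: lerD.
    by apply: le_trans (hL _ _) _; rewrite ler_wpM2r// ler_nat ltnW.
  rewrite {1}(divn_eq N q); apply: le_trans (hD _ _ _) _; rewrite lerD2l.
  by apply: le_trans (hL _ _) _; rewrite ler_wpM2r// ler_nat ltnW// ltn_mod.
have : \sum_(j < q) E <= \sum_(j < q) (q%:R * L + (h j (N %/ q * q)%N + q%:R * L)).
  by apply: ler_sum => j _.
rewrite !big_split/= !sumr_const card_ord -[E *+ q]mulr_natl -[(_ * L) *+ q]mulr_natl.
have := blocks (N %/ q)%N.
have : \sum_(0 <= i < N %/ q * q) h i q <= \sum_(i < N) h i q.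
  rewrite -(big_mkord xpredT (fun i => h i q)).
  rewrite [leRHS](@big_cat_nat _ _ _ (N %/ q * q)%N) ?leq_trunc_div//=.
  by rewrite lerDl; apply: sumr_ge0.
move=> h1 h2 h3; apply: le_trans h3 _.
have -> : 2 * q%:R ^+ 2 * L = q%:R * (q%:R * L) + q%:R * (q%:R * L) by ring.
rewrite [leLHS]addrCA lerD2r.
exact: le_trans h2 h1.
Qed.

End finite_entropy.

(** * Compactness of the sphere and of the path space *)

Section metric_continuity.
Context {R : realType} {T U : metricType R}.

Lemma metric_continuous (f : T -> U) (x : T) :
  (forall e, 0 < e -> exists2 d : R, 0 < d &
     forall y, mdist x y < d -> mdist (f x) (f y) < e) ->
  {for x, continuous f}.
Proof.
move=> h A /metricType_numDomainType.nbhs_mdistP[e /= e0 eA].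
apply/metricType_numDomainType.nbhs_mdistP; have [d d0 hd] := h e e0.
by exists d => //= y /hd /eA.
Qed.

End metric_continuity.

Lemma half_pow_small (R : realType) (c e : R) : 0 <= c -> 0 < e ->
  exists N : nat, forall r, (N <= r)%N -> 2 ^- r * c < e.
Proof.
move=> c0 e0; exists (Num.truncn (c / e)).+1 => r hr.
rewrite mulrC ltr_pdivrMr ?exprn_gt0// mulrC -ltr_pdivrMr//.
apply: lt_le_trans (truncnS_gt _) _.
rewrite -natrX ler_nat; apply: leq_trans hr _; apply: ltnW; exact: ltn_expl.
Qed.

Section ultrafilters.

Lemma ultra_fmap (T U : Type) (f : T -> U) (F : set_system T) :
  UltraFilter F -> UltraFilter (f @ F).
Proof.
move=> FU; split; first exact: fmap_proper_filter.
move=> G PG FG; apply/seteqP; split => [A GA|]; last exact: FG.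
have [//|FnA] := in_ultra_setVsetC (f @^-1` A) FU.
have GnA : G (~` A) by exact: FG.
have : G (A `&` ~` A) by exact: filterI.
by rewrite setICr => /(filter_not_empty G).
Qed.

Lemma ultra_bounded_cvg (R : realType) (T : Type) (F : set_system T)
    (g : T -> R) (B : R) :
  UltraFilter F -> (forall t, `|g t| <= B) -> cvg (g @ F).
Proof.
move=> FU gB; have gU := ultra_fmap g FU.
have := @segment_compact R (- B) B; rewrite compact_ultra => /(_ _ gU) [].
  by apply: (@filterE _ F) => t /=; rewrite in_itv/= -ler_norml.
by move=> l [_ /= gl]; apply/cvg_ex; exists l.
Qed.

Lemma ultra_fin (A : finType) (T : Type) (F : set_system T) (g : T -> A) :
  UltraFilter F -> exists a, \forall t \near F, g t = a.
Proof.
move=> FU; apply: contrapT => /forallNP h.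
have : \forall t \near F, forall a, g t <> a.
  apply: (@filter_forall _ _ (fun a t => g t <> a)) => a.
  by have [|//] := in_ultra_setVsetC [set t | g t = a] FU => /h.
by move=> /filter_ex [t /(_ (g t))].
Qed.

End ultrafilters.

Section sphere_topology.
Context {R : realType}.
Implicit Types x y : sphere R.

(** The distance is the arc cosine of [dot3], and [cos] decreases on [0, pi]. In
    this way the topology can be studied on the coordinates of [stereo], which are
    rational functions. *)
Lemma spherical_dist_small (e : R) : 0 < e -> exists2 d : R, 0 < d &
  forall x y, 1 - dot3 (stereo x) (stereo y) < d -> spherical_dist x y < e.
Proof.
move=> e0; pose e' := Num.min e pi.
have pi0 : 0 < pi :> R by exact: pi_gt0.
have e'0 : 0 < e' by rewrite lt_min e0.
have e'i : e' \in `[0, pi] by rewrite in_itv/= ltW//= ge_min lexx orbT.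
exists (1 - cos e') => [|x y].
  by rewrite subr_gt0 -cos0 ltr_cos// in_itv/= lexx ltW.
rewrite ltrD2l ltrN2 => h; apply: (@lt_le_trans _ _ e'); last by rewrite ge_min lexx.
rewrite -ltr_cos// ?in_itv/= ?spherical_dist_ge0 ?spherical_dist_lepi//.
by rewrite acosK// in_itv/= stereo_itv.
Qed.

Lemma dot3_small (d : R) : 0 < d -> exists2 e : R, 0 < e &
  forall x y, spherical_dist x y < e -> 1 - dot3 (stereo x) (stereo y) < d.
Proof.
move=> d0; have : cos x @[x --> (0 : R)] --> cos 0 by exact: continuous_cos.
rewrite cos0 => /cvgrPdist_lt/(_ _ d0).
move=> /nbhs_ballP[e /= e0 h]; exists e => // x y xy.
have := h (spherical_dist x y); rewrite /ball/= sub0r normrN.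
rewrite ger0_norm ?spherical_dist_ge0// => /(_ xy).
rewrite {1}/spherical_dist acosK ?in_itv/= ?stereo_itv//.
exact: le_lt_trans (ler_norm _).
Qed.

(** Stereographic projection from the north pole, the only point that comes from
    infinity. *)
Lemma stereo_surj (u : R * R * R) : dot3 u u = 1 -> exists x, stereo x = u.
Proof.
case: u => -[a b] c; rewrite /dot3/= => h.
have [c1|c1] := eqVneq c 1.
  exists None => /=; move: h; rewrite c1 => h.
  have h1 := sqr_ge0 a; have h2 := sqr_ge0 b.
  have a0 : a ^+ 2 = 0 by rewrite expr2 in h1 *; rewrite expr2 in h2; lra.
  have b0 : b ^+ 2 = 0 by rewrite expr2 in h1; rewrite expr2 in h2 *; lra.
  by move/eqP: a0; move/eqP: b0; rewrite !sqrf_eq0 => /eqP -> /eqP ->.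
have c0 : 1 - c != 0 by rewrite subr_eq0 eq_sym.
exists (Some ((a / (1 - c)) +i* (b / (1 - c)))%C) => /=.
have e : (a / (1 - c)) ^+ 2 + (b / (1 - c)) ^+ 2 = (1 + c) / (1 - c).
  have -> : (a / (1 - c)) ^+ 2 + (b / (1 - c)) ^+ 2 = (a * a + b * b) / (1 - c) ^+ 2.
    by field.
  have -> : a * a + b * b = 1 - c * c by rewrite -h; ring.
  by field.
have e1 : 1 + (a / (1 - c)) ^+ 2 + (b / (1 - c)) ^+ 2 = 2 / (1 - c).
  by rewrite -addrA e; field.
rewrite e1 e; congr (_, _, _); field; rewrite c0 ?andbT//.
Qed.

Lemma stereo_norm_le1 x : [/\ `|(stereo x).1.1| <= 1, `|(stereo x).1.2| <= 1
  & `|(stereo x).2| <= 1].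
Proof.
have := stereo_unit x; rewrite /dot3 -!expr2 => h.
have h1 := sqr_ge0 (stereo x).1.1; have h2 := sqr_ge0 (stereo x).1.2.
have h3 := sqr_ge0 (stereo x).2.
by split; rewrite ler_norml; apply/andP; split; nra.
Qed.

(** Along an ultrafilter the three coordinates of [stereo] converge, and the limit
    is on the unit sphere. *)
Lemma sphere_compact : compact [set: sphere R].
Proof.
rewrite compact_ultra => F FU _.
have [g1 g2 g3] : [/\ cvg ((stereo y).1.1 @[y --> F]), cvg ((stereo y).1.2 @[y --> F])
    & cvg ((stereo y).2 @[y --> F])].
  by split; apply: (@ultra_bounded_cvg R _ F _ 1) => // y; have [] := stereo_norm_le1 y.
set l1 := lim _ in g1; set l2 := lim _ in g2; set l3 := lim _ in g3.
have FF : ProperFilter F by exact: ultra_proper.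
have unit : dot3 (l1, l2, l3) (l1, l2, l3) = 1.
  have h : dot3 (stereo y) (stereo y) @[y --> F] --> dot3 (l1, l2, l3) (l1, l2, l3).
    by rewrite /dot3/=; apply: cvgD; [apply: cvgD|]; apply: cvgM.
  rewrite -(cvg_lim (@Rhausdorff R) h); under eq_fun do rewrite stereo_unit.
  exact: lim_cst.
have [x xl] := stereo_surj unit.
exists x; split => //; apply/metricType_numDomainType.fcvgrPdist_lt => e e0.
have [d d0 hd] := spherical_dist_small e0.
have h : dot3 (stereo x) (stereo y) @[y --> F] --> dot3 (l1, l2, l3) (l1, l2, l3).
  by rewrite xl /dot3/=; apply: cvgD; [apply: cvgD|]; apply: cvgM => //; exact: cvg_cst.
move: h; rewrite unit => /cvgrPdist_lt/(_ _ d0); apply: filterS => y hy.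
by apply: hd; apply: le_lt_trans hy; exact: ler_norm.
Qed.

(** Inversion is an isometry that exchanges the two charts, so that only the
    finite chart has to be examined. *)
Definition inversion x : sphere R :=
  if x is Some z then (if z == 0 then None else Some z^-1) else Some 0.

Lemma inversionK : involutive inversion.
Proof.
case=> [z|] /=; last by rewrite eqxx.
by case: eqVneq => [->//|z0] /=; rewrite invr_eq0 (negbTE z0) invrK.
Qed.

Lemma stereo_inversion x :
  stereo (inversion x) = ((stereo x).1.1, - (stereo x).1.2, - (stereo x).2).
Proof.
case: x => [[a b]|] /=; last first.
  by congr (_, _, _); rewrite !expr0n /= !(mulr0, addr0, mul0r, oppr0, sub0r, divr1).
case: eqVneq => [[-> ->]|z0] /=.
  by congr (_, _, _); rewrite !expr0n /= !(mulr0, addr0, mul0r, oppr0, sub0r, divr1, opprK).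
have n0 : a ^+ 2 + b ^+ 2 != 0.
  apply: contra z0 => /eqP h; have h1 := sqr_ge0 a; have h2 := sqr_ge0 b.
  have a0 : a ^+ 2 = 0 by lra.
  have b0 : b ^+ 2 = 0 by lra.
  by move/eqP: a0; move/eqP: b0; rewrite !sqrf_eq0 => /eqP -> /eqP ->.
have N0 : 1 + a ^+ 2 + b ^+ 2 != 0.
  by apply: lt0r_neq0; have := sqr_ge0 a; have := sqr_ge0 b; lra.
have n1 : (a / (a ^+ 2 + b ^+ 2)) ^+ 2 + (- b / (a ^+ 2 + b ^+ 2)) ^+ 2
   = (a ^+ 2 + b ^+ 2)^-1 by field.
have n2 : 1 + (a / (a ^+ 2 + b ^+ 2)) ^+ 2 + (- b / (a ^+ 2 + b ^+ 2)) ^+ 2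
   = (1 + a ^+ 2 + b ^+ 2) / (a ^+ 2 + b ^+ 2) by rewrite -addrA n1; field.
by rewrite ?mulNr in n1 n2 *; rewrite n2 n1; congr (_, _, _); field; rewrite n0 N0.
Qed.

Lemma inversion_isometry x y :
  spherical_dist (inversion x) (inversion y) = spherical_dist x y.
Proof. by rewrite /spherical_dist !stereo_inversion /dot3/= !mulrNN. Qed.

Lemma chartE (i : bool) (z : R[i]^o) :
  chart i z = if i then inversion (Some z) else Some z.
Proof. by case: i. Qed.

(** The square of the chordal distance, in terms of the affine coordinates. *)
Lemma chordal (a b c d : R) :
  2 * ((a - c) ^+ 2 + (b - d) ^+ 2) =
  (1 - dot3 (stereo (Some (a +i* b)%C)) (stereo (Some (c +i* d)%C)))
  * ((1 + a ^+ 2 + b ^+ 2) * (1 + c ^+ 2 + d ^+ 2)).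
Proof.
have N0 (u v : R) : 1 + u ^+ 2 + v ^+ 2 != 0.
  by apply: lt0r_neq0; have := sqr_ge0 u; have := sqr_ge0 v; lra.
by rewrite /dot3/=; field; rewrite !N0.
Qed.

(** By [chordal], the affine distance is small as soon as the chordal one is,
    provided that the affine coordinate of the second point remains bounded. *)
Lemma finite_chart_open (z : R[i]) (e : R) : 0 < e -> exists2 d : R, 0 < d &
  forall y, spherical_dist (Some z) y < d ->
    exists2 w : R[i], y = Some w & `|z - w| < e%:C%C.
Proof.
case: z => a b e0.
pose N := 1 + a ^+ 2 + b ^+ 2.
have N1 : 1 <= N by rewrite /N -addrA lerDl addr_ge0 ?sqr_ge0.
have N0 : 0 < N by exact: lt_le_trans N1.
(* A bound [k] on [1 - dot3]: below [N^-1] it excludes infinity, and the second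
   term of the minimum is what the last two estimates need. *)
pose k := Num.min N^-1 (Num.min (e ^+ 2) 1 / (2 * N * N)).
have k0 : 0 < k.
  rewrite lt_min invr_gt0 N0/= divr_gt0// ?mulr_gt0//.
  by rewrite lt_min ltr01 exprn_gt0.
have [d d0 hd] := dot3_small k0.
exists d => // y /hd; case: y => [[c f]|] h; last first.
  exfalso; move: h; rewrite /dot3/= !mulr0 !add0r mulr1 lt_min => /andP[+ _].
  apply/negP; rewrite -leNgt -/N.
  have -> : 1 - (a ^+ 2 + b ^+ 2 - 1) / N = 2 / N.
    by rewrite /N; field; rewrite -/N gt_eqF.
  by rewrite ler_pMl ?invr_gt0// ler1n.
exists (c +i* f)%C => //.
rewrite normc_def/= ltcR.
set s := _ ^+ 2 + _ ^+ 2.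
have s0 : 0 <= s by rewrite addr_ge0 ?sqr_ge0.
suff : s < e ^+ 2.
  by move=> h'; rewrite -(@ltr_pXn2r _ 2) ?nnegrE ?sqrtr_ge0 ?ltW// sqr_sqrtr.
have M : 1 + c ^+ 2 + f ^+ 2 <= 2 * (N + s).
  rewrite /s /N -subr_ge0.
  have -> : 2 * (1 + a ^+ 2 + b ^+ 2 + ((a - c) ^+ 2 + (b - f) ^+ 2)) -
    (1 + c ^+ 2 + f ^+ 2) = 1 + (2 * a - c) ^+ 2 + (2 * b - f) ^+ 2 by ring.
  by rewrite !addr_ge0 ?sqr_ge0.
have := chordal a b c f; rewrite -/N -/s; move: h.
set D := 1 - _; set P := 1 + _ + _ in M *.
rewrite lt_min => /andP[_]; rewrite ltr_pdivlMr ?mulr_gt0// lt_min => /andP[h1 h2] h3.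
have D0 : 0 <= D by rewrite subr_ge0; have /andP[] := stereo_itv (Some (a +i* b)%C) (Some (c +i* f)%C).
have DN : 0 <= D * N by rewrite mulr_ge0// ltW.
have h4 : s <= D * N * (N + s).
  have : D * (N * P) <= D * N * (2 * (N + s)) by rewrite mulrA ler_wpM2l.
  by rewrite -h3; move: (D * N) DN => q q0; nra.
have DNN : D * N <= D * N * N by rewrite ler_peMr.
nra.
Qed.

Lemma chart_open (i : bool) (z : R[i]^o) (U : set R[i]^o) : nbhs z U ->
  exists2 d : R, 0 < d & forall y, mdist (chart i z) y < d ->
    exists2 w, U w & y = chart i w.
Proof.
move=> /nbhs_normP[e /= e0 eU].
have [r r0 er] : exists2 r : R, 0 < r & e = r%:C%C.
  move: e0; case: e {eU} => r s; rewrite ltcE/= => /andP[/eqP -> r0].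
  by exists r.
have [d d0 hd] := finite_chart_open z r0.
exists d => // y; rewrite /mdist/= !chartE.
case: i => [|]; rewrite ?chartE.
  rewrite -inversion_isometry inversionK => /hd[w yw zw].
  exists w; last by rewrite chartE -yw inversionK.
  by apply: eU; rewrite /ball_/= er.
move=> /hd[w yw zw]; exists w; last by rewrite chartE.
by apply: eU; rewrite /ball_/= er.
Qed.

Lemma chart_cover x : exists (i : bool) (z : R[i]^o), chart i z = x.
Proof.
case: x => [z|]; first by exists false, z.
by exists true, 0; rewrite /chart eqxx.
Qed.

(** Off the set some local equation does not vanish, hence does not vanish on a
    neighbourhood in the charts; its image is a neighbourhood by [chart_open]. *)
Lemma analytic_set_closed (A : set (sphere R * sphere R)) x y :
  analytic_set A -> ~ A (x, y) -> exists2 d : R, 0 < d &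
    forall x' y', mdist x x' < d -> mdist y y' < d -> ~ A (x', y').
Proof.
move=> Aan nA.
have [i [z xz]] := chart_cover x; have [j [w yw]] := chart_cover y.
have [U [m [g [oU Up dg gA]]]] := Aan i j (z, w).
have /existsNP[k gk] : ~ forall k, g k (z, w) = 0.
  by move=> /gA; rewrite /= xz yw => /(_ Up).
have cg : g k q @[q --> (z, w)] --> g k (z, w).
  by apply: differentiable_continuous; exact: dg.
have n1 : \forall q \near (z, w), g k q != 0.
  by apply: cvgr_neq0 cg _; apply/eqP.
have n2 : \forall q \near (z, w), U q by apply: open_nbhs_nbhs.
have [[V W]/= [hV hW] VW] : nbhs (z, w) (fun q => g k q != 0 /\ U q).
  exact: filterI n1 n2.
have [d1 d10 h1] := chart_open i hV; have [d2 d20 h2] := chart_open j hW.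
exists (Num.min d1 d2); first by rewrite lt_min d10.
move=> x' y'; rewrite !lt_min => /andP[xd _] /andP[_ yd].
rewrite -xz in xd; rewrite -yw in yd.
have [z' Vz ->] := h1 _ xd; have [w' Ww ->] := h2 _ yd.
have [/eqP g0 Uq] := VW (z', w') (conj Vz Ww).
by move=> /(gA _ Uq) /(_ k).
Qed.

End sphere_topology.

Section path_topology.
Context {R : realType} {Gamma : correspondence R}.
Implicit Types p q : path_space Gamma.

Lemma mdist_vertex p q r :
  mdist (vertex p r) (vertex q r) <= 2 ^+ r * mdist p q.
Proof.
have := path_term1_le p q r; rewrite /path_term1 => h.
by rewrite -ler_pdivrMl ?exprn_gt0.
Qed.

Lemma mdist_letter p q r : mdist p q < 2 ^- r.+1 -> letter p r = letter q r.
Proof.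
move=> h; apply/eqP; apply: contraTT h => h; rewrite -leNgt.
by have := path_term2_le p q r; rewrite /path_term2 h mulr1.
Qed.

Lemma mdist_path_shift p q :
  mdist (path_shift p) (path_shift q) <= 2 * mdist p q.
Proof.
apply: path_dist_le => r.
- have := path_term1_le p q r.+1; rewrite /path_term1 /= => h.
  have -> : 2 ^- r = 2 * 2 ^- r.+1 :> R.
    by rewrite exprS invfM mulrA divff// mul1r.
  by rewrite -mulrA ler_pM2l.
- have := path_term2_le p q r.+1; rewrite /path_term2 /= => h.
  have -> : 2 ^- r.+1 = 2 * 2 ^- r.+2 :> R.
    by rewrite [in RHS]exprS invfM mulrA divff// mul1r.
  by rewrite -mulrA ler_pM2l.
Qed.

Lemma continuous_vertex r : continuous (fun p => vertex p r).
Proof.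
move=> p; apply: metric_continuous => e e0; exists (e / 2 ^+ r).
  by rewrite divr_gt0 ?exprn_gt0.
move=> q pq; apply: le_lt_trans (mdist_vertex _ _ _) _.
by rewrite mulrC -ltr_pdivlMr ?exprn_gt0.
Qed.

Lemma continuous_path_shift : continuous (@path_shift R Gamma).
Proof.
move=> p; apply: metric_continuous => e e0; exists (e / 2).
  by rewrite divr_gt0.
move=> q pq; apply: le_lt_trans (mdist_path_shift _ _) _.
by rewrite mulrC -ltr_pdivlMr.
Qed.

Lemma open_letter r t : open [set p : path_space Gamma | letter p r = t].
Proof.
rewrite openE => p /= pt; rewrite /interior -metricType_numDomainType.nbhs_nbhs_mdist.
exists (2 ^- r.+1) => /=; first by rewrite invr_gt0 exprn_gt0.
by move=> q /= pq; rewrite -(mdist_letter pq).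
Qed.

(** Along an ultrafilter every vertex converges and every letter is constant. The
    limits form a path because components are closed, and the distance to it only
    depends, up to any given error, on finitely many vertices and letters. *)
Lemma path_space_compact : compact [set: path_space Gamma].
Proof.
rewrite compact_ultra => F FU _; have FF : ProperFilter F by exact: ultra_proper.
have /choice[x xF] : forall r, exists x : sphere R, vertex p r @[p --> F] --> x.
  move=> r; have := @sphere_compact R; rewrite compact_ultra.
  move=> /(_ _ (ultra_fmap (fun p => vertex p r) FU) filterT) [x [_ h]].
  by exists x.
have /choice[a aF] := fun r => ultra_fin (fun p => letter p r) FU.
have xnear r d : 0 < d -> \forall p \near F, mdist (x r) (vertex p r) < d.
  by move=> d0; apply: metricType_numDomainType.cvgr_dist_lt d0; exact: xF.
have xa r : component (a r) (x r, x r.+1).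
  have [an _ _] := component_irreducible (a r).
  apply: contrapT => /(analytic_set_closed an)[d d0 hd].
  have [p [pa [p1 p2]]] :=
    filter_ex (filterI (aF r) (filterI (xnear r d d0) (xnear r.+1 d d0))).
  by apply: (hd (vertex p r) (vertex p r.+1)) => //; rewrite -pa; exact: path_spaceP.
exists (PathSpace xa); split => //.
apply/metricType_numDomainType.fcvgrPdist_lt => e e0.
have e20 : 0 < e / 2 by rewrite divr_gt0.
have [N hN] := half_pow_small (pi_ge0 R) e20; have [N' hN'] := half_pow_small ler01 e20.
have near1 : \forall p \near F, forall r : 'I_(maxn N N'), mdist (x r) (vertex p r) < e / 2.
  apply: (@filter_forall _ _ (fun (r : 'I_(maxn N N')) p => mdist (x r) (vertex p r) < e / 2)) => r.
  by apply: xnear; rewrite divr_gt0.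
have near2 : \forall p \near F, forall r : 'I_(maxn N N'), letter p r = a r.
  by apply: (@filter_forall _ _ (fun (r : 'I_(maxn N N')) p => letter p r = a r)) => r.
move: near1 near2; apply: filterS2 => p h1 h2.
apply: (@le_lt_trans _ _ (e / 2)); last by rewrite ltr_pdivrMr// ltr_pMr// ltr1n.
apply: path_dist_le => r; rewrite /path_term1 /path_term2 /=.
- have [rN|Nr] := ltnP r (maxn N N').
    apply: le_trans (ltW (h1 (Ordinal rN))); rewrite ler_piMl ?mdist_ge0//.
    by rewrite invf_le1 ?exprn_gt0// exprn_ege1// ler1n.
  apply: le_trans (ltW (hN r _)); last by apply: leq_trans Nr; exact: leq_maxl.
  by rewrite ler_pM2l ?invr_gt0 ?exprn_gt0//; exact: spherical_dist_lepi.
- have [rN|Nr] := ltnP r (maxn N N').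
    by rewrite (h2 (Ordinal rN)) eqxx mulr0 divr_ge0// ltW.
  apply: le_trans (ltW (hN' r.+1 _)); last first.
    by apply: leqW; apply: leq_trans Nr; exact: leq_maxr.
  by rewrite ler_pM2l ?invr_gt0 ?exprn_gt0// lern1; case: (_ != _).
Qed.

End path_topology.

(** * From finitely additive probabilities to Borel probabilities *)

(** Generated sigma-algebras are measurable types on pointed types only; both the
    sphere and the path space are pointed metric spaces. *)
#[short(type="pointedMetricType")]
HB.structure Definition PointedMetric (K : realFieldType) :=
  { M of Metric K M & isPointed M }.

HB.instance Definition _ (R : realType) := Metric.on (sphere R).

HB.instance Definition _ (R : realType) (Gamma : correspondence R) :=
  Metric.on (path_space Gamma).

Section borel_sets.
Context {R : realType}.

Lemma borel_open (X : pointedMetricType R) (U : set X) :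
  open U -> measurable (U : set (borel X)).
Proof. exact: sub_sigma_algebra. Qed.

Lemma borel_closed (X : pointedMetricType R) (F : set X) :
  closed F -> measurable (F : set (borel X)).
Proof.
move=> cF; rewrite -[F]setCK; apply: measurableC; apply: borel_open.
exact: closed_openC.
Qed.

Lemma borel_preimage (X Y : pointedMetricType R) (g : X -> Y) (B : set Y) :
  continuous g -> measurable (B : set (borel Y)) ->
  measurable (g @^-1` B : set (borel X)).
Proof.
move=> gc mB.
have gmf : measurable_fun [set: borel X] (g : borel X -> borel Y).
  apply: (@measurability _ _ (borel X) (borel Y) setT g open) => //.
  move=> _ [U oU <-]; rewrite setTI; apply: borel_open.
  by apply: open_comp => // x _; exact: gc.
by rewrite -[_ @^-1` _]setTI; exact: gmf.
Qed.

End borel_sets.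

Section metric_functions.
Context {R : realType} {X : pointedMetricType R}.

Lemma mdist_diff (x y z : X) : `|mdist x y - mdist x z| <= mdist y z.
Proof.
have := metric_triangle x y z; have := metric_triangle x z y.
rewrite (metric_sym z y) => h1 h2; rewrite ler_norml; apply/andP; split; lra.
Qed.

Lemma continuous_mdist (x : X) : continuous (fun y : X => mdist x y : R).
Proof.
move=> y; apply: (@metric_continuous R X R^o) => t t0; exists t => // z.
by apply: le_lt_trans; rewrite /mdist/= distrC; exact: mdist_diff.
Qed.

Lemma open_mball (x : X) r : open [set y | mdist x y < r].
Proof.
apply: (@open_comp _ _ (fun y => mdist x y) [set t | t < r]); last exact: open_lt.
by move=> y _; exact: continuous_mdist.
Qed.

End metric_functions.

Section distance_to_set.
Context {R : realType} {X : pointedMetricType R}.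
Variables (F : set X) (F0 : F !=set0).

Definition dist_to (x : X) : R := inf [set mdist x y | y in F].

Let has_inf_dist x : has_inf [set mdist x y | y in F].
Proof.
split; first by have [y Fy] := F0; exists (mdist x y), y.
by exists 0 => _ [y _ <-]; exact: mdist_ge0.
Qed.

Lemma dist_to_le x y : F y -> dist_to x <= mdist x y.
Proof. by move=> Fy; apply: ge_inf; [exact: (has_inf_dist x).2 | exists y]. Qed.

Lemma dist_to_lipschitz x y : dist_to x <= mdist x y + dist_to y.
Proof.
rewrite -lerBlDl; apply: lb_le_inf; first exact: (has_inf_dist y).1.
move=> _ [z Fz <-]; rewrite lerBlDl.
exact: le_trans (dist_to_le x Fz) (metric_triangle x y z).
Qed.

Lemma continuous_dist_to : continuous dist_to.
Proof.
move=> x; apply: (@metric_continuous R X R^o dist_to x) => e e0; exists e => // y.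
apply: le_lt_trans; rewrite /mdist/= distrC ler_distlC.
have h1 := dist_to_lipschitz x y; have h2 := dist_to_lipschitz y x.
by rewrite metric_sym in h2; rewrite lerBlDl h1 addrC.
Qed.

Lemma dist_to_lt r : open [set x | dist_to x < r].
Proof.
apply: (@open_comp _ _ dist_to [set t | t < r]); last exact: open_lt.
by move=> x _; exact: continuous_dist_to.
Qed.

Lemma dist_to_gt r : open [set x | r < dist_to x].
Proof.
apply: (@open_comp _ _ dist_to [set t | r < t]); last exact: open_gt.
by move=> x _; exact: continuous_dist_to.
Qed.

Lemma dist_to_gt0 x : closed F -> ~ F x -> 0 < dist_to x.
Proof.
move=> cF nF; have : open (~` F) by exact: closed_openC.
rewrite openE => /(_ x nF); rewrite /interior -metricType_numDomainType.nbhs_nbhs_mdist.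
move=> [e /= e0 eF]; apply: (lt_le_trans e0); apply: lb_le_inf.
  exact: (has_inf_dist x).1.
move=> _ [y Fy <-]; rewrite leNgt; apply/negP => xy.
exact: (eF y xy).
Qed.

End distance_to_set.

(** A probability that is only finitely additive, but defined on all sets. *)
Record mean (R : realType) (X : Type) := Mean {
  mean_val :> set X -> R ;
  mean_ge0 : forall A, 0 <= mean_val A ;
  mean_setT : mean_val setT = 1 ;
  meanU : forall A B, A `&` B = set0 -> mean_val (A `|` B) = mean_val A + mean_val B
}.

Section mean_theory.
Context {R : realType} {X : Type} (m : mean R X).

Lemma mean_set0 : m set0 = 0.
Proof.
have := meanU m (set0I (@set0 X)); rewrite setU0 => /eqP.
by rewrite addrC -subr_eq subrr eq_sym => /eqP.
Qed.

Lemma le_mean A B : A `<=` B -> m A <= m B.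
Proof.
move=> AB; rewrite -(setDUK AB) meanU ?setDIK// ?lerDl ?mean_ge0//.
Qed.

Lemma mean_setC A : m (~` A) = 1 - m A.
Proof. by rewrite -(mean_setT m) -(setUCr A) meanU ?setICr// addrAC subrr add0r. Qed.

Lemma mean_leU A B : m (A `|` B) <= m A + m B.
Proof.
have -> : A `|` B = A `|` (B `\` A) by rewrite setDE setUIr setUCr setIT.
rewrite meanU; first by rewrite lerD2l le_mean// => x [].
by apply/seteqP; split => x // [? []].
Qed.

Lemma mean_le1 A : m A <= 1.
Proof. by rewrite -(mean_setT m) le_mean. Qed.

End mean_theory.

Section regular_extension.
Context {R : realType} {X : pointedMetricType R} (m : mean R X).
Local Open Scope ereal_scope.

(** The infinite value outside of the open sets makes the coverings of the outer
    measure below consist of open sets. *)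
Definition open_content (A : set (g_sigma_algebraType [set: set X])) : \bar R :=
  if `[< open (A : set X) >] then (m A)%:E else +oo.

Let open_content0 : open_content set0 = 0.
Proof. by rewrite /open_content asboolT ?mean_set0//; exact: open0. Qed.

Let open_content_ge0 A : 0 <= open_content A.
Proof. by rewrite /open_content; case: ifP => // _; rewrite lee_fin mean_ge0. Qed.

Definition regular_outer : set X -> \bar R := mu_ext open_content.

HB.instance Definition _ := isOuterMeasure.Build R X regular_outer
  (mu_ext0 open_content0 open_content_ge0)
  (mu_ext_ge0 open_content_ge0)
  (le_mu_ext open_content)
  (mu_ext_sigma_subadditive open_content_ge0).

Lemma regular_outer_open (O : set X) : open O -> regular_outer O <= (m O)%:E.
Proof.
move=> oO; apply: ereal_inf_lbound; exists (fun n => if n is 0%N then O else set0).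
  split; last by move=> t Ot; exists 0%N.
  by move=> i; exact: sub_sigma_algebra.
apply/cvg_lim => //; rewrite -cvg_shiftS.
rewrite (_ : [sequence _]_n = cst (m O)%:E); first exact: cvg_cst.
rewrite funeqE => n /=; rewrite big_nat_recl//= big1 ?adde0//.
by rewrite /open_content asboolT.
Qed.

Lemma le_regular_outer (A : set X) (b : \bar R) :
  (forall O : (set X)^nat, (forall k, open (O k)) -> A `<=` \bigcup_k O k ->
     b <= \sum_(k <oo) (m (O k))%:E) -> b <= regular_outer A.
Proof.
move=> h; apply: le_ereal_inf_tmp => _ [U [_ AU] <-].
have [oU|/existsNP[k nU]] := pselect (forall k, open (U k : set X)).
  apply: le_trans (h U oU AU) _; apply: lee_nneseries => k _.
    by move=> _; rewrite lee_fin mean_ge0.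
  by rewrite /open_content asboolT.
rewrite (eseries_pinfty _ _ (k := k)) ?leey//.
  by move=> n _; rewrite -ltNye (lt_le_trans _ (open_content_ge0 _)).
by rewrite /open_content asboolF.
Qed.

(** The shells [2^-(j+2) < dist_to F < 2^-j] have summable mean, so that all but
    finitely many of them can be added to a cover of [A `\` F] at a small cost. The
    other points of [A] are either on [F] or away from it, and an open cover of [A]
    can be cut into two disjoint ones. *)
Lemma closed_caratheodory (F : set X) :
  closed F -> regular_outer.-caratheodory F.
Proof.
move=> cF; have [->|/set0P F0] := eqVneq F set0.
  exact: caratheodory_measurable_set0.
apply: le_caratheodory_measurable => A; apply: le_regular_outer => O oO AO.
apply/lee_addgt0Pr => e e0.
pose D := dist_to F; pose r (j : nat) : R := (2 ^- j)%R.
have r0 j : (0 < r j)%R by rewrite invr_gt0 exprn_gt0.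
have rS j : (r j.+1 < r j)%R.
  by rewrite ltf_pV2 ?posrE ?exprn_gt0// exprS ltr_pMl ?exprn_gt0// ltr1n.
have rle j k : (j <= k)%N -> (r k <= r j)%R.
  by move=> jk; rewrite lef_pV2 ?posrE ?exprn_gt0// ler_weXn2l// ler1n.
pose G j : set X := [set x | r j <= D x]%R.
have GS j k : (j <= k)%N -> G j `<=` G k.
  by move=> jk x; exact: le_trans (rle _ _ jk).
have mGub : has_ubound (range (fun j => m (G j))).
  by exists 1%R => _ [j _ <-]; exact: mean_le1.
have mGsup : has_sup (range (fun j => m (G j))).
  by split => //; exists (m (G 0%N)), 0%N.
have [_ [N _ <-] hN] := sup_adherent (divr_gt0 e0 (ltr0n R 2)) mGsup.
pose S j : set X := [set x | r j.+2 < D x /\ D x < r j]%R.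
have oS j : open (S j).
  by apply: openI; [exact: dist_to_gt | exact: dist_to_lt].
have mS j : (m (S j) <= m (G j.+2) - m (G j))%R.
  rewrite lerBrDr -meanU.
    apply: le_mean => x [[h _]|]; first exact: ltW.
    by apply: GS; rewrite -addn2 leq_addr.
  by apply/seteqP; split => x //= [[_ h]]; rewrite /G/= leNgt h.
(* The sum telescopes, as the shells are differences of the sets [G j]. *)
have sumS n : (\sum_(j < n) m (S (N + j)%N) <= e)%R.
  apply: (@le_trans _ _ (\sum_(j < n) (m (G (N + j).+2) - m (G (N + j)%N)))%R).
    by apply: ler_sum => j _; exact: mS.
  have -> : (\sum_(j < n) (m (G (N + j).+2) - m (G (N + j)%N)) =
      (m (G (N + n).+1) - m (G N.+1)) + (m (G (N + n)%N) - m (G N)))%R.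
    elim: n => [|n IH]; first by rewrite big_ord0 addn0 !subrr addr0.
    by rewrite big_ord_recr/= IH addnS; ring.
  have up k : (m (G k) <= sup (range (fun j => m (G j))))%R.
    by apply: ub_le_sup => //; exists k.
  have := up (N + n).+1; have := up (N + n)%N.
  have : (m (G N) <= m (G N.+1))%R by apply: le_mean; exact: GS.
  by move: hN; move: (m (G N)) (sup _) => *; lra.
pose V : set X := [set x | D x < r N.+1]%R.
pose W : set X := [set x | r N.+1 < D x]%R.
have oV : open V by exact: dist_to_lt.
have oW : open W by exact: dist_to_gt.
have AF : regular_outer (A `&` F) <= \sum_(k <oo) (m (O k `&` V))%:E.
  apply: (@le_trans _ _ (regular_outer (\bigcup_k (O k `&` V)))).
    apply: le_outer_measure => x [Ax Fx]; have [k _ Okx] := AO _ Ax.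
    exists k => //; split => //; apply: (@le_lt_trans _ _ 0%R) => //.
    by rewrite -(mdistxx x); exact: dist_to_le.
  apply: le_trans (outer_measure_sigma_subadditive _ _) _.
  apply: lee_nneseries => k _; first by move=> _; exact: outer_measure_ge0.
  by apply: regular_outer_open; exact: openI.
have AnF : regular_outer (A `&` ~` F) <= \sum_(k <oo) (m (O k `&` W))%:E + e%:E.
  apply: (@le_trans _ _ (regular_outer
      ((\bigcup_k (O k `&` W)) `|` (\bigcup_j S (N + j)%N)))).
    apply: le_outer_measure => x [Ax nFx]; have [k _ Okx] := AO _ Ax.
    have [xW|xW] := ltP (r N.+1) (D x); first by left; exists k.
    right; have Dx0 : (0 < D x)%R by exact: dist_to_gt0.
    have [j hj] : exists j, (r j < D x)%R.
      have [j hj] := half_pow_small ler01 Dx0; exists j.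
      by have := hj j (leqnn j); rewrite mulr1.
    have [j' h1 h2] := ex_minnP (ex_intro (fun j => r j < D x)%R j hj).
    have Nj' : (N.+2 <= j')%N.
      by rewrite ltnNge; apply/negP => /rle h; move: (lt_le_trans h1 xW); rewrite ltNge h.
    have [i ij'] : exists i, j' = i.+2 by case: j' Nj' {h1 h2} => [|[|i]]//; exists i.
    exists (i - N)%N => //; rewrite /S/= subnKC; last by move: Nj'; rewrite ij'.
    split; first by rewrite -ij'.
    apply: le_lt_trans (rS i); rewrite leNgt; apply/negP => /h2.
    by rewrite ij' ltnn.
  apply: le_trans (outer_measureU2 _ _ _) _; apply: leeD.
    apply: le_trans (outer_measure_sigma_subadditive _ _) _.
    apply: lee_nneseries => k _; first by move=> _; exact: outer_measure_ge0.
    by apply: regular_outer_open; exact: openI.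
  apply: le_trans (outer_measure_sigma_subadditive _ _) _.
  apply: lime_le; first by apply: is_cvg_nneseries => *; exact: outer_measure_ge0.
  apply: nearW => n; rewrite big_mkord.
  apply: (@le_trans _ _ (\sum_(j < n) (m (S (N + j)%N))%:E)).
    by apply: lee_sum => j _; exact: regular_outer_open.
  by rewrite sumEFin lee_fin.
apply: le_trans (leeD AF AnF) _; rewrite addeA leeD2r//.
rewrite -nneseriesD; last 2 first.
  by move=> *; rewrite lee_fin mean_ge0.
  by move=> *; rewrite lee_fin mean_ge0.
apply: lee_nneseries => k _; first by move=> _; rewrite -EFinD lee_fin addr_ge0 ?mean_ge0.
rewrite -EFinD lee_fin -meanU; first by apply: le_mean => x [[]|[]].
apply/seteqP; split => x //= [[_ h] [_ h']].
by move: (lt_trans h h'); rewrite ltxx.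
Qed.

Definition regular_extension : set (borel X) -> \bar R := regular_outer.

Lemma borel_caratheodory (A : set X) :
  measurable (A : set (borel X)) -> regular_outer.-caratheodory A.
Proof.
move: A; apply: smallest_sub.
  split => [|A mA|A mA].
  - exact: caratheodory_measurable_set0.
  - by rewrite setTD; exact: caratheodory_measurable_setC.
  - exact: caratheodory_measurable_bigcup.
move=> A oA; rewrite -[A]setCK; apply: caratheodory_measurable_setC.
by apply: closed_caratheodory; exact: open_closedC.
Qed.

Let regular_extension0 : regular_extension set0 = 0.
Proof. exact: outer_measure0. Qed.

Let regular_extension_ge0 A : 0 <= regular_extension A.
Proof. exact: outer_measure_ge0. Qed.

Let regular_extension_sigma_additive : semi_sigma_additive regular_extension.
Proof.
move=> F mF tF mUF.
apply: (@caratheodory_measure_sigma_additive R X regular_outer) => //.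
  by move=> i; exact: borel_caratheodory.
exact: borel_caratheodory.
Qed.

HB.instance Definition _ := isMeasure.Build _ _ _ regular_extension
  regular_extension0 regular_extension_ge0 regular_extension_sigma_additive.

(** A countable open cover of a compact space has a finite subcover, for which
    finite additivity is enough. *)
Lemma regular_extension_setT : compact [set: X] -> regular_extension setT = 1.
Proof.
move=> Xc; apply/eqP; rewrite eq_le; apply/andP; split.
  by rewrite -(mean_setT m); exact: regular_outer_open openT.
apply: le_regular_outer => O oO XO; move: Xc; rewrite compact_cover.
move=> /(_ nat setT O (fun k _ => oO k)) [].
  by move=> x Xx; have [k _ Ok] := XO x Xx; exists k.
move=> D _ XD.
have [n hn] : exists n, [set: X] `<=` \big[setU/set0]_(k < n) O k.
  exists (\max_(k <- finmap.enum_fset D) k).+1 => x /XD[k /= kD Okx].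
  rewrite -bigcup_mkord; exists k => //=.
  by rewrite ltnS; exact: leq_bigmax_seq.
have le n' : (m (\big[setU/set0]_(k < n') O k) <= \sum_(k < n') m (O k))%R.
  elim: n' => [|n' IH]; first by rewrite !big_ord0 mean_set0.
  by rewrite !big_ord_recr/=; apply: le_trans (mean_leU _ _ _) _; rewrite lerD2r.
apply: (@le_trans _ _ (\sum_(0 <= k < n) (m (O k))%:E)).
  rewrite big_mkord sumEFin lee_fin -(mean_setT m).
  by apply: le_trans (le n); exact: le_mean.
by apply: nneseries_lim_ge => k _; rewrite lee_fin mean_ge0.
Qed.

(** The preimage of an open cover is an open cover with the same means. *)
Lemma regular_outer_preimage (g : X -> X) (A : set X) : continuous g ->
  (forall A, m (g @^-1` A) = m A) -> regular_outer (g @^-1` A) <= regular_outer A.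
Proof.
move=> gc gm; apply: le_regular_outer => O oO AO.
apply: ereal_inf_lbound; exists (fun k => g @^-1` O k).
  split; first by move=> i; exact: sub_sigma_algebra.
  by move=> x /AO[k _ Ok]; exists k.
apply: eq_eseriesr => k _; rewrite /open_content asboolT ?gm//.
by apply: open_comp => // x _; exact: gc.
Qed.

End regular_extension.

(** The outer measure of an open set is at most its mean since the set covers
    itself. For the invariance, [regular_outer_preimage] is used for [B] and for
    its complement. *)
Lemma exists_regular_probability (R : realType) (X : pointedMetricType R)
    (m : mean R X) : compact [set: X] ->
  exists mu : probability (borel X) R,
    (forall O : set X, open O -> (mu O <= (m O)%:E)%E) /\
    (forall g : X -> X, continuous g -> (forall A, m (g @^-1` A) = m A) ->
       forall B : set (borel X), measurable B -> mu (g @^-1` B) = mu B).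
Proof.
move=> Xc.
pose P : probability (borel X) R := HB.pack_for (probability (borel X) R)
  (@regular_extension R X m)
  (Measure_isProbability.Build _ _ _ (@regular_extension R X m)
    (@regular_extension_setT R X m Xc)).
exists P; split => [U oU|g gc gm B mB]; first exact: regular_outer_open.
have mgB : measurable (g @^-1` B : set (borel X)) by exact: borel_preimage.
apply/eqP; rewrite eq_le; apply/andP; split; first exact: regular_outer_preimage.
have := @regular_outer_preimage R X m g (~` B) gc gm.
rewrite preimage_setC.
have h C : measurable C -> P (~` C) = (1 - P C)%E by exact: probability_setC.
move=> h'; have {h'} : (P (~` (g @^-1` B)) <= P (~` B))%E by exact: h'.
rewrite !h// => h'.
have f1 : P B \is a fin_num by exact: fin_num_measure.
have f2 : P (g @^-1` B) \is a fin_num by exact: fin_num_measure.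
by move: h'; rewrite -(fineK f1) -(fineK f2) -!EFinB !lee_fin lerD2l lerN2.
Qed.

(** * Names of orbits and the entropy of a partition *)

Lemma sum_fsbig (R : realType) (W : finType) (P : {pred W}) (f : W -> R) :
  \sum_(w | P w) f w = \sum_(w \in [set` P]) f w.
Proof.
by apply: bigfs; [exact: index_enum_uniq | move=> i _; rewrite mem_index_enum].
Qed.

Section distribution.
Context {R : realType} {d : measure_display} {T : measurableType d}.
Variable P : probability T R.

Definition levels_measurable (W : Type) (N : T -> W) :=
  forall w, measurable (N @^-1` [set w]).

Definition law (W : Type) (N : T -> W) (w : W) : R := fine (P (N @^-1` [set w])).

Lemma levels_measurable_preimage (W : finType) (N : T -> W) (A : set W) :
  levels_measurable N -> measurable (N @^-1` A).
Proof.
move=> mN; have -> : N @^-1` A = \bigcup_(w in A) N @^-1` [set w].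
  apply/seteqP; split => [t At|t [w Aw /= Nw]]; first by exists (N t).
    by rewrite /preimage/= Nw.
by apply: fin_bigcup_measurable => // w _; exact: mN.
Qed.

Lemma levels_measurable_pair (W V : finType) (N : T -> W) (N' : T -> V) :
  levels_measurable N -> levels_measurable N' ->
  levels_measurable (fun t => (N t, N' t)).
Proof.
move=> mN mN' [w v]; have -> : (fun t => (N t, N' t)) @^-1` [set (w, v)] =
    N @^-1` [set w] `&` N' @^-1` [set v].
  by apply/seteqP; split => t /= [-> ->].
by apply: measurableI.
Qed.

Lemma law_ge0 (W : Type) (N : T -> W) w : 0 <= law N w.
Proof. exact: fine_ge0. Qed.

Lemma lawE (W : Type) (N : T -> W) w : levels_measurable N ->
  (law N w)%:E = P (N @^-1` [set w]).
Proof. by move=> mN; rewrite fineK// fin_num_measure. Qed.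

Lemma law_sum (W : finType) (N : T -> W) (Q : {pred W}) : levels_measurable N ->
  \sum_(w | Q w) law N w = fine (P (N @^-1` [set` Q])).
Proof.
move=> mN; rewrite sum_fsbig; apply: EFin_inj.
rewrite fineK ?fin_num_measure//; last exact: levels_measurable_preimage.
have -> : N @^-1` [set` Q] = \bigcup_(w in [set` Q]) N @^-1` [set w].
  apply/seteqP; split => [t At|t [w Aw /= Nw]]; first by exists (N t).
  by rewrite /preimage/= Nw.
rewrite measure_fin_bigcup//; last by move=> w v _ _ [t [/= <- <-]].
by rewrite -fsumEFin//; apply: eq_fsbigr => w _; exact: lawE.
Qed.

Lemma law_mass (W : finType) (N : T -> W) : levels_measurable N ->
  \sum_w law N w = 1.
Proof.
move=> mN; rewrite law_sum//.
have -> : N @^-1` [set` xpredT] = setT by apply/seteqP; split.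
by rewrite probability_setT.
Qed.

Lemma push_law (W V : finType) (N : T -> W) (g : W -> V) :
  levels_measurable N -> push g (law N) = law (g \o N).
Proof.
move=> mN; apply/funext => v; rewrite /push law_sum//; congr (fine (P _)).
by apply/seteqP; split => t /= /eqP.
Qed.

End distribution.

Section names.
Context {X : Type} {K : finType}.
Variables (T : X -> X) (C : X -> K).

(** The name of an orbit segment, in the sense of symbolic dynamics. *)
Definition name n (x : X) : {ffun 'I_n -> K} := [ffun r : 'I_n => C (iter r T x)].

Definition ffun_cat m n (w : {ffun 'I_m -> K} * {ffun 'I_n -> K}) :
    {ffun 'I_(m + n) -> K} :=
  [ffun i => match fintype.split i with inl j => w.1 j | inr k => w.2 k end].

Lemma name_cat m n x :
  name (m + n) x = ffun_cat (name m x, name n (iter m T x)).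
Proof.
apply/ffunP => i; rewrite !ffunE; case: fintype.splitP => j -> /=; rewrite ffunE//.
by rewrite addnC iterD.
Qed.

End names.

Section name_entropy.
Context {R : realType} {d : measure_display} {X : measurableType d} {K : finType}.
Variables (P : probability X R) (T : X -> X) (C : X -> K).
Hypothesis mT : forall B, measurable B -> measurable (T @^-1` B).
Hypothesis PT : forall B, measurable B -> P (T @^-1` B) = P B.
Hypothesis mC : levels_measurable C.

Lemma measurable_iter_preimage r B : measurable B -> measurable (iter r T @^-1` B).
Proof.
elim: r B => [|r IH] B mB //.
have -> : iter r.+1 T @^-1` B = iter r T @^-1` (T @^-1` B) by [].
by apply: IH; exact: mT.
Qed.

Lemma iter_invariant r B : measurable B -> P (iter r T @^-1` B) = P B.
Proof.
elim: r B => [|r IH] B mB //.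
have -> : iter r.+1 T @^-1` B = iter r T @^-1` (T @^-1` B) by [].
by rewrite IH ?PT//; exact: mT.
Qed.

Lemma levels_measurable_name n : levels_measurable (name T C n).
Proof.
move=> w; have -> : name T C n @^-1` [set w] =
    \bigcap_(r in [set: 'I_n]) iter r T @^-1` (C @^-1` [set w r]).
  apply/seteqP; split => [x /= <- r _|x h] /=; first by rewrite ffunE.
  by apply/ffunP => r; rewrite ffunE; exact: h.
apply: fin_bigcap_measurable => // r _.
by apply: measurable_iter_preimage; exact: mC.
Qed.

Definition name_entropy n : R := ent (law P (name T C n)).

Lemma name_entropy_ge0 n : 0 <= name_entropy n.
Proof.
apply: ent_ge0 => [w|]; first exact: law_ge0.
apply: law_mass; exact: levels_measurable_name.
Qed.

(** A name of length [m + n] consists of a name of length [m] and of one of length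
    [n] read [m] steps later; the latter has the law of the names of length [n] by
    invariance. *)
Lemma name_entropyD m n : name_entropy (m + n) <= name_entropy m + name_entropy n.
Proof.
pose N x := (name T C m x, name T C n (iter m T x)).
have mN' : levels_measurable (name T C n \o iter m T).
  move=> w; rewrite comp_preimage; apply: measurable_iter_preimage.
  exact: levels_measurable_name.
have mN : levels_measurable N.
  by apply: levels_measurable_pair => //; exact: levels_measurable_name.
have -> : name_entropy (m + n) = ent (push (@ffun_cat K m n) (law P N)).
  by rewrite push_law//; congr (ent (law P _)); apply/funext => x; exact: name_cat.
apply: le_trans (ent_push_le _ (law_ge0 P N)) _.
have -> : name_entropy m = ent (push fst (law P N)) by rewrite push_law.
have -> : name_entropy n = ent (push snd (law P N)).
  rewrite push_law//; congr ent; apply/funext => w; congr fine.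
  by rewrite -(iter_invariant m)//; exact: levels_measurable_name.
have := @ent_join R _ _ _ fst snd (law P N) (law_ge0 P N) (law_mass P mN).
have -> : push (fun o => (o.1, o.2)) (law P N) = law P N.
  by rewrite -[RHS]push_id; congr push; apply/funext => -[].
by [].
Qed.

Lemma name_entropy_cvg : cvgn (fun n => n%:R^-1 * name_entropy n).
Proof. by apply: fekete; [exact: name_entropy_ge0 | exact: name_entropyD]. Qed.

End name_entropy.

Section collection_entropy.
Context {X : Type} {K : finType}.

Lemma big_collection_join n (G : nat -> K -> set X) :
  \big[@collection_join _/[set setT]]_(p < n) [set G p k | k in [set: K]] =
  [set [set x | forall p : 'I_n, G p (w p) x] | w in [set: {ffun 'I_n -> K}]].
Proof.
elim: n G => [|n IH] G.
  rewrite big_ord0; apply/seteqP; split => [A /= ->|A [w _ <-]] /=.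
    by exists (ffun0 (card_ord 0)) => //; apply/seteqP; split => // x _ [].
  by apply/seteqP; split => // x _ [].
rewrite big_ord_recl (IH (fun p => G p.+1)) /collection_join.
apply/seteqP; split => [_ [_ [k _ <-]] [_ [w _ <-] <-]|_ [w _ <-]] /=.
  exists [ffun p => if unlift ord0 p is Some j then w j else k] => //.
  apply/seteqP; split => x /=.
    move=> h; split; first by have := h ord0; rewrite ffunE unlift_none.
    by move=> p; have := h (lift ord0 p); rewrite ffunE liftK.
  move=> [h0 h] p; rewrite ffunE; case: unliftP => [j|] -> //; exact: h.
exists (G 0%N (w ord0)); first by exists (w ord0).
exists [set x | forall p : 'I_n, G p.+1 ([ffun j => w (lift ord0 j)] p) x].
  by exists [ffun j => w (lift ord0 j)].
apply/seteqP; split => x /= => [[h0 h] p|h].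
  by case: (unliftP ord0 p) => [j|] -> //; have := h j; rewrite ffunE.
by split; [exact: (h ord0) | move=> p; rewrite ffunE; exact: (h (lift ord0 p))].
Qed.

(** The members of the collection and the values of [N] correspond bijectively,
    except for the values that are not attained: these all give the empty set,
    which has no entropy. *)
Lemma collection_entropy_law {R : realType} {d : measure_display}
    {Y : measurableType d} (P : probability Y R) (N : Y -> K) :
  collection_entropy P [set N @^-1` [set w] | w in [set: K]] = ent (law P N).
Proof.
rewrite /collection_entropy /ent sumrN; congr (- _).
pose E := [set w | N @^-1` [set w] !=set0].
pose F (A : set Y) := fine (P A) * ln (fine (P A)).
have F0 : F set0 = 0 by rewrite /F measure0 mul0r.
transitivity (\sum_(w \in E) F (N @^-1` [set w])).
  rewrite -(@reindex_fsbig _ _ _ _ _ (fun w => N @^-1` [set w]) E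
    [set N @^-1` [set w] | w in E] F); last first.
    apply: inj_bij => w v; rewrite !inE => -[t tw] [t' t'v] h.
    have : (N @^-1` [set w]) t by exact: tw.
    by rewrite h => /= tv; rewrite -tw.
  symmetry; apply: fsbig_widen => [_ [w _ <-]|A [[w _ <-]]] /=; first by exists w.
  move=> nE; have [h|/set0P h] := eqVneq (N @^-1` [set w]) set0; first by rewrite h.
  by exfalso; apply: nE; exists w.
rewrite [RHS](sum_fsbig xpredT (fun w => law P N w * ln (law P N w))).
apply: fsbig_widen => [w _ //|w [_ /= nE]].
have [h|/set0P h] := eqVneq (N @^-1` [set w]) set0; last by exfalso; exact: nE.
by rewrite /= /law h.
Qed.

End collection_entropy.

Section partition_entropy.
Context {R : realType} {Gamma : correspondence R}.

Lemma vertex_iter_shift r (x : path_space Gamma) :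
  vertex (iter r path_shift x) = fun k => vertex x (r + k)%N.
Proof. by elim: r => [//|r IH] /=; rewrite IH; apply/funext => k; rewrite addnS. Qed.

Lemma letter_iter_shift r (x : path_space Gamma) :
  letter (iter r path_shift x) = fun k => letter x (r + k)%N.
Proof. by elim: r => [//|r IH] /=; rewrite IH; apply/funext => k; rewrite addnS. Qed.

(** The letter belongs to the symbol because the entropy of a correspondence takes
    into account which component a path follows. *)
Definition symbol (A : finType) (c : sphere R -> A) (x : path_space Gamma) :
  A * 'I_(ncomp Gamma) := (c (vertex x 0%N), letter x 0%N).

Lemma nameE (A : finType) (c : sphere R -> A) n (x : path_space Gamma) (r : 'I_n) :
  name path_shift (symbol c) n x r = (c (vertex x r), letter x r).
Proof. by rewrite ffunE /symbol vertex_iter_shift letter_iter_shift addn0. Qed.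

Lemma measurable_shift_preimage (B : set (borel (path_space Gamma))) :
  measurable B -> measurable (path_shift @^-1` B : set (borel (path_space Gamma))).
Proof. by apply: borel_preimage; exact: continuous_path_shift. Qed.

Lemma levels_measurable_symbol (A : finType) (c : borel (sphere R) -> A) :
  levels_measurable c ->
  levels_measurable (symbol c : borel (path_space Gamma) -> A * 'I_(ncomp Gamma)).
Proof.
move=> mc; apply: levels_measurable_pair => [a|t].
  apply: (@borel_preimage R (path_space Gamma) (sphere R)
    (fun x => vertex x 0%N) (c @^-1` [set a])) (mc a).
  exact: continuous_vertex.
by apply: sub_sigma_algebra; exact: open_letter.
Qed.

Lemma collection_entropy_name (mu : probability (borel (path_space Gamma)) R)
    (s : nat) (c : borel (sphere R) -> 'I_s) n :
  collection_entropy mu (\big[@collection_join _/[set setT]]_(p < n)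
    cylinders (fun i => c @^-1` [set i]) p) =
  name_entropy mu path_shift (symbol c) n.
Proof.
suff : \big[@collection_join _/[set setT]]_(p < n)
    cylinders (fun i => c @^-1` [set i]) p =
  [set name path_shift (symbol c) n @^-1` [set w] | w in setT].
  by move=> ->; rewrite collection_entropy_law.
pose G p (k : 'I_s * 'I_(ncomp Gamma)) : set (path_space Gamma) :=
  [set x | c (vertex x p) = k.1 /\ letter x p = k.2].
have E p : cylinders (fun i => c @^-1` [set i]) p = [set G p k | k in setT].
  apply/seteqP; split => [_ [i _ [t _ <-]]|_ [[i t] _ <-]] /=; first by exists (i, t).
  by exists i => //; exists t.
under eq_bigr do rewrite E.
rewrite big_collection_join; apply: eq_imagel => w _.
apply/seteqP; split => x /= => [h|<- p].
  by apply/ffunP => r; rewrite nameE; have [-> ->] := h r; case: (w r).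
by rewrite nameE.
Qed.

Lemma partition_entropy_cvg (mu : probability (borel (path_space Gamma)) R)
    (s : nat) (c : borel (sphere R) -> 'I_s) :
  shift_invariant mu -> levels_measurable c ->
  n%:R^-1 * name_entropy mu path_shift (symbol c) n @[n --> \oo] -->
    partition_entropy mu (fun i => c @^-1` [set i]).
Proof.
move=> muT mc; rewrite /partition_entropy.
under [X in limn X]eq_fun do rewrite collection_entropy_name.
apply: name_entropy_cvg => //; first exact: measurable_shift_preimage.
exact: levels_measurable_symbol.
Qed.

Lemma partition_code (s : nat) (Q : 'I_s -> set (borel (sphere R))) :
  measurable_partition Q -> exists2 c : borel (sphere R) -> 'I_s,
    levels_measurable c & Q = fun i => c @^-1` [set i].
Proof.
move=> [[cQ tQ _] mQ].
have /choice[c hc] : forall x : borel (sphere R), exists i, Q i x.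
  by move=> x; have : [set: borel (sphere R)] x by []; rewrite -cQ => -[i _ Qi]; exists i.
have QE : Q = fun i => c @^-1` [set i].
  apply/funext => i; apply/seteqP; split => x /=; last by move=> <-.
  by move=> Qi; apply: tQ => //; exists x.
by exists c => // i; have := mQ i; rewrite {1}QE.
Qed.

End partition_entropy.

(** * Uniformity and regularity on compact metric spaces *)

Section compact_metric.
Context {R : realType} {X : pointedMetricType R}.
Hypothesis Xc : compact [set: X].

(** Near every point [x] some [i > 0] works for all points close to [x]; compactness,
    in the form of near coverings, gives one [i] for all [x]. *)
Lemma uniform_continuity (f : X -> R) (e : R) : continuous f -> 0 < e ->
  exists2 d : R, 0 < d & forall x y, mdist x y < d -> `|f x - f y| <= e.
Proof.
move=> fc e0.
pose P (i : R) x := forall y, mdist x y < i -> `|f x - f y| <= e.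
have := compact_near_coveringP [set: X]; case => /(_ Xc) + _.
move=> /(_ R (0^'+) P _) [].
  move=> x _; have e20 : 0 < e / 2 by rewrite divr_gt0.
  have : \forall y \near x, `|f x - f y| < e / 2.
    by have /cvgrPdist_lt/(_ _ e20) := fc x.
  move=> /metricType_numDomainType.nbhs_mdistP[r /= r0 hr].
  exists ([set y | mdist x y < r / 2], [set i | i < r / 2]) => /=.
    split; last by apply: nbhs_right_lt; rewrite divr_gt0.
    by apply/metricType_numDomainType.nbhs_mdistP; exists (r / 2) => //=; rewrite divr_gt0.
  move=> [x' i] /= [xx' ir] y x'y.
  have h1 : `|f x - f x'| < e / 2.
    by apply: hr => /=; apply: (lt_le_trans xx'); rewrite ler_pdivrMr// ler_pMr// ler1n.
  have h2 : `|f x - f y| < e / 2.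
    apply: hr => /=; apply: le_lt_trans (metric_triangle x x' y) _.
    by rewrite [ltRHS]splitr ltrD//; exact: lt_trans ir.
  rewrite distrC in h1.
  have -> : f x' - f y = (f x' - f x) + (f x - f y) by ring.
  by apply: le_trans (ler_normD _ _) _; rewrite [leRHS]splitr lerD// ltW.
move=> r /= r0 hr; exists (r / 2); first by rewrite divr_gt0.
move=> x y; apply: (hr (r / 2)) => //=; last by rewrite divr_gt0.
by rewrite sub0r normrN gtr0_norm ?divr_gt0// ltr_pdivrMr// ltr_pMr// ltr1n.
Qed.

Lemma closed_gap (F G : set X) : closed F -> closed G -> F `&` G = set0 ->
  exists2 d : R, 0 < d & forall x y, F x -> G y -> d <= mdist x y.
Proof.
move=> cF cG FG.
have [->|/set0P F0] := eqVneq F set0; first by exists 1.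
have [->|/set0P G0] := eqVneq G set0; first by exists 1.
have Gc : compact G by exact: subclosed_compact Xc _.
have [z Gz hz] := compact_EVT_min G0 Gc (continuous_subspaceT (continuous_dist_to F0)).
exists (dist_to F z).
  apply: dist_to_gt0 => // Fz; have : (F `&` G) z by split => //; exact/set_mem.
  by rewrite FG.
move=> x y Fx Gy; rewrite metric_sym; apply: le_trans (hz y _) _; first exact/mem_set.
exact: dist_to_le.
Qed.

Lemma finite_gap (A : finType) (F : A -> set X) : (forall a, closed (F a)) ->
  (forall a b, a != b -> F a `&` F b = set0) ->
  exists2 d : R, 0 < d & forall a b x y, F a x -> F b y -> mdist x y < d -> a = b.
Proof.
move=> cF dF.
have h (ab : A * A) : exists d : R, 0 < d /\ (ab.1 != ab.2 ->
    forall x y, F ab.1 x -> F ab.2 y -> d <= mdist x y).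
  have [->|ab12] := eqVneq ab.1 ab.2; first by exists 1.
  by have [d d0 hd] := closed_gap (cF _) (cF _) (dF _ _ ab12); exists d.
have /choice[d hd] := h.
exists (\big[Num.min/1]_ab d ab).
  by apply/bigmin_gtP; split => // ab _; exact: (hd ab).1.
move=> a b x y Fx Fy xy; apply/eqP; apply: contraTT xy => ab; rewrite -leNgt.
apply: le_trans ((hd (a, b)).2 ab x y Fx Fy); exact: bigmin_le_cond.
Qed.

End compact_metric.

Section closed_regularity.
Context {R : realType} {X : pointedMetricType R} (mu : probability (borel X) R).

Let approx (B : set X) := forall e : R, 0 < e -> exists F U : set X,
  [/\ closed F, open U, F `<=` B, B `<=` U &
      (mu (U `\` F : set (borel X)) <= e%:E)%E].

Let cvg_small (D : (set (borel X))^nat) (e : R) :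
  (forall i, measurable (D i)) -> {homo D : n m / (n <= m)%N >-> (m <= n)%O} ->
  (mu (\bigcap_n D n) < e%:E)%E -> exists n, (mu (D n) <= e%:E)%E.
Proof.
move=> mD hD De; have mI : measurable (\bigcap_n D n) by exact: bigcap_measurable.
have D0 : (mu (D 0%N) < +oo)%E by rewrite -ge0_fin_numE// fin_num_measure.
have := nonincreasing_cvg_mu D0 mD mI hD.
move=> /(_ _ (open_nbhs_nbhs _)) => h.
have [|N _ hN] := h [set t | (t < e%:E)%E].
  by split => //; exact: open_ereal_lt_ereal.
by exists N; apply: ltW; exact: (hN N (leqnn N)).
Qed.

Let approx_open U : open U -> approx U.
Proof.
move=> oU e e0.
have [/eqP|/set0P F0] := eqVneq (~` U) set0.
  move=> /eqP UT; exists U, U; split => //; last by rewrite setDv measure0 lee_fin ltW.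
  by rewrite -[U]setCK UT setC0; exact: closedT.
pose F n := [set x : X | 2 ^- n <= dist_to (~` U) x].
have cF n : closed (F n).
  have -> : F n = ~` [set x | dist_to (~` U) x < 2 ^- n].
    by apply/seteqP; split => x; rewrite /F/= leNgt => /negP.
  by apply: open_closedC; exact: dist_to_lt.
have FU n : F n `<=` U.
  move=> x; rewrite /F/= => h; apply: contrapT => nU.
  have := dist_to_le F0 x nU; rewrite mdistxx => h'.
  by have := le_trans h h'; rewrite leNgt invr_gt0 exprn_gt0.
have [n hn] : exists n, (mu ((U `\` F n) : set (borel X)) <= e%:E)%E.
  apply: cvg_small.
  - by move=> i; apply: measurableD; [exact: borel_open | exact: borel_closed].
  - move=> n m nm; apply/subsetPset; apply: setDS => x /=; apply: le_trans.
    by rewrite lef_pV2 ?posrE ?exprn_gt0// ler_weXn2l// ler1n.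
  - suff -> : \bigcap_n (U `\` F n) = set0 by rewrite measure0 lte_fin.
    apply/seteqP; split => // x h; have [Ux _] := h 0%N I.
    have d0 : 0 < dist_to (~` U) x by apply: dist_to_gt0 => //; exact: open_closedC.
    have [k hk] := half_pow_small ler01 d0.
    have [_] := h k I; apply; rewrite /F/= ltW//.
    by have := hk k (leqnn k); rewrite mulr1.
by exists (F n), U; split.
Qed.

Let approxC B : approx B -> approx (~` B).
Proof.
move=> h e e0; have [F [U [cF oU FB BU m]]] := h e e0.
exists (~` U), (~` F); split; [exact: open_closedC|exact: closed_openC|exact: subsetC|exact: subsetC|].
by rewrite setDE setCK setIC -setDE.
Qed.

Let approx_bigcup (B : (set X)^nat) : (forall n, approx (B n)) -> approx (\bigcup_n B n).
Proof.
move=> h e e0; have e20 : 0 < e / 2 by rewrite divr_gt0.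
have e2n n : 0 < (e / 2) / (2 ^ n.+1)%:R by rewrite divr_gt0// ltr0n expn_gt0.
have /choice[FU hFU] : forall n, exists FU : set X * set X,
    [/\ closed FU.1, open FU.2, FU.1 `<=` B n, B n `<=` FU.2 &
      (mu (FU.2 `\` FU.1 : set (borel X)) <= ((e / 2) / (2 ^ n.+1)%:R)%:E)%E].
  by move=> n; have [F [U hh]] := h n _ (e2n n); exists (F, U).
pose U := \bigcup_n (FU n).2; pose K N := \big[setU/set0]_(n < N) (FU n).1.
have KE N : K N = \bigcup_(n < N) (FU n).1.
  by rewrite /K (bigcup_mkord N (fun n => (FU n).1)).
have oU : open U by apply: bigcup_open => n _; have [] := hFU n.
have cK N : closed (K N).
  by apply: closed_bigsetU => n _; have [] := hFU n.
have mFU n : measurable ((FU n).2 `\` (FU n).1 : set (borel X)).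
  by have [cF oV _ _ _] := hFU n; apply: measurableD; [exact: borel_open | exact: borel_closed].
have [N hN] : exists N, (mu (U `\` K N : set (borel X)) <= e%:E)%E.
  apply: cvg_small.
  - by move=> i; apply: measurableD; [exact: borel_open | exact: borel_closed].
  - move=> n m nm; apply/subsetPset; apply: setDS.
    rewrite !KE => x [k /= kn Fk]; exists k => //=.
    exact: leq_trans nm.
  - apply: (@le_lt_trans _ _ (mu (\bigcup_n ((FU n).2 `\` (FU n).1) : set (borel X)))).
      apply: le_measure; rewrite ?inE.
      + apply: bigcap_measurable => // n _.
        by apply: measurableD; [exact: borel_open | exact: borel_closed].
      + exact: bigcup_measurable.
      + move=> x xh; have [[n _ Un] _] := xh 0%N I; exists n => //; split => // Fn.
        have [_] := xh n.+1 I; apply; rewrite /K big_ord_recr/=; by right.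
    have mD : measurable (\bigcup_n ((FU n).2 `\` (FU n).1) : set (borel X)).
      by apply: bigcupT_measurable => n; exact: mFU.
    apply: le_lt_trans (measure_sigma_subadditive mu mFU mD (@subset_refl _ _)) _.
    apply: (@le_lt_trans _ _ (\sum_(n <oo) ((e / 2) / (2 ^ n.+1)%:R)%:E)%E).
      by apply: lee_nneseries => // n _; have [] := hFU n.
    have := @epsilon_trick0 R (e / 2) xpredT (ltW e20).
    move=> /le_lt_trans; apply; by rewrite lte_fin ltr_pdivrMr// ltr_pMr// ltr1n.
exists (K N), U; split => //.
- by rewrite KE => x [n _ Fn]; exists n => //; have [_ _ h1 _ _] := hFU n; exact: h1.
- by move=> x [n _ Bn]; exists n => //; have [_ _ _ h1 _] := hFU n; exact: h1.
Qed.

(** The sets squeezed between a closed and an open set whose difference has small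
    measure form a sigma-algebra, to which an open set belongs because it is the
    increasing union of the sets of points at distance at least [2^-n] from its
    complement. *)
Lemma closed_inner_regular (B : set (borel X)) (e : R) : measurable B -> 0 < e ->
  exists F : set X, [/\ closed F, F `<=` B & (mu (B `\` F : set (borel X)) <= e%:E)%E].
Proof.
move=> mB e0; have : approx B.
  move: B mB; apply: smallest_sub => [|U oU]; last exact: approx_open.
  split => [|A aA|A aA].
  - by apply: approx_open; exact: open0.
  - by rewrite setTD; exact: approxC.
  - exact: approx_bigcup.
move=> /(_ e e0)[F [U [cF oU FB BU m]]]; exists F; split => //.
apply: le_trans m; apply: le_measure; rewrite ?inE.
- by apply: measurableD => //; exact: borel_closed.
- by apply: measurableD; [exact: borel_open | exact: borel_closed].
- exact: setSD.
Qed.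

End closed_regularity.

Section integral_law.
Context {R : realType} {d : measure_display} {T : measurableType d}.
Context (P : probability T R) {A : finType} (c : T -> A) (f : T -> R).
Hypothesis mc : levels_measurable c.
Hypothesis mf : measurable_fun setT f.
Hypothesis bf : [bounded f x | x in [set: T]].
Local Open Scope ereal_scope.

Let split_integral : \int[P]_x (f x)%:E = \sum_a \int[P]_(x in c @^-1` [set a]) (f x)%:E.
Proof.
have E : [set: T] = \big[setU/set0]_(a <- index_enum A) (c @^-1` [set a]).
  rewrite -bigcup_seq; apply/seteqP; split => x // _; exists (c x) => //=.
  exact: mem_index_enum.
rewrite {1}E integral_bigsetU_EFin//; first exact: index_enum_uniq.
  by move=> a b _ _ [x [/= <- <-]].
by rewrite -E; apply/measurable_EFinP.
Qed.

Let fint a : P.-integrable (c @^-1` [set a]) (EFin \o f).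
Proof.
apply: (@integrableS _ _ _ _ setT) => //.
apply: measurable_bounded_integrable => //.
by rewrite -ge0_fin_numE// fin_num_measure.
Qed.

Let cint a r : P.-integrable (c @^-1` [set a]) (EFin \o cst r).
Proof. by apply: finite_measure_integrable_cst; exact: mc. Qed.

Let cst_integral (v : A -> R) :
  \sum_a \int[P]_(x in c @^-1` [set a]) (EFin \o cst (v a)) x =
  (\sum_a v a * law P c a)%R%:E.
Proof.
rewrite -sumEFin; apply: eq_bigr => a _.
rewrite EFinM lawE//. exact: (integral_cst P (mc a) (v a)%:E).
Qed.

Lemma integral_law_le (v : A -> R) : (forall x, f x <= v (c x))%R ->
  \int[P]_x (f x)%:E <= (\sum_a v a * law P c a)%R%:E.
Proof.
move=> fv; rewrite split_integral -cst_integral; apply: lee_sum => a _.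
apply: le_integral => //.
by move=> x; rewrite inE/= => cx; rewrite lee_fin -cx.
Qed.

Lemma integral_law_ge (v : A -> R) : (forall x, v (c x) <= f x)%R ->
  (\sum_a v a * law P c a)%R%:E <= \int[P]_x (f x)%:E.
Proof.
move=> fv; rewrite split_integral -cst_integral; apply: lee_sum => a _.
apply: le_integral => //.
by move=> x; rewrite inE/= => cx; rewrite lee_fin -cx.
Qed.

End integral_law.

(** * Weights of words and separated sets *)

(** Greedy choice along the list. *)
Lemma maximal_separated (T : choiceType) (close : T -> T -> Prop) (s : seq T) :
  (forall x, close x x) -> (forall x y, close x y -> close y x) ->
  exists E : seq T, [/\ uniq E,
    forall x y, x \in E -> y \in E -> x <> y -> ~ close x y,
    {subset E <= s} & forall x, x \in s -> exists2 y, y \in E & close x y].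
Proof.
move=> clxx clC; elim: s => [|x s [E [uE sE Es hE]]]; first by exists [::].
have [[y yE xy]|nE] := pselect (exists2 y, y \in E & close x y).
  exists E; split => //.
    by move=> z /Es; rewrite in_cons => ->; rewrite orbT.
  move=> z; rewrite in_cons => /orP[/eqP ->|/hE//]; by exists y.
have xE : x \notin E by apply/negP => xE; apply: nE; exists x.
exists (x :: E); split.
- by rewrite /= xE.
- move=> y z; rewrite !in_cons => /orP[/eqP ->|yE] /orP[/eqP ->|zE] // yz cl.
  + by apply: nE; exists z.
  + by apply: nE; exists y => //; exact: clC.
  + exact: sE cl.
- by move=> z; rewrite !in_cons => /orP[->//|/Es ->]; rewrite orbT.
- move=> z; rewrite in_cons => /orP[/eqP ->|/hE[y yE zy]].
    by exists x => //; rewrite mem_head.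
  by exists y => //; rewrite in_cons yE orbT.
Qed.

Section finite_restriction.
Context {R : realType} {Gamma : correspondence R}.

Definition restrict_path n (x : path_space Gamma) : finite_path_type Gamma n :=
  ([ffun r : 'I_n.+1 => vertex x r], [ffun r : 'I_n => letter x r]).

Lemma restrict_path_finite n x : finite_paths (restrict_path n x).
Proof. by move=> r; rewrite !ffunE; exact: path_spaceP. Qed.

(** Every component projects onto the sphere, so that a path can always be
    prolonged; [V] and [L] follow the first component after time [n]. *)
Lemma finite_path_extend n (p : finite_path_type Gamma n) : finite_paths p ->
  exists x, restrict_path n x = p.
Proof.
case: p => [x a] h.
have := h; rewrite /finite_paths/= => {}h.
pose t0 := Ordinal (ncomp_gt0 Gamma).
pose V k := if (k <= n)%N then x (inord k)
  else iter (k - n) (fun y => sval (component_next t0 y)) (x ord_max).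
pose L k := if insub k is Some i then a i else t0 : 'I_(ncomp Gamma).
have hVL r : component (L r) (V r, V r.+1).
  rewrite /L /V; case: insubP => [i rn ri|].
    have in1 : (i <= n)%N := ltnW (ltn_ord i).
    have in2 : (i < n)%N := ltn_ord i.
    rewrite -ri in1 in2.
    have := h i; congr (component _ (x _, x _)); apply/val_inj => /=.
      by rewrite inordK// ltnS ltnW// ltn_ord.
    by rewrite inordK// ltnS ltn_ord.
  rewrite -leqNgt => nr; rewrite ltnNge nr/= subSn//=.
  have -> : (if (r <= n)%N then x (inord r) else
     iter (r - n) (fun y => sval (component_next t0 y)) (x ord_max)) =
     iter (r - n) (fun y => sval (component_next t0 y)) (x ord_max).
    case: ifP => // rn; have -> : r = n by apply/eqP; rewrite eqn_leq rn.
    by rewrite subnn/=; congr (x _); apply/val_inj; rewrite /= inordK.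
  exact: svalP (component_next t0 _).
exists (PathSpace hVL); congr pair; apply/ffunP => r; rewrite ffunE/=.
  by rewrite /V -ltnS ltn_ord inord_val.
by rewrite /L insubT//= => hr; congr (a _); exact/val_inj.
Qed.

Definition path_weight (f : sphere R -> R) n (p : finite_path_type Gamma n) : R :=
  \prod_(k < n) expR (f (p.1 (widen_ord (leqnSn n) k))).

Lemma path_weight_gt0 f n (p : finite_path_type Gamma n) : 0 < path_weight f p.
Proof. by apply: prodr_gt0 => k _; exact: expR_gt0. Qed.

Lemma path_weight_restrict f n x :
  path_weight f (restrict_path n x) = \prod_(k < n) expR (f (vertex x k)).
Proof. by apply: eq_bigr => k _; rewrite /= ffunE. Qed.

Lemma separated_sum_seq f n (E : seq (finite_path_type Gamma n)) : uniq E ->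
  separated_sum f [set` E] = (\sum_(p <- E) path_weight f p)%:E.
Proof.
move=> uE; rewrite /separated_sum esum_fset//; last first.
  by move=> p _; rewrite lee_fin ltW// path_weight_gt0.
  exact: finite_seq.
by rewrite -fsbig_seq// sumEFin.
Qed.

End finite_restriction.

Section word_weights.
Context {R : realType} {Gamma : correspondence R} {A : finType}.
Variables (f : sphere R -> R) (c : sphere R -> A) (bad : sphere R -> bool).
Variables (v : A -> R) (delta eta rho : R).
Hypothesis delta0 : 0 <= delta.
Hypothesis rho0 : 0 < rho.
Hypothesis c_good : forall x y z, ~~ bad x -> ~~ bad y ->
  mdist x z <= delta -> mdist y z <= delta -> c x = c y.
Hypothesis v_le : forall x, v (c x) <= f x + eta.
Hypothesis f_unif : forall x y, mdist x y <= delta -> f x <= f y + eta.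

Let K := ((A * bool) * 'I_(ncomp Gamma))%type.
Let code x := (c x, bad x).
Notation itinerary := (name path_shift (symbol code)).

(** A bad letter does not locate the point within [delta], so that any of the
    [#|A|] cells has to be allowed for it; a small factor [rho] makes up for them. *)
Definition letter_weight (k : K) : R := expR (v k.1.1) * (if k.1.2 then rho else 1).

Lemma letter_weight_gt0 k : 0 < letter_weight k.
Proof. by rewrite mulr_gt0 ?expR_gt0//; case: ifP. Qed.

(** Words that no path reads must not contribute to the sum. *)
Definition word_weight n (w : {ffun 'I_n -> K}) : R :=
  if `[< exists x : path_space Gamma, itinerary n x = w >]
  then \prod_(i < n) letter_weight (w i) else 0.

Lemma word_weight_ge0 n w : 0 <= @word_weight n w.
Proof.
rewrite /word_weight; case: ifP => // _.
by apply: prodr_ge0 => i _; exact: ltW (letter_weight_gt0 _).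
Qed.

(** An upper bound of the weight of the symbol of a point within [delta] of [z]; it
    vanishes on the symbols that no such point has. *)
Let near_weight (z : sphere R) (t : 'I_(ncomp Gamma)) (k : K) : R :=
  ((k.2 == t) && (k.1.2 || `[< exists2 x, ~~ bad x /\ c x = k.1.1 & mdist x z <= delta >]))%:R
  * (expR (f z + 2 * eta) * (if k.1.2 then rho else 1)).

Let near_weight_ge0 z t k : 0 <= near_weight z t k.
Proof. by rewrite mulr_ge0// mulr_ge0 ?expR_ge0//; case: ifP => // _; exact: ltW. Qed.

(** Among the good symbols only one cell is possible near [z], which accounts for
    the [1]; the bad symbols may have any cell. *)
Let sum_near_weight z t :
  \sum_k near_weight z t k <= expR (f z) * (expR (2 * eta) * (1 + #|A|%:R * rho)).
Proof.
pose g a := `[< exists2 x, ~~ bad x /\ c x = a & mdist x z <= delta >].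
have -> : \sum_k near_weight z t k =
    \sum_(ab : A * bool) (ab.2 || g ab.1)%:R * (expR (f z + 2 * eta) * (if ab.2 then rho else 1)).
  rewrite -(pair_bigA _ (fun ab t' => near_weight z t (ab, t')))/=.
  apply: eq_bigr => ab _; rewrite (bigD1 t)//= big1 ?addr0 => [|t' /negbTE t't].
    by rewrite /near_weight/= eqxx.
  by rewrite /near_weight/= t't mul0r.
rewrite -(pair_bigA _ (fun a (b : bool) => (b || g a)%:R * (expR (f z + 2 * eta) * (if b then rho else 1))))/=.
under eq_bigr do rewrite big_bool/= mul1r mulr1.
rewrite big_split/= sumr_const -mulr_suml -[_ *+ #|A|]mulr_natl.
have g1 : \sum_a (g a)%:R <= 1 :> R.
  have [[a ga]|ng] := pselect (exists a, g a); last first.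
    by rewrite big1// => a _; case: (boolP (g a)) => // ga; exfalso; apply: ng; exists a.
  rewrite (bigD1 a)//= big1 ?addr0; first by case: (g a).
  move=> b ba; case: (boolP (g b)) => // gb; exfalso; move/eqP: ba; apply.
  move: ga gb => /asboolP[x [bx <-] xz] /asboolP[y [by' <-] yz].
  exact: c_good yz xz.
rewrite expRD.
have -> : #|A|%:R * (expR (f z) * expR (2 * eta) * rho) +
  (\sum_a (g a)%:R) * (expR (f z) * expR (2 * eta)) =
  expR (f z) * (expR (2 * eta) * (\sum_a (g a)%:R + #|A|%:R * rho)) by ring.
by rewrite !ler_pM2l ?expR_gt0// lerD2r.
Qed.

(** Choose a path for every word that is read, and a maximal separated subset of
    the chosen paths. A word is then read near an element of this subset, and the
    sum over the words read near a given path is bounded by a product over time of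
    sums over symbols. *)
Lemma sum_word_weight n : exists E : seq (finite_path_type Gamma n),
  [/\ uniq E, separated_set delta [set` E] &
  \sum_w @word_weight n w <=
    (expR (2 * eta) * (1 + #|A|%:R * rho)) ^+ n * \sum_(p <- E) path_weight f p].
Proof.
pose ne (w : {ffun 'I_n -> K}) := `[< exists x : path_space Gamma, itinerary n x = w >].
have /choice[x hx] : forall w, exists x : path_space Gamma, ne w -> itinerary n x = w.
  move=> w; have [/asboolP[x xw]|nw] := boolP (ne w); first by exists x.
  by exists some_path.
pose close (p q : finite_path_type Gamma n) := ~ separated_points delta p q.
have close_refl p : close p p.
  by move=> [[r]|[r]//]; rewrite mdistxx ltNge delta0.
have close_sym p q : close p q -> close q p.
  move=> pq [[r qp]|[r qp]]; apply: pq; [left; exists r|right; exists r].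
    by rewrite metric_sym.
  by move=> h; apply: qp.
have [E [uE sE Es hE]] := maximal_separated
  [seq restrict_path n (x w) | w <- enum ne] close_refl close_sym.
exists E; split => //.
  split => [p /= /Es /mapP[w _ ->]|p q /= pE qE pq]; first exact: restrict_path_finite.
  by apply: contrapT; exact: sE.
pose G (p : finite_path_type Gamma n) (w : {ffun 'I_n -> K}) :=
  \prod_(i < n) near_weight (p.1 (widen_ord (leqnSn n) i)) (p.2 i) (w i).
have G0 p w : 0 <= G p w by apply: prodr_ge0 => i _; exact: near_weight_ge0.
apply: (@le_trans _ _ (\sum_w \sum_(p <- E) G p w)).
  apply: ler_sum => w _; rewrite /word_weight -/(ne w); case: ifP => [new|_]; last first.
    by apply: sumr_ge0 => p _; exact: G0.
  have xw := hx w new.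
  have [|p pE xp] := hE (restrict_path n (x w)).
    by apply/mapP; exists w => //; rewrite mem_enum.
  rewrite (big_rem p)//=; apply: ler_wpDr; first by apply: sumr_ge0 => q _; exact: G0.
  apply: ler_prod => i _; rewrite (ltW (letter_weight_gt0 _))/=.
  have wi : w i = ((c (vertex (x w) i), bad (vertex (x w) i)), letter (x w) i).
    by rewrite -{1}xw nameE.
  have d1 : mdist (vertex (x w) i) (p.1 (widen_ord (leqnSn n) i)) <= delta.
    rewrite leNgt; apply/negP => h; apply: xp; left.
    by exists (widen_ord (leqnSn n) i); rewrite ffunE.
  have d2 : letter (x w) i = p.2 i.
    apply: contrapT => h; apply: xp; right; exists i; by rewrite ffunE.
  rewrite /near_weight /letter_weight wi/= d2 eqxx/=.
  have -> : bad (vertex (x w) i) || `[< exists2 y, ~~ bad y /\ c y = c (vertex (x w) i)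
      & mdist y (p.1 (widen_ord (leqnSn n) i)) <= delta >].
    case: (boolP (bad _)) => //= nb; apply/asboolP; by exists (vertex (x w) i).
  rewrite mul1r ler_wpM2r//; first by case: ifP => // _; exact: ltW.
  rewrite ler_expR; have h1 := v_le (vertex (x w) i); have h2 := f_unif d1.
  by move: h1 h2; set a := v _; set b := f _; set b' := f _; lra.
rewrite exchange_big/= mulr_sumr; apply: ler_sum => p _.
have -> : \sum_w G p w = \prod_(i < n) \sum_k
    near_weight (p.1 (widen_ord (leqnSn n) i)) (p.2 i) k by rewrite bigA_distr_bigA.
rewrite /path_weight.
rewrite -[X in _ ^+ X]card_ord -prodr_const -big_split/=.
apply: ler_prod => i _; rewrite sumr_ge0/=; last by move=> k _; exact: near_weight_ge0.
by rewrite [leRHS]mulrC; exact: sum_near_weight.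
Qed.

End word_weights.

(** * Entropy plus integral is at most the pressure *)

Section continuous_code.
Context {R : realType} {X : pointedMetricType R}.
Hypothesis Xc : compact [set: X].
Variables (f : X -> R) (fc : continuous f).

Lemma continuous_borel_measurable : measurable_fun [set: borel X] (f : borel X -> R).
Proof.
apply: (measurability (@RGenOInfty.G R)) => //; first exact: RGenOInfty.measurableE.
move=> _ [_ [a ->] <-]; rewrite setTI; apply: sub_sigma_algebra.
by apply: open_comp => [x _|]; [exact: fc | exact: interval_open].
Qed.

Lemma continuous_compact_bounded : exists B : R, forall x, `|f x| <= B.
Proof.
have nc : continuous (fun x => `|f x|).
  by move=> x; apply: (@continuous_comp _ _ _ f (@Num.norm _ R)); [exact: fc|exact: norm_continuous].
have [z _ hz] := compact_EVT_max (ex_intro _ point I) Xc (continuous_subspaceT nc).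
by exists `|f z| => x; apply: hz; exact/mem_set.
Qed.

Lemma bounded_continuous : [bounded f x | x in [set: X]].
Proof.
have [B fB] := continuous_compact_bounded; exists B; split; first exact: num_real.
by move=> M BM x _ /=; exact: le_trans (fB x) (ltW BM).
Qed.

(** The code of a point is the interval of length [e] to which the value of [f]
    belongs. *)
Lemma fine_code (e : R) : 0 < e -> exists (k : nat) (c : borel X -> 'I_k) (v : 'I_k -> R),
  levels_measurable c /\ forall x, f x <= v (c x) <= f x + e.
Proof.
move=> e0; have [B fB] := continuous_compact_bounded.
have fB' x : 0 <= f x + B by have := fB x; rewrite ler_norml => /andP[h _]; lra.
have [k hk] : exists k, forall x, (Num.truncn ((f x + B) / e) <= k)%N.
  exists (Num.truncn ((B + B) / e)) => x; apply: le_truncn.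
  rewrite ler_pM2r ?invr_gt0// lerD2r; exact: le_trans (ler_norm _) (fB x).
pose c (x : borel X) : 'I_k.+1 := inord (Num.truncn ((f x + B) / e)).
have cE x : c x = Num.truncn ((f x + B) / e) :> nat by rewrite /c inordK// ltnS.
have c1 x (i : 'I_k.+1) : (c x = i) <-> (i%:R * e - B <= f x < i.+1%:R * e - B).
  rewrite lerBlDr ltrBrDr -ler_pdivlMr// -ltr_pdivrMr//.
  have := truncn_itv (divr_ge0 (fB' x) (ltW e0)); rewrite -cE => /andP[h1 h2].
  split => [<-|/andP[h3 h4]]; first by rewrite h1.
  have a1 : (c x < i.+1)%N by rewrite -(ltr_nat R); exact: le_lt_trans h1 h4.
  have a2 : (i < (c x).+1)%N by rewrite -(ltr_nat R); exact: le_lt_trans h3 h2.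
  by apply/val_inj/eqP; rewrite eqn_leq; apply/andP; split; [exact: a1|exact: a2].
exists k.+1, c, (fun i => i.+1%:R * e - B); split => [i|x]; last first.
  have /c1/andP[h1 h2] : c x = c x by [].
  rewrite (ltW h2)/=; move: h1; rewrite -natr1 mulrDl mul1r.
  by move: (_ * e) => u; lra.
have -> : c @^-1` [set i] = f @^-1` [set` `[i%:R * e - B, i.+1%:R * e - B[%R].
  by apply/seteqP; split => x /=; rewrite in_itv/=; apply c1.
rewrite -[X in measurable X]setTI; apply: continuous_borel_measurable => //.
Qed.

End continuous_code.

Lemma ln_prod (R : realType) n (F : 'I_n -> R) : (forall i, 0 < F i) ->
  ln (\prod_(i < n) F i) = \sum_(i < n) ln (F i).
Proof.
move=> F0; elim: n F F0 => [|n IH] F F0; first by rewrite !big_ord0 ln1.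
rewrite !big_ord_recr/= lnM ?posrE ?IH//; apply: prodr_gt0 => i _; exact: F0.
Qed.

Section pressure_limit.
Context {R : realType} (Gamma : correspondence R) (f : sphere R -> R).
Local Open Scope ereal_scope.

Let S (e : R) n := ereal_sup [set separated_sum f F | F in @separated_set R Gamma n e].

Lemma separated_sup_ge0 e n : 0 <= S e n.
Proof.
apply: le_trans (ereal_sup_ubound (_ : _ (separated_sum f set0))).
  by apply: esum_ge0 => p _; rewrite lee_fin prodr_ge0// => k _; exact: expR_ge0.
by exists set0 => //; split.
Qed.

Lemma le_separated_sup (e : R) n F : @separated_set R Gamma n e F ->
  separated_sum f F <= S e n.
Proof. by move=> sF; apply: ereal_sup_ubound; exists F. Qed.

Lemma le_lne_separated (e : R) n (x : R) : (0 < x)%R -> x%:E <= S e n ->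
  (ln x)%:E <= lne (S e n).
Proof.
move=> x0 xS; rewrite -lne_EFin// lee_lne// in_itv/= ?leey ?andbT.
  by rewrite lee_fin ltW.
exact: separated_sup_ge0.
Qed.

Lemma pressure_at_nonincreasing (d e : R) : (d <= e)%R ->
  pressure_at Gamma f e <= pressure_at Gamma f d.
Proof.
move=> de; apply: le_ereal_inf_tmp => _ [V hV <-].
apply: (@le_trans _ _ (ereal_sup ((fun n : nat => n%:R^-1%:E * lne (S e n)) @` V))).
  by apply: ereal_inf_lbound; exists V.
apply: ge_ereal_sup => _ [n Vn <-].
apply: (@le_trans _ _ (n%:R^-1%:E * lne (S d n))); last first.
  by apply: ereal_sup_ubound; exists n.
apply: lee_wpmul2l; first by rewrite lee_fin.
rewrite lee_lne ?in_itv/= ?separated_sup_ge0 ?leey//.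
apply: ge_ereal_sup => _ [F [Fp Fs] <-]; apply: le_separated_sup; split => // p q Fpp Fq pq.
have [[r h]|[r h]] := Fs p q Fpp Fq pq; last by right; exists r.
by left; exists r; exact: le_lt_trans de h.
Qed.

(** A monotone function has a limit at [0], which is its supremum. *)
Lemma pressureE :
  pressure Gamma f = ereal_sup [set pressure_at Gamma f e | e in `]0%R, +oo[%classic].
Proof.
apply/cvg_lim => //; apply: nonincreasing_at_right_cvge => // d e _ _.
exact: pressure_at_nonincreasing.
Qed.

Lemma le_limn_esup (u : nat -> \bar R) (w : nat -> R) (l K : R) :
  w n @[n --> \oo] --> l -> (forall n, (0 < n)%N -> (w n)%:E <= K%:E + u n) ->
  l%:E <= K%:E + limn_esup u.
Proof.
move=> wl wu; rewrite -leeBlDl//; apply: le_ereal_inf_tmp => _ [V [N _ NV] <-].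
apply/lee_addgt0Pr => t t0.
move/cvgrPdist_lt : wl => /(_ _ t0)[M _ hM].
pose n := (maxn N M).+1.
have Vn : V n by apply: NV; rewrite /= /n leqW// leq_maxl.
have Mn : (`|l - w n| < t)%R by apply: hM; rewrite /= /n leqW// leq_maxr.
apply: (@le_trans _ _ (u n + t%:E)); last by rewrite leeD2r//; apply: ereal_sup_ubound; exists n.
have := wu n isT; rewrite -leeBlDl// => h.
apply: (@le_trans _ _ ((w n)%:E - K%:E + t%:E)); last by rewrite leeD2r.
rewrite -!EFinB -EFinD lee_fin; have := ler_norm (l - w n)%R.
by move: Mn; move: `|_|%R => a; lra.
Qed.

End pressure_limit.

Section itinerary_entropy.
Context {R : realType} {Gamma : correspondence R}.
Context (mu : probability (borel (path_space Gamma)) R)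
  (nu : probability (borel (sphere R)) R).
Hypothesis muT : shift_invariant mu.
Hypothesis numu : is_marginal nu mu.

Lemma law_marginal (A : finType) (c : borel (sphere R) -> A) : levels_measurable c ->
  law mu (fun x : borel (path_space Gamma) => c (vertex x 0%N)) = law nu c.
Proof. by move=> mc; apply/funext => a; rewrite /law numu. Qed.

Lemma push_name_coordinate (A : finType) (c : borel (sphere R) -> A) n (i : 'I_n) :
  levels_measurable c ->
  push (fun w : {ffun 'I_n -> A * 'I_(ncomp Gamma)} => w i)
    (law mu (name path_shift (symbol c) n)) = law mu (symbol c).
Proof.
move=> mc; rewrite push_law; last first.
  apply: levels_measurable_name; first exact: measurable_shift_preimage.
  exact: levels_measurable_symbol.
have -> : (fun w : {ffun 'I_n -> A * 'I_(ncomp Gamma)} => w i) \o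
    name path_shift (symbol c) n = symbol c \o iter i path_shift.
  by apply/funext => x /=; rewrite ffunE.
apply/funext => k; rewrite /law -[in RHS](@iter_invariant _ _ _ mu path_shift _ _ i)//.
- exact: measurable_shift_preimage.
- exact: levels_measurable_symbol.
Qed.

Section bound.
Context {A : finType} (f : sphere R -> R) (c : borel (sphere R) -> A)
  (bad : borel (sphere R) -> bool).
Variables (v : A -> R) (delta eta rho : R).
Hypothesis delta0 : 0 <= delta.
Hypothesis rho0 : 0 < rho.
Hypothesis c_good : forall x y z : sphere R, ~~ bad x -> ~~ bad y ->
  mdist x z <= delta -> mdist y z <= delta -> c x = c y.
Hypothesis v_le : forall x, v (c x) <= f x + eta.
Hypothesis f_unif : forall x y : sphere R, mdist x y <= delta -> f x <= f y + eta.
Hypothesis mc : levels_measurable c.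
Hypothesis mbad : levels_measurable bad.

Let code (x : borel (sphere R)) := (c x, bad x).

Let mcode : levels_measurable code.
Proof. exact: levels_measurable_pair. Qed.

Let msymbol : levels_measurable (symbol code : borel (path_space Gamma) -> _).
Proof. exact: levels_measurable_symbol. Qed.

Let W n := {ffun 'I_n -> (A * bool) * 'I_(ncomp Gamma)}.

Let mname n : levels_measurable (name path_shift (symbol code) n : borel (path_space Gamma) -> W n).
Proof.
by apply: levels_measurable_name => //; exact: measurable_shift_preimage.
Qed.

Let mean_letter_weight : \sum_k law mu (symbol code) k * ln (letter_weight v rho k) =
  \sum_a v a * law nu c a + ln rho * law nu bad true.
Proof.
have -> : \sum_a v a * law nu c a = \sum_k law mu (symbol code) k * v k.1.1.
  rewrite -(sum_push (fun k => k.1.1) _ v) push_law// -(law_marginal mc).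
  by apply: eq_bigr => a _; rewrite mulrC.
have -> : ln rho * law nu bad true =
    \sum_k law mu (symbol code) k * (ln rho * (k.1.2)%:R).
  rewrite -(sum_push (fun k => k.1.2) _ (fun b : bool => ln rho * b%:R)) push_law//.
  by rewrite big_bool/= mulr0 mulr0 addr0 mulr1 -(law_marginal mbad) mulrC.
rewrite -big_split/=; apply: eq_bigr => k _; rewrite -mulrDr; congr (_ * _).
rewrite /letter_weight lnM ?posrE ?expR_gt0//; last by case: ifP.
by rewrite expRK; case: ifP => _; rewrite ?mulr1// ln1 mulr0.
Qed.

(** [ent_weight] for the law of the names and the weights [word_weight]; by
    invariance each of the [n] coordinates contributes the same mean of the
    logarithm of [letter_weight]. *)
Lemma itinerary_entropy_le n : exists E : seq (finite_path_type Gamma n),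
  [/\ uniq E, separated_set delta [set` E], 0 < \sum_(p <- E) path_weight f p &
  name_entropy mu path_shift (symbol code) n
    + n%:R * (\sum_a v a * law nu c a + ln rho * law nu bad true) <=
  n%:R * (2 * eta + ln (1 + #|A|%:R * rho)) + ln (\sum_(p <- E) path_weight f p)].
Proof.
have [E [uE sE hE]] := @sum_word_weight R Gamma A f c bad v delta eta rho
  delta0 rho0 c_good v_le f_unif n.
pose p := law mu (name path_shift (symbol code) n : borel (path_space Gamma) -> W n).
have ww w : word_weight c bad v rho w = 0 -> p w = 0 :> R.
  rewrite /word_weight; case: ifP => [_ /eqP|/negP nw _].
    by move=> h; exfalso; move: h; apply/negP; rewrite gt_eqF// prodr_gt0// => i _;
      exact: letter_weight_gt0.
  rewrite /p /law; set B := _ @^-1` _; have -> : B = set0; last by rewrite measure0.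
  apply/seteqP; split => // x /= xw; apply: nw; apply/asboolP; by exists x.
have p0 w : 0 <= p w by exact: law_ge0.
have p1 : \sum_w p w = 1 by apply: law_mass; exact: mname.
have H := @ent_weight R _ p _ p0 p1 (word_weight_ge0 c bad v rho0 (n := n)) ww.
have E1 : \sum_w p w * ln (word_weight c bad v rho w) =
    n%:R * (\sum_a v a * law nu c a + ln rho * law nu bad true).
  rewrite -mean_letter_weight.
  transitivity (\sum_w \sum_(i < n) p w * ln (letter_weight v rho (w i))).
    apply: eq_bigr => w _; rewrite -mulr_sumr.
    have [->|pw] := eqVneq (p w) 0; first by rewrite !mul0r.
    congr (_ * _); have : word_weight c bad v rho w != 0 by apply: contra_neq pw => /ww.
    rewrite /word_weight; case: ifP => [_ _|_]; last by rewrite eqxx.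
    rewrite ln_prod// => i; exact: letter_weight_gt0.
  rewrite exchange_big/= -[X in X%:R * _]card_ord mulr_natl -sumr_const.
  apply: eq_bigr => i _.
  by rewrite -(sum_push (fun w : W n => w i) _ (fun k => ln (letter_weight v rho k)))
    push_name_coordinate.
set Z := \sum_(q <- E) _ in hE *.
have b0 : 0 < expR (2 * eta) * (1 + #|A|%:R * rho).
  by rewrite mulr_gt0 ?expR_gt0// ltr_pwDl// mulr_ge0// ltW.
have S0 : 0 < \sum_(w : W n) word_weight c bad v rho w.
  pose w0 : {ffun 'I_n -> (A * bool) * 'I_(ncomp Gamma)} := name path_shift (symbol code) n (some_path : path_space Gamma).
  rewrite (bigD1 w0)//=; apply: ltr_pwDl.
    rewrite /word_weight asboolT; last by exists (some_path : path_space Gamma).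
    by apply: prodr_gt0 => i _; exact: letter_weight_gt0.
  by apply: sumr_ge0 => w _; exact: word_weight_ge0.
have Z0 : 0 < Z by have := lt_le_trans S0 hE; rewrite pmulr_rgt0// exprn_gt0.
exists E; split => //; rewrite -E1; apply: le_trans H _.
have := hE; rewrite -ler_ln ?posrE// ?mulr_gt0 ?exprn_gt0// => /le_trans; apply.
rewrite lnM ?posrE ?exprn_gt0// lnXn// lnM ?posrE ?expR_gt0//.
  by rewrite expRK -[_ *+ n]mulr_natl.
by rewrite ltr_pwDl// mulr_ge0// ltW.
Qed.

Lemma name_entropy_pressure n : (0 < n)%N ->
  ((n%:R^-1 * name_entropy mu path_shift (symbol code) n
     + \sum_a v a * law nu c a)%:E <=
   (2 * eta + #|A|%:R * rho - ln rho * law nu bad true)%:E +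
   n%:R^-1%:E * lne (ereal_sup [set separated_sum f F
     | F in @separated_set R Gamma n delta]))%E.
Proof.
move=> n0; have [E [uE sE Z0 hE]] := itinerary_entropy_le n.
set Z := \sum_(p <- E) _ in Z0 hE.
have nR : 0 < n%:R :> R by rewrite ltr0n.
have hZ : ((ln Z)%:E <= lne (ereal_sup [set separated_sum f F
     | F in @separated_set R Gamma n delta]))%E.
  apply: le_lne_separated => //.
  by rewrite -separated_sum_seq//; exact: le_separated_sup.
apply: (@le_trans _ _ ((2 * eta + #|A|%:R * rho - ln rho * law nu bad true)%:E
    + n%:R^-1%:E * (ln Z)%:E)%E); last first.
  by apply: leeD2l; apply: lee_wpmul2l => //; rewrite lee_fin invr_ge0.
rewrite -EFinM -EFinD lee_fin -(ler_pM2l nR) mulrDr mulrA divff ?gt_eqF// mul1r.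
rewrite [leRHS]mulrDr mulrA divff ?gt_eqF// mul1r.
have hl : ln (1 + #|A|%:R * rho) <= #|A|%:R * rho.
  apply: le_ln1Dx; apply: lt_le_trans (_ : -1 < 0) _; first by rewrite ltrN10.
  by rewrite mulr_ge0// ltW.
have := ler_wpM2l (ltW nR) hl; move: hE.
rewrite !mulrDr mulrN; move: (n%:R * ln _) (n%:R * (ln _ * _)) => a b.
by move: (n%:R * (\sum__ _)) (n%:R * (_ * rho)) => a' b'; lra.
Qed.

End bound.

(** The name for the coarse code is a function of the name for the fine code. *)
Lemma name_entropy_coarse (A B : finType) (c : borel (sphere R) -> A) (g : A -> B) n :
  levels_measurable c ->
  name_entropy mu path_shift (symbol (g \o c)) n <=
  name_entropy mu path_shift (symbol c) n.
Proof.
move=> mc; pose h (w : {ffun 'I_n -> A * 'I_(ncomp Gamma)}) :=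
  [ffun i => (g (w i).1, (w i).2)].
have mN : levels_measurable (name path_shift (symbol c) n :
    borel (path_space Gamma) -> {ffun 'I_n -> A * 'I_(ncomp Gamma)}).
  apply: levels_measurable_name; first exact: measurable_shift_preimage.
  exact: levels_measurable_symbol.
have E : name path_shift (symbol (g \o c)) n =
    h \o (name path_shift (symbol c) n : borel (path_space Gamma) -> _).
  by apply/funext => x; apply/ffunP => i; rewrite !ffunE.
rewrite /name_entropy E -push_law//; apply: ent_push_le => w; exact: law_ge0.
Qed.

(** [closed_inner_regular] in every cell, with the error shared among the cells. *)
Lemma closed_cells (A : finType) (c : borel (sphere R) -> A) (e : R) :
  levels_measurable c -> 0 < e -> exists F : A -> set (sphere R),
    [/\ forall a, closed (F a), forall a, F a `<=` c @^-1` [set a] &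
        law nu (fun x : borel (sphere R) => ~~ `[< F (c x) x >]) true <= e /\
        levels_measurable (fun x : borel (sphere R) => ~~ `[< F (c x) x >])].
Proof.
move=> mc e0; have e1 : 0 < e / #|A|.+1%:R by rewrite divr_gt0.
have /choice[F hF] := fun a => closed_inner_regular nu (mc a) e1.
have cF a : closed (F a) by have [] := hF a.
have Fc a : F a `<=` c @^-1` [set a] by have [] := hF a.
have mF a : measurable (F a : set (borel (sphere R))) by exact: borel_closed.
pose bad (x : borel (sphere R)) := ~~ `[< F (c x) x >].
have badE : bad @^-1` [set true] = \bigcup_(a in [set: A]) (c @^-1` [set a] `\` F a).
  apply/seteqP; split => x /=; first by move=> /negP h; exists (c x) => //; split => // /asboolP.
  by move=> [a _ [/= <- nF]]; apply/negP => /asboolP.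
have mbT : measurable (bad @^-1` [set true]).
  by rewrite badE; apply: fin_bigcup_measurable => // a _; apply: measurableD.
exists F; split => //; split; last first.
  case => //; have -> : (fun x : borel (sphere R) => ~~ `[< F (c x) x >]) @^-1` [set false] =
      ~` (bad @^-1` [set true]).
    by apply/seteqP; split => x /=; rewrite /bad; case: (~~ _).
  exact: measurableC.
rewrite -lee_fin -/bad /law fineK ?fin_num_measure// badE.
rewrite measure_fin_bigcup//; last 2 first.
- by move=> a b _ _ [x [[/= <- _] [/= <- _]]].
- by move=> a _; apply: measurableD.
apply: (@le_trans _ _ (\sum_(a \in [set: A]) (e / #|A|.+1%:R)%:E)%E).
  by apply: lee_fsum; [exact: finite_finset | move=> a _; have [] := hF a].
rewrite fsumEFin; last exact: finite_finset.
have -> : [set: A] = [set` xpredT] by apply/seteqP.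
rewrite lee_fin -(sum_fsbig xpredT (fun=> e / #|A|.+1%:R)) sumr_const.
rewrite -[leLHS]mulr_natl mulrCA; apply: ler_piMr; first exact: ltW.
by rewrite ler_pdivrMr// mul1r ler_nat leqnSn.
exact: finite_finset.
Qed.

(** The given code is refined by [fine_code], so that the sums of [f] along the
    paths of a cylinder are almost constant; then [name_entropy_pressure] is used
    with a bad set so small that its measure times [ln rho] is negligible. *)
Lemma partition_entropy_le_pressure (f : sphere R -> R) (s : nat)
    (Q : 'I_s -> set (borel (sphere R))) : continuous f -> measurable_partition Q ->
  ((partition_entropy mu Q)%:E + \int[nu]_x (f x)%:E <= pressure Gamma f)%E.
Proof.
move=> fc /partition_code[c0 mc0 ->]; apply/lee_addgt0Pr => t t0.
(* The error is made of four terms, each of them at most [eta]. *)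
pose eta := t / 5; have eta0 : 0 < eta by rewrite divr_gt0.
have [k [c1 [v' [mc1 hv']]]] := fine_code (@sphere_compact R) fc eta0.
pose A := ('I_s * 'I_k)%type.
pose c (x : borel (sphere R)) : A := (c0 x, c1 x).
have mc : levels_measurable c by exact: levels_measurable_pair.
pose v (a : A) := v' a.2.
pose rho := eta / #|{: A}|.+1%:R.
have rho0 : 0 < rho by rewrite divr_gt0.
have Arho : #|{: A}|%:R * rho <= eta.
  rewrite /rho mulrCA; apply: ler_piMr; first exact: ltW.
  by rewrite ler_pdivrMr// mul1r ler_nat leqnSn.
have kappa0 : 0 < eta / (`|ln rho| + 1) by rewrite divr_gt0// ltr_wpDl.
have [F [cF Fc [lbad mbad]]] := closed_cells mc kappa0.
set bad := (fun x => _) in lbad mbad.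
have lnbad : - (ln rho * law nu bad true) <= eta.
  rewrite -mulNr; apply: (@le_trans _ _ ((`|ln rho| + 1) * law nu bad true)).
    rewrite ler_wpM2r ?law_ge0//; apply: le_trans (_ : `|ln rho| <= _).
      by rewrite -normrN ler_norm.
    by rewrite lerDl.
  by rewrite mulrC -ler_pdivlMr// ltr_wpDl.
have dF a b : a != b -> F a `&` F b = set0.
  move=> ab; apply/seteqP; split => // x [/Fc /= xa /Fc /= xb].
  by move: ab; rewrite -xa -xb eqxx.
have [d d0 hd] := finite_gap (@sphere_compact R) cF dF.
have [d' d'0 hd'] := uniform_continuity (@sphere_compact R) fc eta0.
(* Two points within [delta] of a third one are at a distance less than [d]. *)
pose delta := Num.min (d / 3) (d' / 2).
have delta0 : 0 < delta by rewrite lt_min !divr_gt0.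
have dd : delta <= d / 3 by rewrite ge_min lexx.
have dd' : delta < d'.
  by apply: le_lt_trans (_ : d' / 2 < d'); rewrite ?ge_min ?lexx ?orbT// ltr_pdivrMr// ltr_pMr// ltr1n.
have c_good (x y z : sphere R) : ~~ bad x -> ~~ bad y ->
    mdist x z <= delta -> mdist y z <= delta -> c x = c y.
  rewrite /bad !negbK => /asboolP Fx /asboolP Fy xz yz.
  apply: (hd _ _ _ _ Fx Fy); apply: le_lt_trans (metric_triangle x z y) _.
  rewrite (metric_sym z y); move: d0 dd xz yz => *; lra.
have v_le x : v (c x) <= f x + eta by have /andP[] := hv' x.
have f_unif (x y : sphere R) : mdist x y <= delta -> f x <= f y + eta.
  move=> xy; have := hd' x y (le_lt_trans xy dd'); rewrite ler_norml => /andP[_ h].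
  by move: h; lra.
have fint : (\int[nu]_x (f x)%:E <= (\sum_a v a * law nu c a)%:E)%E.
  apply: integral_law_le => //.
  - exact: continuous_borel_measurable.
  - by apply: bounded_continuous => //; exact: sphere_compact.
  - by move=> x; have /andP[] := hv' x.
set I := \sum_a _ in fint.
apply: (@le_trans _ _ ((partition_entropy mu (fun i => c0 @^-1` [set i]) + I)%:E)).
  by rewrite EFinD leeD2l.
apply: (@le_trans _ _ ((4 * eta)%:E + pressure_at Gamma f delta)%E); last first.
  rewrite addeC; apply: leeD; last by rewrite lee_fin /eta; move: t0; lra.
  by rewrite pressureE; apply: ereal_sup_ubound; exists delta => //=; rewrite in_itv/= delta0.
apply: (@le_limn_esup _ _
    (fun n => n%:R^-1 * name_entropy mu path_shift (symbol c0) n + I)).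
  by apply: cvgD; [exact: partition_entropy_cvg | exact: cvg_cst].
move=> n n0; have := @name_entropy_pressure A f c bad v delta eta rho (ltW delta0) rho0
  c_good v_le f_unif mc mbad n n0.
rewrite -/I.
have coarse : name_entropy mu path_shift (symbol c0) n <=
    name_entropy mu path_shift (symbol (fun x => (c x, bad x))) n.
  apply: (@name_entropy_coarse _ _ (fun x => (c x, bad x)) (fun a => a.1.1)).
  exact: levels_measurable_pair.
move=> h; apply: le_trans (le_trans _ h) _.
  by rewrite lee_fin lerD2r ler_wpM2l.
by apply: leeD2r; rewrite lee_fin; move: Arho lnbad; lra.
Qed.

End itinerary_entropy.

(** * Invariant means built on separated sets *)

Section entropy_continuity.
Context {R : realType}.

(** With [s = Num.sqrt y], this is [- ln s <= s^-1] multiplied by [2 s^2]. *)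
Lemma xlnx_le_sqrt (y : R) : 0 <= y <= 1 -> `|y * ln y| <= 2 * Num.sqrt y.
Proof.
move=> /andP[y0 y1]; have [->|yn0] := eqVneq y 0.
  by rewrite mul0r normr0 sqrtr0 mulr0.
have yp : 0 < y by rewrite lt_neqAle eq_sym yn0.
have s0 : 0 < Num.sqrt y by rewrite sqrtr_gt0.
have yE : y = Num.sqrt y * Num.sqrt y by rewrite -expr2 sqr_sqrtr.
rewrite ler0_norm; last by rewrite mulr_ge0_le0// ln_le0.
move: yE s0; set s := Num.sqrt y => yE s0.
have h : - ln s <= s^-1.
  rewrite -lnV ?posrE//; apply: ltW; apply: ln_sublinear; by rewrite invr_gt0.
rewrite yE lnM ?posrE// -mulrN opprD.
apply: (@le_trans _ _ (s * s * (s^-1 + s^-1))).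
  by apply: ler_wpM2l; [rewrite mulr_ge0 ?ltW | exact: lerD].
by rewrite -mulr2n mulrnAr -mulrA divff ?gt_eqF// mulr1 mulr_natl.
Qed.

Lemma cvg_xlnx (T : Type) (F : set_system T) (g : T -> R) (l : R) : Filter F ->
  (forall t, 0 <= g t) -> g @ F --> l -> 0 <= l -> g t * ln (g t) @[t --> F] --> l * ln l.
Proof.
move=> FF g0 gl l0; have [l0'|ln0] := eqVneq l 0; last first.
  have lp : 0 < l by rewrite lt_neqAle eq_sym ln0.
  by apply: cvgM => //; apply: continuous_cvg => //; exact: continuous_ln.
rewrite l0' mul0r; rewrite l0' in gl; apply/cvgrPdist_lt => e e0.
have m0 : 0 < Num.min 1 ((e / 2) ^+ 2) by rewrite lt_min ltr01 exprn_gt0// divr_gt0.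
have := gl; move=> /cvgrPdist_lt/(_ _ m0); apply: filterS => t.
rewrite !sub0r !normrN ger0_norm// lt_min => /andP[h1 h2].
apply: le_lt_trans (xlnx_le_sqrt _) _; first by rewrite g0 ltW.
rewrite mulrC -ltr_pdivlMr//.
have e20 : 0 < e / 2 by rewrite divr_gt0.
by rewrite -(@ltr_pXn2r _ 2) ?nnegrE ?sqrtr_ge0 ?ltW// sqr_sqrtr.
Qed.

Lemma cvg_ent (A : finType) (T : Type) (F : set_system T) (p : T -> A -> R) (l : A -> R) :
  Filter F -> (forall t a, 0 <= p t a) -> (forall a, 0 <= l a) ->
  (forall a, p t a @[t --> F] --> l a) -> ent (p t) @[t --> F] --> ent l.
Proof.
move=> FF p0 l0 pl; rewrite /ent; apply: cvg_big => [|a _]; first exact: add_continuous.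
by apply: cvgN; apply: cvg_xlnx.
Qed.

Lemma ent_push_inj (O A : finType) (X : O -> A) (p : O -> R) :
  injective X -> ent (push X p) = ent p.
Proof.
move=> Xinj; rewrite ent_push; apply: eq_bigr => o _.
by rewrite /push (eq_bigl (pred1 o)) ?big_pred1_eq// => o'; rewrite (inj_eq Xinj).
Qed.

End entropy_continuity.

Section orbit_mean.
Context {R : realType} {X : Type} {O : finType}.
Variables (T : X -> X) (pt : O -> X) (p : O -> R).
Hypothesis p0 : forall o, 0 <= p o.
Hypothesis p1 : \sum_o p o = 1.

Definition orbit_mass k (A : set X) : R :=
  \sum_o p o * (`[< A (iter k T (pt o)) >])%:R.

Let orbit_mass_ge0 k A : 0 <= orbit_mass k A.
Proof. by apply: sumr_ge0 => o _; rewrite mulr_ge0. Qed.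

Let orbit_mass_setT k : orbit_mass k setT = 1.
Proof. by rewrite -p1; apply: eq_bigr => o _; rewrite asboolT// mulr1. Qed.

Let orbit_massU k A B : A `&` B = set0 ->
  orbit_mass k (A `|` B) = orbit_mass k A + orbit_mass k B.
Proof.
move=> AB; rewrite /orbit_mass -big_split/=; apply: eq_bigr => o _.
rewrite -mulrDr; congr (_ * _); set x := iter k T _.
have [Ax|nA] := pselect (A x).
  have nB : ~ B x by move=> Bx; have : (A `&` B) x by []; rewrite AB.
  by rewrite (asboolT Ax) (asboolF nB) asboolT ?addr0//; left.
rewrite (asboolF nA) add0r; congr (nat_of_bool _)%:R.
by apply/asboolP/asboolP => [[]//|Bx]; right.
Qed.

Let orbit_mass_le1 k A : orbit_mass k A <= 1.
Proof.
rewrite -p1; apply: ler_sum => o _; rewrite ler_piMr//.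
by case: `[< _ >]; rewrite ?ler01.
Qed.

Section average.
Variables (n : nat) (n0 : (0 < n)%N).

Let nR : 0 < n%:R :> R. Proof. by rewrite ltr0n. Qed.

Definition orbit_average (A : set X) : R := n%:R^-1 * \sum_(k < n) orbit_mass k A.

Let orbit_average_ge0 A : 0 <= orbit_average A.
Proof. by rewrite mulr_ge0// sumr_ge0. Qed.

Let orbit_average_setT : orbit_average setT = 1.
Proof.
rewrite /orbit_average; under eq_bigr do rewrite orbit_mass_setT.
by rewrite sumr_const card_ord mulVf// gt_eqF.
Qed.

Let orbit_averageU A B : A `&` B = set0 ->
  orbit_average (A `|` B) = orbit_average A + orbit_average B.
Proof.
move=> AB; rewrite /orbit_average -mulrDr -big_split/=; congr (_ * _).
by apply: eq_bigr => k _; exact: orbit_massU.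
Qed.

Definition orbit_mean := Mean orbit_average_ge0 orbit_average_setT orbit_averageU.

Lemma orbit_mean_almost_invariant A :
  `|orbit_mean (T @^-1` A) - orbit_mean A| <= n%:R^-1.
Proof.
rewrite /= /orbit_average -mulrBr -sumrB normrM [`|n%:R^-1|]gtr0_norm ?invr_gt0//.
apply: ler_piMr; first by rewrite invr_ge0 ltW.
have -> : \sum_(k < n) (orbit_mass k (T @^-1` A) - orbit_mass k A) =
    orbit_mass n A - orbit_mass 0 A.
  rewrite -(big_mkord xpredT (fun k => orbit_mass k (T @^-1` A) - orbit_mass k A)).
  exact: (telescope_sumr (fun k => orbit_mass k A)).
have := orbit_mass_ge0 n A; have := orbit_mass_ge0 0 A.
have := orbit_mass_le1 n A; have := orbit_mass_le1 0 A.
by rewrite ler_norml; move: (orbit_mass _ _) (orbit_mass _ _) => *; apply/andP; split; lra.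
Qed.

Lemma orbit_mass_level (A : finType) (C : X -> A) k a :
  orbit_mass k (C @^-1` [set a]) = push (fun o => C (iter k T (pt o))) p a.
Proof.
rewrite /orbit_mass /push [RHS]big_mkcond/=; apply: eq_bigr => o _.
by case: eqP => h; [rewrite asboolT ?mulr1 | rewrite asboolF ?mulr0].
Qed.

Lemma orbit_mean_sum (A : finType) (C : X -> A) (v : A -> R) :
  n%:R * \sum_a v a * orbit_mean (C @^-1` [set a]) =
  \sum_(k < n) \sum_o p o * v (C (iter k T (pt o))).
Proof.
rewrite /= /orbit_average.
under eq_bigr do rewrite mulrCA mulr_sumr.
rewrite -mulr_sumr mulrA divff ?gt_eqF// mul1r exchange_big/=.
apply: eq_bigr => k _; rewrite -sum_push; apply: eq_bigr => a _.
by rewrite mulrC orbit_mass_level.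
Qed.

(** Each of the [n] entropies is at most the cross entropy with respect to the
    average, by Gibbs' inequality, and the cross entropies add up to [n] times the
    entropy of the average. *)
Lemma sum_ent_orbit_mass (A : finType) (C : X -> A) :
  \sum_(k < n) ent (push (fun o => C (iter k T (pt o))) p) <=
  n%:R * ent (fun a => orbit_mean (C @^-1` [set a])).
Proof.
pose g a := orbit_mean (C @^-1` [set a]).
have gE a : n%:R * g a = \sum_(k < n) push (fun o => C (iter k T (pt o))) p a.
  rewrite /g/= /orbit_average mulrA divff ?gt_eqF// mul1r.
  by apply: eq_bigr => k _; rewrite orbit_mass_level.
have push0 k a : 0 <= push (fun o => C (iter k T (pt o))) p a by exact: push_ge0.
apply: (@le_trans _ _ (\sum_(k < n) \sum_a
    - (push (fun o => C (iter k T (pt o))) p a * ln (g a)))).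
  apply: ler_sum => k _; apply: gibbs => //.
  - move=> a; exact: mean_ge0.
  - move=> a ga; have := gE a; rewrite ga mulr0 => /esym/eqP.
    rewrite psumr_eq0// => /allP/(_ k (mem_index_enum _)) /eqP; exact.
  - rewrite push_mass p1.
    have : n%:R * \sum_a g a = n%:R.
      rewrite mulr_sumr; under eq_bigr do rewrite gE.
      rewrite exchange_big/=; under eq_bigr do rewrite push_mass p1.
      by rewrite sumr_const card_ord.
    move=> h; rewrite -(ler_pM2l nR) h mulr1//.
rewrite exchange_big/= /ent mulr_sumr; apply: ler_sum => a _.
rewrite sumrN -mulr_suml -gE mulrN -mulrA; exact: lexx.
Qed.

End average.

(** Names of length [n.+1] separate the points, so that the entropy of long names
    is [ent p]. It is split into blocks of length [q] by [block_average], and the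
    laws of the blocks are averaged by [sum_ent_orbit_mass]. A surplus of [q] comes
    from the block that starts at time [n]. *)
Lemma discrete_entropy (K : finType) (C : X -> K) (n q : nat) (n0 : (0 < n)%N) :
  (0 < q)%N -> injective (fun o => name T C n.+1 (pt o)) ->
  q%:R * ent p <=
  n%:R * ent (fun u => orbit_mean n0 (name T C q @^-1` [set u]))
    + (2 * q%:R ^+ 2 + q%:R) * ln #|K|%:R.
Proof.
move=> q0 inj; pose h i l := ent (push (fun o => name T C l (iter i T (pt o))) p).
have pm (A : finType) (Y : O -> A) : \sum_a push Y p a = 1 by rewrite push_mass.
have pg (A : finType) (Y : O -> A) a : 0 <= push Y p a by exact: push_ge0.
have h0 i l : 0 <= h i l by apply: ent_ge0.
have [i0 _] : exists o : O, True.
  apply: contrapT => /forallNP no; have : \sum_o p o = 0.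
    by apply: big1 => o _; have := no o.
  by rewrite p1 => /eqP; rewrite oner_eq0.
have K0 : 1 <= #|K|%:R :> R.
  by rewrite ler1n; apply/card_gt0P; exists (C (pt i0)).
have L0 : 0 <= ln #|K|%:R :> R by rewrite ln_ge0.
have hL i l : h i l <= l%:R * ln #|K|%:R.
  apply: le_trans (ent_le_ln_card _ _) _ => //.
  by rewrite card_ffun card_ord natrX lnXn ?mulr_natl// (lt_le_trans ltr01).
have hD i l l' : h i (l + l')%N <= h i l + h (i + l)%N l'.
  have -> : h i (l + l')%N = ent (push (@ffun_cat K l l') (push
      (fun o => (name T C l (iter i T (pt o)), name T C l' (iter (i + l) T (pt o)))) p)).
    rewrite push_comp; congr (ent (push _ p)); apply/funext => o /=.
    by rewrite name_cat -iterD (addnC i).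
  by apply: le_trans (ent_push_le _ (pg _ _)) _; apply: ent_join.
have hE j : ent p <= h 0%N (j + n.+1)%N.
  rewrite /h ent_push_inj// => o o' /= oo'; apply: inj; apply/ffunP => i.
  have := congr1 (fun w : {ffun 'I_(j + n.+1) -> K} => w (widen_ord (leq_addl _ _) i)) oo'.
  by rewrite !ffunE.
have b := block_average hD h0 hL L0 q0 hE; rewrite big_ord_recr/= in b.
apply: le_trans b _; rewrite [(_ + _) * ln _]mulrDl [X in _ <= _ + X]addrC [leRHS]addrA lerD2r.
by apply: lerD (hL n q); exact: sum_ent_orbit_mass.
Qed.

End orbit_mean.

Section mean_ultralimit.
Context {R : realType} {X : Type} (m : nat -> mean R X) (U : set_system nat).
Hypothesis UU : UltraFilter U.

Let cvgm A : cvg (m k A @[k --> U]).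
Proof.
apply: (@ultra_bounded_cvg R _ U _ 1) => // k.
by rewrite ger0_norm ?mean_ge0// mean_le1.
Qed.

Definition mean_lim (A : set X) : R := lim (m k A @[k --> U]).

Let mean_lim_ge0 A : 0 <= mean_lim A.
Proof. by apply: limr_ge => //; apply: nearW => k; exact: mean_ge0. Qed.

Let mean_lim_setT : mean_lim setT = 1.
Proof. by rewrite /mean_lim; under eq_fun do rewrite mean_setT; exact: lim_cst. Qed.

Let mean_limU A B : A `&` B = set0 -> mean_lim (A `|` B) = mean_lim A + mean_lim B.
Proof.
move=> AB; rewrite /mean_lim; under eq_fun do rewrite meanU//.
by apply/cvg_lim => //; apply: cvgD; exact: cvgm.
Qed.

Definition mean_ultralimit := Mean mean_lim_ge0 mean_lim_setT mean_limU.

Lemma cvg_mean_ultralimit A : m k A @[k --> U] --> mean_ultralimit A.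
Proof. exact: cvgm. Qed.

End mean_ultralimit.

Section separated_mean.
Context {R : realType} {Gamma : correspondence R}.
Variables (f : sphere R -> R) (a e : R).

(** The sum over a separated set is the supremum of the sums over its finite
    subsets, which are separated as well. *)
Lemma lt_pressure_at N : (a%:E < pressure_at Gamma f e)%E ->
  exists n (E : seq (finite_path_type Gamma n)),
    [/\ (N < n)%N, uniq E, separated_set e [set` E] &
        expR (n%:R * a) < \sum_(p <- E) path_weight f p].
Proof.
move=> ha; pose V := [set n | (N < n)%N].
have VN : \oo V by exists N.+1.
have := lt_le_trans ha (ereal_inf_lbound (_ : _ (ereal_sup ((fun n : nat => n%:R^-1%:E *
  lne (ereal_sup [set separated_sum f F | F in @separated_set R Gamma n e]))%E @` V)))).
move=> /(_ (ex_intro2 _ _ V VN erefl)) /ereal_sup_gt[_ [n Vn <-]] h.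
have n0 : 0 < n%:R :> R by rewrite ltr0n (leq_ltn_trans _ Vn).
have : ((expR (n%:R * a))%:E < ereal_sup [set separated_sum f F
    | F in @separated_set R Gamma n e])%E.
  rewrite ltNge; apply/negP => h'; move: h; apply/negP; rewrite -leNgt.
  apply: (@le_trans _ _ (n%:R^-1%:E * (n%:R * a)%:E)%E).
    apply: lee_wpmul2l; first by rewrite lee_fin invr_ge0 ltW.
    rewrite -[X in (_ <= X%:E)%E]expRK -lne_EFin ?expR_gt0//.
    rewrite lee_lne// ?in_itv/= ?leey ?separated_sup_ge0//.
    by rewrite lee_fin expR_ge0.
  by rewrite -EFinM mulrA mulVf ?gt_eqF// mul1r.
move=> /ereal_sup_gt[_ [F [Fp Fs] <-]] /ereal_sup_gt[_ [D [Dfin DF] <-]] hD.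
exists n, (finmap.enum_fset (fset_set D)); split => //.
- exact: finmap.fset_uniq.
- have DE : [set` finmap.enum_fset (fset_set D)] `<=` F by move=> p /=; rewrite in_fset_set// inE => /DF.
  by split => [p /DE/Fp//|p q /DE Fpp /DE Fq]; exact: Fs.
- by move: hD; rewrite fsbig_finite// sumEFin lte_fin.
Qed.

(** For the distribution proportional to [path_weight] on a separated set [E], the
    entropy plus the mean of the logarithm of [path_weight] is exactly the logarithm
    of the sum of the weights. Two points of [E] have different names as soon as the
    cells have diameter at most [e], so that [discrete_entropy] applies. *)
Lemma separated_mean N : 0 < e -> (a%:E < pressure_at Gamma f e)%E ->
  exists (n : nat) (m : mean R (path_space Gamma)), [/\ (N < n)%N,
    forall B, `|m (path_shift @^-1` B) - m B| <= n%:R^-1 &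
    forall (A : finType) (c : sphere R -> A) (v : A -> R) (q : nat), (0 < q)%N ->
      (forall x y, c x = c y -> mdist x y <= e) -> (forall x, f x <= v (c x)) ->
      q%:R * a <= ent (fun u => m (name path_shift (symbol c) q @^-1` [set u]))
        + q%:R * \sum_b v b * m ((fun x => c (vertex x 0%N)) @^-1` [set b])
        + n%:R^-1 * ((2 * q%:R ^+ 2 + q%:R) * ln #|{: A * 'I_(ncomp Gamma)}|%:R)].
Proof.
move=> e0 /(@lt_pressure_at N)[n [E [Nn uE [Ep Es] hE]]].
set Z := \sum_(p <- E) _ in hE.
have Z0 : 0 < Z by apply: lt_trans hE; exact: expR_gt0.
have n0 : (0 < n)%N by exact: leq_ltn_trans Nn.
have nR : 0 < n%:R :> R by rewrite ltr0n.
pose O := 'I_(size E).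
pose fp (o : O) := tnth (in_tuple E) o.
have fpE o : fp o \in E by exact: mem_tnth.
have /choice[pt hpt] : forall o : O, exists x, restrict_path n x = fp o.
  by move=> o; apply: finite_path_extend; apply: Ep; exact: fpE.
pose p (o : O) := path_weight f (fp o) / Z.
have p0 o : 0 <= p o by rewrite divr_ge0// ltW// path_weight_gt0.
have p1 : \sum_o p o = 1.
  rewrite -mulr_suml; have -> : \sum_o path_weight f (fp o) = Z.
    by rewrite /Z [RHS]big_tnth.
  by rewrite divff// gt_eqF.
exists n, (orbit_mean path_shift pt p0 p1 n0); split => //.
  by move=> B; exact: orbit_mean_almost_invariant.
move=> A c v q q0 mesh fv.
set m := orbit_mean _ _ _ _ _.
have inj : injective (fun o => name path_shift (symbol c) n.+1 (pt o)).
  have /(tuple_uniqP (in_tuple E)) tinj := uE.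
  move=> o o' oo'; apply: tinj.
  have oo'r := fun r => congr1
    (fun w : {ffun 'I_n.+1 -> A * 'I_(ncomp Gamma)} => w r) oo'.
  apply: contrapT => ne; have [] := Es _ _ (fpE o) (fpE o') ne.
    move=> [r]; rewrite -/(fp o) -/(fp o') -!hpt !ffunE ltNge => /negP; apply.
    by apply: mesh; have := oo'r r; rewrite !nameE => -[].
  move=> [r]; rewrite -/(fp o) -/(fp o') -!hpt !ffunE; apply.
  by have := oo'r (widen_ord (leqnSn n) r); rewrite !nameE => -[].
have lnZ : n%:R * a <= ln Z.
  by rewrite -[leLHS]expRK ler_ln ?posrE ?expR_gt0// ltW.
have S : \sum_o p o * ln (path_weight f (fp o)) <=
    n%:R * \sum_b v b * m ((fun x => c (vertex x 0%N)) @^-1` [set b]).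
  rewrite orbit_mean_sum exchange_big/=; apply: ler_sum => o _.
  rewrite -mulr_sumr; apply: ler_wpM2l => //.
  rewrite -hpt path_weight_restrict ln_prod; last by move=> i; exact: expR_gt0.
  by apply: ler_sum => i _; rewrite expRK vertex_iter_shift addn0.
have Eent : ent p + \sum_o p o * ln (path_weight f (fp o)) = ln Z.
  rewrite /ent -big_split/= -[RHS]mul1r -p1 mulr_suml; apply: eq_bigr => o _.
  rewrite /p ln_div ?posrE ?path_weight_gt0//.
  by rewrite mulrBr opprB addrNK.
have D := discrete_entropy p0 p1 n0 q0 inj.
rewrite -/m in D.
set S1 := \sum_o _ in S Eent; set S2 := \sum_b _ in S *.
set H := ent (fun u => _) in D *.
set L := (_ + _) * ln _ in D *.
have h1 : q%:R * (n%:R * a) <= q%:R * (ent p + S1).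
  by apply: ler_wpM2l; rewrite ?ler0n// Eent.
have h2 : q%:R * S1 <= q%:R * (n%:R * S2) by apply: ler_wpM2l; rewrite ?ler0n.
rewrite -(ler_pM2l nR) !(mulrDr n%:R) mulVKf ?gt_eqF//.
rewrite [n%:R * (q%:R * S2)]mulrCA [n%:R * (q%:R * a)]mulrCA.
apply: le_trans h1 _; rewrite mulrDr.
by apply: le_trans (lerD D h2) _; rewrite addrAC.
Qed.

End separated_mean.

Section limit_mean.
Context {R : realType} {Gamma : correspondence R}.
Variables (f : sphere R -> R) (a e : R).

(** Means on all sets are bounded, hence converge along an ultrafilter; their
    defects of invariance and the last term of [separated_mean] tend to [0]. *)
Lemma limit_mean : 0 < e -> (a%:E < pressure_at Gamma f e)%E ->
  exists m : mean R (path_space Gamma),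
    (forall B, m (path_shift @^-1` B) = m B) /\
    forall (A : finType) (c : sphere R -> A) (v : A -> R) (q : nat), (0 < q)%N ->
      (forall x y, c x = c y -> mdist x y <= e) -> (forall x, f x <= v (c x)) ->
      q%:R * a <= ent (fun u => m (name path_shift (symbol c) q @^-1` [set u]))
        + q%:R * \sum_b v b * m ((fun x => c (vertex x 0%N)) @^-1` [set b]).
Proof.
move=> e0 ha; have /choice[nm hnm] : forall N, exists nm : nat * mean R (path_space Gamma),
    [/\ (N < nm.1)%N,
    forall B, `|nm.2 (path_shift @^-1` B) - nm.2 B| <= nm.1%:R^-1 &
    forall (A : finType) (c : sphere R -> A) (v : A -> R) (q : nat), (0 < q)%N ->
      (forall x y, c x = c y -> mdist x y <= e) -> (forall x, f x <= v (c x)) ->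
      q%:R * a <= ent (fun u => nm.2 (name path_shift (symbol c) q @^-1` [set u]))
        + q%:R * \sum_b v b * nm.2 ((fun x => c (vertex x 0%N)) @^-1` [set b])
        + nm.1%:R^-1 * ((2 * q%:R ^+ 2 + q%:R) * ln #|{: A * 'I_(ncomp Gamma)}|%:R)].
  by move=> N; have [n [m h]] := separated_mean N e0 ha; exists (n, m).
have [U [UU ooU]] := @ultraFilterLemma nat \oo _.
have FU : ProperFilter U by exact: ultra_proper.
have inv0 : ((nm N).1%:R^-1 : R) @[N --> U] --> (0 : R).
  apply: cvg_trans (_ : ((nm N).1%:R^-1 : R) @[N --> \oo] --> 0).
    by apply: cvg_app; exact: ooU.
  apply: (@squeeze_cvgr _ _ _ _ (fun=> 0) (fun N => N.+1%:R^-1)).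
  - near=> N; rewrite invr_ge0 ler0n/= lef_pV2 ?posrE ?ltr0n//.
      by rewrite ler_nat; have [] := hnm N.
    by have [h _ _] := hnm N; exact: leq_ltn_trans h.
  - exact: cvg_cst.
  - exact: cvg_harmonic.
pose m := mean_ultralimit (fun N => (nm N).2) UU.
have cm B : (nm N).2 B @[N --> U] --> m B by exact: cvg_mean_ultralimit.
exists m; split.
  move=> B; apply/eqP; rewrite -subr_eq0; apply/eqP.
  have : (nm N).2 (path_shift @^-1` B) - (nm N).2 B @[N --> U] --> m (path_shift @^-1` B) - m B.
    exact: cvgB.
  move=> /cvg_lim <- //; apply/cvg_lim => //; apply/norm_cvg0P.
  apply: (@squeeze_cvgr _ _ _ _ (fun=> 0) (fun N => (nm N).1%:R^-1)) => //.
  - by apply: nearW => N; rewrite normr_ge0/=; have [] := hnm N.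
  - exact: cvg_cst.
move=> A c v q q0 mesh fv; pose L : R := (2 * q%:R ^+ 2 + q%:R) * ln #|{: A * 'I_(ncomp Gamma)}|%:R.
have C : ent (fun u => (nm N).2 (name path_shift (symbol c) q @^-1` [set u]))
    + q%:R * \sum_b v b * (nm N).2 ((fun x => c (vertex x 0%N)) @^-1` [set b])
    + (nm N).1%:R^-1 * L @[N --> U] -->
  ent (fun u => m (name path_shift (symbol c) q @^-1` [set u]))
    + q%:R * \sum_b v b * m ((fun x => c (vertex x 0%N)) @^-1` [set b]) + 0 * L.
  apply: cvgD; last by apply: cvgM; [exact: inv0 | exact: cvg_cst].
  apply: cvgD.
    by apply: cvg_ent => // *; exact: mean_ge0.
  apply: cvgM; first exact: cvg_cst.
  apply: cvg_big => [|b _]; first exact: add_continuous.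
  by apply: cvgM; [exact: cvg_cst | exact: cm].
rewrite mul0r addr0 in C; rewrite -(cvg_lim (@Rhausdorff R) C); apply: limr_ge.
  by apply/cvg_ex; eexists; exact: C.
by apply: nearW => N; have [_ _ h] := hnm N; exact: (h A c v q q0 mesh fv).
Unshelve. all: by end_near. Qed.

End limit_mean.

(** * Partitions with null boundaries *)

Section null_boundary.
Context {R : realType} {X : pointedMetricType R} (mu : probability (borel X) R).

(** [U] and [F] stand for the interior and the closure; leaving them free makes the
    stability under boolean operations and preimages immediate. *)
Definition null_boundary (A : set X) := exists U F : set X,
  [/\ open U, closed F, U `<=` A, A `<=` F & mu (F `\` U : set (borel X)) = 0%E].

Lemma null_boundary_clopen A : open A -> closed A -> null_boundary A.
Proof. by move=> oA cA; exists A, A; split => //; rewrite setDv measure0. Qed.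

Lemma null_boundaryC A : null_boundary A -> null_boundary (~` A).
Proof.
move=> [U [F [oU cF UA AF m0]]]; exists (~` F), (~` U); split.
- exact: closed_openC.
- exact: open_closedC.
- exact: subsetC.
- exact: subsetC.
- by rewrite setDE setCK setIC -setDE.
Qed.

Lemma null_boundaryI A B : null_boundary A -> null_boundary B -> null_boundary (A `&` B).
Proof.
move=> [U [F [oU cF UA AF m0]]] [V [G [oV cG VB BG n0]]].
exists (U `&` V), (F `&` G); split.
- exact: openI.
- exact: closedI.
- exact: setISS.
- exact: setISS.
- have mFU : measurable (F `\` U : set (borel X)).
    by apply: measurableD; [exact: borel_closed | exact: borel_open].
  have mGV : measurable (G `\` V : set (borel X)).
    by apply: measurableD; [exact: borel_closed | exact: borel_open].
  apply: (@subset_measure0 _ _ _ mu _ ((F `\` U) `|` (G `\` V))).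
  + apply: measurableD; first exact: (borel_closed (closedI cF cG)).
    exact: (borel_open (openI oU oV)).
  + exact: measurableU.
  + move=> x [[Fx Gx] nUV]; have [Ux|nU] := pselect (U x); last by left.
    by right; split => // Vx; apply: nUV.
  + exact: etrans (measureU0 mFU mGV n0) m0.
Qed.

Lemma null_boundary_forall (I : finType) (A : I -> set X) :
  (forall i, null_boundary (A i)) -> null_boundary [set x | forall i, A i x].
Proof.
move=> hA; have h (s : seq I) : null_boundary [set x | forall i, i \in s -> A i x].
  elim: s => [|i s IH].
    have -> : [set x | forall i, i \in [::] -> A i x] = [set: X] by apply/seteqP; split.
    by apply: null_boundary_clopen; [exact: openT | exact: closedT].
  have -> : [set x | forall j, j \in i :: s -> A j x] =
      A i `&` [set x | forall j, j \in s -> A j x].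
    apply/seteqP; split => x /= => [h|[Ai h] j].
      by split; [apply: h; rewrite mem_head | move=> j js; apply: h; rewrite in_cons js orbT].
    by rewrite in_cons => /orP[/eqP ->|/h].
  exact: null_boundaryI.
have -> : [set x | forall i, A i x] = [set x | forall i, i \in enum I -> A i x].
  apply/seteqP; split => x /= => [h' i _|h' i]; first exact: h'.
  by apply: h'; rewrite mem_enum.
exact: h.
Qed.

(** With [U] and [F] as in [null_boundary], [mu U <= m U <= m A <= m F <= mu F], the
    last inequality being the hypothesis on open sets for the complement of [F]. *)
Lemma regular_null_boundary (m : mean R X) (A : set (borel X)) :
  (forall U : set X, open U -> (mu U <= (m U)%:E)%E) ->
  measurable A -> null_boundary A -> fine (mu A) = m A.
Proof.
move=> mum mA [U [F [oU cF UA AF m0]]].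
have fin (B : set (borel X)) : measurable B -> (fine (mu B))%:E = mu B.
  by move=> mB; rewrite fineK// fin_num_measure.
have mU : measurable (U : set (borel X)) by exact: borel_open.
have mF : measurable (F : set (borel X)) by exact: borel_closed.
have FU : mu F = mu U.
  have mFU : measurable (F `\` U : set (borel X)) by exact: measurableD.
  rewrite -[RHS](measureU0 mU mFU m0) setDUK//; exact: subset_trans UA AF.
have UmA : (mu U <= mu A)%E by apply: le_measure; rewrite ?inE.
have AmF : (mu A <= mu F)%E by apply: le_measure; rewrite ?inE.
have mUA : mu A = mu U by apply/eqP; rewrite eq_le UmA andbT -FU.
apply/eqP; rewrite eq_le; apply/andP; split.
  rewrite mUA -lee_fin fin//; apply: le_trans (mum _ oU) _.
  by rewrite lee_fin le_mean.
have := mum _ (closed_openC cF); rewrite probability_setC// mean_setC.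
rewrite -(fin F)// -EFinB lee_fin lerD2l lerN2 => h.
by rewrite mUA -FU; apply: le_trans h; exact: le_mean.
Qed.

(** The spheres around [x] are disjoint, hence only countably many of them have
    positive measure: for each [k], at most [k.+1] have measure at least
    [k.+1%:R^-1]. *)
Lemma null_sphere (x : X) (e : R) : 0 < e ->
  exists2 r : R, 0 < r < e & mu ([set y | mdist x y = r] : set (borel X)) = 0%E.
Proof.
move=> e0; apply: contrapT => no.
pose S r : set (borel X) := [set y | mdist x y = r].
have mS r : measurable (S r).
  apply: borel_closed; apply: (@closed_comp _ _ (fun y => mdist x y) [set r]).
    by move=> y _; exact: continuous_mdist.
  exact: closed_eq.
pose B k := [set r | 0 < r < e /\ (k.+1%:R^-1 <= fine (mu (S r)))].
have finB k : finite_set (B k).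
  apply: contrapT => /(infinite_set_fset k.+2)[D DB kD].
  have : (mu (\big[setU/set0]_(r <- finmap.enum_fset D) S r) <= 1)%E.
    by apply: probability_le1; apply: bigsetU_measurable => r _; exact: mS.
  rewrite measure_fbigsetU//; last by move=> r s _ _ [y [/= <- <-]].
  apply/negP; rewrite -ltNge.
  apply: (@lt_le_trans _ _ (\sum_(r <- finmap.enum_fset D) (k.+1%:R^-1)%:E)%E).
    rewrite sumEFin lte_fin big_const_seq count_predT iter_addr addr0 -[ltRHS]mulr_natl.
    rewrite ltr_pdivlMr// mul1r ltr_nat; exact: kD.
  rewrite big_seq [leRHS]big_seq; apply: lee_sum => r rD.
  by have [_ h] := DB r rD; rewrite -[leRHS]fineK ?lee_fin// fin_num_measure.
have cB : countable (\bigcup_k B k).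
  by apply: bigcup_countable => // k _; exact: finite_set_countable.
have sub : `]0, e[ `<=` \bigcup_k B k.
  move=> r; rewrite /= in_itv/= => re.
  have pos : 0 < fine (mu (S r)).
    rewrite lt_neqAle fine_ge0// andbT; apply/negP => /eqP h; apply: no; exists r => //.
    by rewrite -/(S r) -[LHS]fineK ?fin_num_measure// -h.
  exists (Num.truncn (fine (mu (S r)))^-1) => //; split => //.
  by rewrite invf_ple ?posrE ?ltr0n// ltW// truncnS_gt.
have := countable_lebesgue_measure0 (sub_countable (subset_card_le sub) cB).
rewrite lebesgue_measure_itv/= lte_fin e0 -EFinD subr0 => /eqP.
by rewrite eqe gt_eqF.
Qed.

Lemma null_boundary_ball (x : X) (r : R) :
  mu ([set y | mdist x y = r] : set (borel X)) = 0%E ->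
  null_boundary [set y | mdist x y < r].
Proof.
move=> m0; exists [set y | mdist x y < r], [set y | mdist x y <= r]; split => //.
- exact: open_mball.
- apply: (@closed_comp _ _ (fun y => mdist x y) [set t | t <= r]); last exact: closed_le.
  by move=> y _; exact: continuous_mdist.
- by move=> y /=; exact: ltW.
- rewrite -m0; congr (mu _); apply/seteqP; split => y /=.
    by move=> [h /negP]; rewrite -leNgt => h'; apply/eqP; rewrite eq_le h.
  by move=> ->; split => //; rewrite ltxx.
Qed.

(** The space is covered by finitely many small balls with negligible spheres, and
    the code records for each of them whether the point belongs to it; the cells are
    intersections of balls and of complements of balls. *)
Lemma null_boundary_code (e : R) : compact [set: X] -> 0 < e ->
  exists (k : nat) (c : borel X -> {ffun 'I_k -> bool}),
    [/\ levels_measurable c, forall w, null_boundary (c @^-1` [set w]) &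
        forall x y : X, c x = c y -> mdist x y <= e].
Proof.
move=> Xc e0; have e20 : 0 < e / 2 by rewrite divr_gt0.
have /choice[r hr] : forall x : X, exists r : R, 0 < r < e / 2 /\
    mu ([set y | mdist x y = r] : set (borel X)) = 0%E.
  by move=> x; have [r r0 h] := null_sphere x e20; exists r.
move: Xc; rewrite compact_cover => /(_ X setT (fun x => [set y | mdist x y < r x])) [].
- by move=> x _; exact: open_mball.
- by move=> x _; exists x => //=; rewrite mdistxx; have [/andP[]] := hr x.
move=> D _ XD; pose s := finmap.enum_fset D; pose z (i : 'I_(size s)) := tnth (in_tuple s) i.
pose c (x : borel X) : {ffun 'I_(size s) -> bool} := [ffun i => mdist (z i) x < r (z i)].
have cE w : c @^-1` [set w] = [set x : X | forall i, [set x : X | (mdist (z i) x < r (z i)) = w i] x].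
  apply/seteqP; split => x /= => [<- i|h]; first by rewrite ffunE.
  by apply/ffunP => i; rewrite ffunE; exact: h.
have lev (i : 'I_(size s)) (b : bool) : [set x : X | (mdist (z i) x < r (z i)) = b] =
    if b then [set x : X | mdist (z i) x < r (z i)] else ~` [set x : X | mdist (z i) x < r (z i)].
  case: b; apply/seteqP; split => x //=; first by move=> ->.
  by move=> /negP/negbTE.
exists (size s), c; split.
- move=> w; rewrite cE; have -> : [set x : X | forall i,
      [set x : X | (mdist (z i) x < r (z i)) = w i] x] =
      \bigcap_(i in [set: 'I_(size s)]) [set x : X | (mdist (z i) x < r (z i)) = w i].
    by apply/seteqP; split => x /= h i; [move=> _; exact: h | exact: (h i I)].
  apply: fin_bigcap_measurable => // i _; rewrite lev.
  have mb : measurable ([set x : X | mdist (z i) x < r (z i)] : set (borel X)).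
    by apply: borel_open; exact: open_mball.
  by case: (w i) => //; exact: measurableC.
- move=> w; rewrite cE; apply: null_boundary_forall => i; rewrite lev.
  have nb := null_boundary_ball (hr (z i)).2.
  by case: (w i) => //; exact: null_boundaryC.
- move=> x y xy; have [u us xu] := XD x I.
  have /tnthP[i ui] : u \in in_tuple s by exact: us.
  have xi : c x i by rewrite ffunE /z -ui.
  have yi : c y i by rewrite -xy.
  rewrite ffunE in xi; rewrite ffunE in yi.
  have [/andP[_ rz] _] := hr (z i).
  apply: le_trans (metric_triangle x (z i) y) _; rewrite (metric_sym x (z i)).
  by rewrite [leRHS]splitr; apply: lerD; apply: ltW; [exact: lt_trans xi rz | exact: lt_trans yi rz].
Qed.

End null_boundary.

(** Renumbers the values that are attained, because the cells of a partition are
    nonempty. *)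
Lemma surjective_code (X : pointedType) (A : finType) (c : X -> A) :
  exists (s : nat) (c' : X -> 'I_s) (g : 'I_s -> A),
    [/\ c = g \o c', injective g & forall i, exists x, c' x = i].
Proof.
pose S := [set a : A | `[< exists x, c x = a >]]%SET.
have cS x : c x \in S by rewrite inE; apply/asboolP; exists x.
exists #|S|, (fun x => enum_rank_in (cS point) (c x)), enum_val; split.
- by apply/funext => x /=; rewrite enum_rankK_in.
- exact: enum_val_inj.
- move=> i; have := enum_valP i; rewrite inE => /asboolP[x cx]; exists x.
  by apply: enum_val_inj; rewrite enum_rankK_in.
Qed.

Section lower_bound.
Context {R : realType} {Gamma : correspondence R}.

Lemma null_boundary_preimage (X Y : pointedMetricType R) (mu : probability (borel X) R)
    (nu : probability (borel Y) R) (g : X -> Y) (A : set Y) : continuous g ->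
  (forall B : set (borel Y), measurable B -> nu B = mu (g @^-1` B)) ->
  null_boundary nu A -> null_boundary mu (g @^-1` A).
Proof.
move=> gc gnu [U [F [oU cF UA AF m0]]]; exists (g @^-1` U), (g @^-1` F); split.
- by apply: open_comp => // x _; exact: gc.
- by apply: closed_comp => // x _; exact: gc.
- by move=> x /UA.
- by move=> x /AF.
- by rewrite -m0 gnu//; apply: measurableD; [exact: borel_closed | exact: borel_open].
Qed.

Variables (mu : probability (borel (path_space Gamma)) R).
Hypothesis muT : shift_invariant mu.

Lemma exists_marginal : exists nu : probability (borel (sphere R)) R, is_marginal nu mu.
Proof.
pose g : borel (path_space Gamma) -> borel (sphere R) := fun x => vertex x 0%N.
have mg : measurable_fun setT g.
  move=> _ B mB; rewrite setTI; apply: (@borel_preimage R (path_space Gamma) (sphere R)) => //.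
  exact: continuous_vertex.
pose G : {mfun borel (path_space Gamma) >-> borel (sphere R)} :=
  HB.pack_for {mfun borel (path_space Gamma) >-> borel (sphere R)} g
    (isMeasurableFun.Build _ _ _ _ g mg).
by exists (distribution mu G).
Qed.

Lemma null_boundary_name (nu : probability (borel (sphere R)) R) (A : finType)
    (c : sphere R -> A) n (w : {ffun 'I_n -> A * 'I_(ncomp Gamma)}) :
  is_marginal nu mu -> (forall a, null_boundary nu (c @^-1` [set a])) ->
  null_boundary mu (name path_shift (symbol c) n @^-1` [set w]).
Proof.
move=> numu cnb.
have vnb r a : null_boundary mu ((fun x : path_space Gamma => vertex x r) @^-1` (c @^-1` [set a])).
  apply: null_boundary_preimage (cnb a); first exact: continuous_vertex.
  move=> B mB; rewrite numu// -(@iter_invariant _ _ _ mu path_shift _ _ r)//.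
  - by congr (mu _); apply/seteqP; split => x /=; rewrite vertex_iter_shift addn0.
  - exact: measurable_shift_preimage.
  - by apply: (@borel_preimage R (path_space Gamma) (sphere R)) => //; exact: continuous_vertex.
have lnb r t : null_boundary mu [set x : path_space Gamma | letter x r = t].
  apply: null_boundary_clopen; first exact: open_letter.
  have -> : [set x : path_space Gamma | letter x r = t] =
      ~` (\bigcup_(t' in [set t' | t' != t]) [set x : path_space Gamma | letter x r = t']).
    apply/seteqP; split => x /=; first by move=> <- [t' /= h h']; move: h; rewrite h' eqxx.
    by move=> h; apply: contrapT => h'; apply: h; exists (letter x r) => //=; apply/eqP.
  by apply: open_closedC; apply: bigcup_open => t' _; exact: open_letter.
have -> : name path_shift (symbol c) n @^-1` [set w] = [set x | forall i : 'I_n,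
   (((fun x : path_space Gamma => vertex x i) @^-1` (c @^-1` [set (w i).1]))
     `&` [set x : path_space Gamma | letter x i = (w i).2]) x].
  apply/seteqP; split => x /= => [<- i|h]; first by rewrite nameE.
  by apply/ffunP => i; rewrite nameE; have [-> ->] := h i; case: (w i).
by apply: null_boundary_forall => i; apply: null_boundaryI.
Qed.

End lower_bound.

Section pressure_sup.
Context {R : realType} {Gamma : correspondence R}.

(** The inequality of [limit_mean] only involves the means of cylinders over the
    cells of a code, which are their measures if the cells have negligible boundary.
    Dividing by the length [q] of the names and letting it tend to infinity gives
    the entropy of the partition. *)
Lemma pressure_at_le_sup (f : sphere R -> R) (e a : R) : continuous f -> 0 < e ->
  (a%:E < pressure_at Gamma f e)%E -> forall eta : R, 0 < eta ->
  exists (mu : probability (borel (path_space Gamma)) R)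
         (nu : probability (borel (sphere R)) R), [/\ shift_invariant mu, is_marginal nu mu &
    (a%:E <= pair_entropy nu mu + \int[nu]_x (f x)%:E + (2 * eta)%:E)%E].
Proof.
move=> fc e0 ha eta eta0; have [m [mT hm]] := limit_mean e0 ha.
have [mu [mum muT']] := exists_regular_probability m (@path_space_compact R Gamma).
have muT : shift_invariant mu.
  by move=> B mB; apply: muT' => //; exact: continuous_path_shift.
have [nu numu] := exists_marginal mu.
exists mu, nu; split => //.
have [d d0 hd] := uniform_continuity (@sphere_compact R) fc eta0.
pose mesh := Num.min e (d / 2).
have mesh0 : 0 < mesh by rewrite lt_min e0 divr_gt0.
have [k [c0 [mc0 nc0 hc0]]] := null_boundary_code nu (@sphere_compact R) mesh0.
have [s [c [g [c0E ginj csurj]]]] := surjective_code (c0 : sphere R -> _).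
have clev i : c @^-1` [set i] = c0 @^-1` [set g i].
  by rewrite c0E; apply/seteqP; split => x /= => [->//|/ginj].
have mc : levels_measurable (c : borel (sphere R) -> 'I_s) by move=> i; rewrite clev; exact: mc0.
have nc i : null_boundary nu (c @^-1` [set i]) by rewrite clev; exact: nc0.
have cmesh x y : c x = c y -> mdist x y <= mesh.
  by move=> cxy; apply: hc0; rewrite c0E /= cxy.
have /choice[rep hrep] := csurj.
pose v i := f (rep i) + eta.
have fv x : `|f x - f (rep (c x))| <= eta.
  apply: hd; apply: le_lt_trans (cmesh _ _ (esym (hrep (c x)))) _.
  by apply: le_lt_trans (_ : d / 2 < d); rewrite ?ge_min ?lexx ?orbT// ltr_pdivrMr// ltr_pMr// ltr1n.
have fv1 x : f x <= v (c x).
  by have := fv x; rewrite ler_norml /v => /andP[_ h]; move: h; lra.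
have fv2 x : v (c x) - 2 * eta <= f x.
  by have := fv x; rewrite ler_norml /v => /andP[h _]; move: h; lra.
pose Q (i : 'I_s) : set (borel (sphere R)) := c @^-1` [set i].
have mQ : measurable_partition Q.
  split; last exact: mc.
  split; first by apply/seteqP; split => // x _; exists (c x).
  - by move=> i j _ _ [x [/= <- <-]].
  - by move=> i _; exists (rep i); exact: hrep.
have muname q w : fine (mu (name path_shift (symbol c) q @^-1` [set w])) =
    m (name path_shift (symbol c) q @^-1` [set w]).
  apply: (regular_null_boundary mum).
    apply: levels_measurable_name; first exact: measurable_shift_preimage.
    exact: levels_measurable_symbol.
  exact: null_boundary_name numu nc.
have muv i : law nu c i = m ((fun x => c (vertex x 0%N)) @^-1` [set i]).
  rewrite -(law_marginal numu mc); apply: (regular_null_boundary mum).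
    apply: (@borel_preimage R (path_space Gamma) (sphere R)) (mc i).
    exact: continuous_vertex.
  apply: null_boundary_preimage (nc i); last exact: numu.
  exact: continuous_vertex.
pose I := \sum_i v i * law nu c i.
have key q : (0 < q)%N -> a <= q%:R^-1 * name_entropy mu path_shift (symbol c) q + I.
  move=> q0; have qR : 0 < q%:R :> R by rewrite ltr0n.
  rewrite -(ler_pM2l qR) mulrDr mulVKf ?gt_eqF//.
  apply: le_trans (hm _ c v q q0 _ fv1) _.
    by move=> x y /cmesh/le_trans; apply; rewrite ge_min lexx.
  apply: lerD.
    rewrite le_eqVlt; apply/orP; left; apply/eqP; congr ent; apply/funext => w.
    by rewrite /law muname.
  rewrite ler_pM2l//; apply: ler_sum => i _; by rewrite muv.
have lim : (a%:E <= 0%:E + (partition_entropy mu Q + I)%:E)%E.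
  rewrite add0e lee_fin.
  have C : n%:R^-1 * name_entropy mu path_shift (symbol c) n + I @[n --> \oo] -->
      partition_entropy mu Q + I.
    by apply: cvgD; [exact: partition_entropy_cvg | exact: cvg_cst].
  rewrite -(cvg_lim (@Rhausdorff R) C); apply: limr_ge.
    by apply/cvg_ex; eexists; exact: C.
  by exists 1%N => // n /= n1; exact: key.
apply: le_trans lim _; rewrite add0e.
have h1 : ((partition_entropy mu Q)%:E <= pair_entropy nu mu)%E.
  by apply: ereal_sup_ubound; exists s, Q.
have h2 : ((\sum_i (v i - 2 * eta) * law nu c i)%:E <= \int[nu]_x (f x)%:E)%E.
  apply: integral_law_ge => //.
  - exact: continuous_borel_measurable.
  - by apply: bounded_continuous => //; exact: sphere_compact.
have -> : I = \sum_i (v i - 2 * eta) * law nu c i + 2 * eta.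
  rewrite -[X in _ = _ + X]mulr1 -(law_mass nu mc) mulr_sumr -big_split/=.
  by apply: eq_bigr => i _; rewrite mulrBl subrK.
rewrite addrA !EFinD; apply: leeD2r; exact: leeD.
Qed.

End pressure_sup.

(** * The variational principle *)

Lemma integral_fin_num (R : realType) (f : sphere R -> R)
    (nu : probability (borel (sphere R)) R) : continuous f ->
  (\int[nu]_x (f x)%:E \is a fin_num)%E.
Proof.
move=> fc; apply: integrable_fin_num => //.
apply: (@measurable_bounded_integrable _ _ _ nu f setT) => //.
- by rewrite -ge0_fin_numE// fin_num_measure.
- exact: continuous_borel_measurable.
- by apply: bounded_continuous => //; exact: sphere_compact.
Qed.

Theorem theorem5p2 (R : realType) (Gamma : correspondence R)
    (f : sphere R -> R) (f_continuous : continuous f) :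
  pressure Gamma f =
  ereal_sup [set (measure_entropy Gamma nu + \int[nu]_x (f x)%:E)%E
    | nu in marginals Gamma].
Proof.
apply/eqP; rewrite eq_le; apply/andP; split.
  rewrite pressureE; apply: ge_ereal_sup => _ [e /= + <-].
  rewrite in_itv/= andbT => e0.
  set S := ereal_sup _; rewrite leNgt; apply/negP => SP.
  have [a Sa aP] : exists2 a : R, (S < a%:E)%E & (a%:E < pressure_at Gamma f e)%E.
    case: (pressure_at Gamma f e) S SP => [p| |] [r| |] //=.
    - by rewrite lte_fin => rp; exists ((r + p) / 2); rewrite lte_fin ?midf_lt.
    - by move=> _; exists (p - 1); rewrite ?ltNyr// lte_fin ltrBlDr ltrDl.
    - by move=> _; exists (r + 1); rewrite ?ltry// lte_fin ltrDl.
    - by move=> _; exists 0; rewrite ?ltry ?ltNyr.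
  move: Sa; apply/negP; rewrite -leNgt; apply/lee_addgt0Pr => t t0.
  have t20 : 0 < t / 2 by rewrite divr_gt0.
  have [mu [nu [muT numu h]]] := pressure_at_le_sup f_continuous e0 aP t20.
  apply: le_trans h _; have -> : 2 * (t / 2) = t by rewrite mulrC divfK.
  apply: leeD2r; apply: (@le_trans _ _ (measure_entropy Gamma nu + \int[nu]_x (f x)%:E)%E).
    by apply: leeD2r; apply: ereal_sup_ubound; exists mu.
  by apply: ereal_sup_ubound; exists nu => //; exists mu.
apply: ge_ereal_sup => _ [nu _ <-].
rewrite -leeBrDr ?integral_fin_num//; apply: ge_ereal_sup => _ [mu [muT numu] <-].
apply: ge_ereal_sup => _ [s [Q [mQ ->]]]; rewrite leeBrDr ?integral_fin_num//.
exact: partition_entropy_le_pressure.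
Qed.
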